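(* Let $\alpha>0$. Suppose that $\mu$ is an even nonzero finite Borel measure on $\mathbb{R}^n$ such that $\mu$ is not concentrated in any proper linear subspace of $\mathbb{R}^n$ and the first moment of $\mu$ is finite, i.e. $\int_{\mathbb{R}^n}|x|\,d\mu(x)<\infty$. Then there exists a log-concave function $f\in\mathrm{LC}_n$ with $\mathcal{I}_\alpha(f)=\int_{\mathbb{R}^n}d\mu$ such that $\mu=\mathfrak{R}_\alpha(f,\cdot)$.
   Context: $n\ge 1$. A log-concave function is a function $f=e^{-\varphi}:\mathbb{R}^n\to[0,\infty)$ with $\varphi:\mathbb{R}^n\to\mathbb{R}\cup\{+\infty\}$ convex. $\mathrm{LC}_n$ is the set of upper semi-continuous log-concave functions $f$ with $0<\int_{\mathbb{R}^n} f\,dx<\infty$. For $\alpha>0$, the Riesz $\alpha$-potential of $f$ is $I_\alpha(f,y)=\int_{\mathbb{R}^n}\frac{f(x)}{|x-y|^{n-\alpha}}\,dx$, and the Riesz $\alpha$-energy is $\mathcal{I}_\alpha(f)=\int_{\mathbb{R}^n}I_\alpha(f,y)f(y)\,dy$. $K_f=\overline{\{x: f(x)>0\}}$; $\varphi$ is differentiable a.e. in the interior of $K_f$. For $f=e^{-\varphi}\in\mathrm{LC}_n$, the Riesz $\alpha$-energy measure $\mathfrak{R}_\alpha(f,\cdot)$ is the Borel measure on $\mathbb{R}^n$ which is the push-forward of the measure $I_\alpha(f,y)f(y)\,dy$ under $\nabla\varphi$, i.e. $\int_{\mathbb{R}^n}\mathbf{h}(z)\,d\mathfrak{R}_\alpha(f,z)=\int_{K_f}\mathbf{h}(\nabla\varphi(y))I_\alpha(f,y)f(y)\,dy$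 for every Borel function $\mathbf{h}:\mathbb{R}^n\to\mathbb{R}$ that is non-negative or in $\mathcal{L}^1(\mathfrak{R}_\alpha(f,\cdot))$. A measure $\mu$ is even if $\mu(-A)=\mu(A)$ for all Borel sets $A$. *)

(* Defs.v *)
From HB Require Import structures.
From mathcomp Require Import all_boot all_order all_algebra.
From mathcomp Require Import all_classical all_reals all_analysis.
From mathcomp Require Import measurable_realfun.

Set Implicit Arguments.
Unset Strict Implicit.
Unset Printing Implicit Defensive.

Import Order.TTheory GRing.Theory Num.Theory.
Import numFieldNormedType.Exports.

Local Open Scope classical_set_scope.
Local Open Scope ring_scope.

Definition rV_borel_display : measure_display. Proof. exact. Qed.

Section borel_rV.
Context (R : realType) (n : nat).

(* R^n is 'rV[R]_n; open refers to the library topology on matrices, which is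
   the usual topology of R^n *)
Definition rV_borel : set (set 'rV[R]_n) := <<s open >>.

Let rV_borel0 : rV_borel set0. Proof. exact: sigma_algebra0. Qed.

Let rV_borelC A : rV_borel A -> rV_borel (~` A).
Proof. by move=> mA; rewrite -setTD; exact: sigma_algebraCD. Qed.

Let rV_borel_bigcup (F : (set 'rV[R]_n)^nat) :
  (forall i, rV_borel (F i)) -> rV_borel (\bigcup_i F i).
Proof. exact: sigma_algebra_bigcup. Qed.

HB.instance Definition _ := @isMeasurable.Build rV_borel_display
  'rV[R]_n rV_borel rV_borel0 rV_borelC rV_borel_bigcup.

Lemma open_measurable_rV (A : set 'rV[R]_n) : open A -> measurable A.
Proof. by move=> oA; exact: sub_sigma_algebra. Qed.

Lemma open_rV_bigcup (U : set 'rV[R]_n) : open U ->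
  U = \bigcup_(p in [set p : 'rV[rat]_n * rat |
         ball (map_mx ratr p.1 : 'rV[R]_n) (ratr p.2) `<=` U])
       ball (map_mx ratr p.1 : 'rV[R]_n) (ratr p.2).
Proof.
move=> oU; apply/seteqP; split => [x Ux|x [p /= pU /pU]//].
have : nbhs x U by exact: open_nbhs_nbhs.
move=> /nbhs_ballP[e /= e0 xeU].
have /rat_in_itvoo[r /[!in_itv]/= /andP[r0 re]] : 0 < e / 2.
  by rewrite divr_gt0.
have /(_ _)/cid h i : exists q : rat, `|x 0 i - ratr q| < ratr r.
  have /rat_in_itvoo[q] : x 0 i - ratr r < x 0 i + ratr r.
    by rewrite ltrD2l gtrN.
  rewrite in_itv/= => /andP[q1 q2]; exists q.
  by rewrite distrC ltr_distl q1 q2.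
pose q := \row_i sval (h i).
have xq i j : `|x i j - ratr (q i j)| < ratr r.
  by rewrite ord1 mxE; exact: (svalP (h j)).
exists (q, r) => /=.
  move=> y [_ qy]; apply: xeU; split => // i j.
  have := qy i j; rewrite /ball/= mxE => qyij.
  rewrite -(subrKA (ratr (q i j))).
  rewrite (le_lt_trans (ler_normD _ _))// (splitr e).
  by rewrite ltrD// ?(lt_trans (xq _ _) re)// (lt_trans qyij).
by split => // i j; rewrite /ball/= mxE distrC.
Qed.

End borel_rV.

Section lebesgue_measure_rV.
Context {R : realType}.

Definition consrV n (p : measurableTypeR R * 'rV[R]_n) : 'rV[R]_n.+1 :=
  \row_i (if unlift ord0 i is Some j then p.2 0 j else p.1).

Lemma consrV0 n (p : R * 'rV[R]_n) : consrV p 0 ord0 = p.1.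
Proof. by rewrite mxE unlift_none. Qed.

Lemma consrV_lift n (p : R * 'rV[R]_n) j : consrV p 0 (lift ord0 j) = p.2 0 j.
Proof. by rewrite mxE liftK. Qed.

Lemma consrV_ball n (p : R * 'rV[R]_n) (e : R) :
  @consrV n @^-1` ball (consrV p : 'rV[R]_n.+1) e = ball p.1 e `*` ball p.2 e.
Proof.
apply/seteqP; split => -[x v] /=.
  move=> [e0 pv]; split => /=.
    by have := pv 0 ord0; rewrite !consrV0.
  split=> // i j; rewrite (ord1 i).
  by have := pv 0 (lift ord0 j); rewrite !consrV_lift.
move=> [/= px [e0 pv]]; split => // i j; rewrite (ord1 i).
have [k ->|->] := unliftP ord0 j; first by rewrite !consrV_lift.
by rewrite !consrV0.
Qed.

Lemma consrV_surj n (v : 'rV[R]_n.+1) :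
  exists p : R * 'rV[R]_n, v = consrV p.
Proof.
exists (v 0 ord0, \row_j v 0 (lift ord0 j)); apply/rowP => i.
have [k ->|->] := unliftP ord0 i; first by rewrite consrV_lift mxE.
by rewrite consrV0.
Qed.

Lemma measurable_ball_rV n (x : 'rV[R]_n) e : measurable (ball x e).
Proof. by apply: open_measurable_rV; exact: ball_open. Qed.

Lemma measurable_consrV n : measurable_fun setT (@consrV n).
Proof.
apply: (@measurability _ _ _ _ _ _ (@open 'rV[R]_n.+1)) => //.
move=> _ [U oU <-]; rewrite setTI (open_rV_bigcup oU) preimage_bigcup.
rewrite bigcup_mkcond; apply: countable_bigcupT_measurable => [|[q r]].
  exact: countableP.
case: ifPn => // _.
have [p ->] := consrV_surj (map_mx ratr q); rewrite /= consrV_ball.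
apply: measurableX; last exact: measurable_ball_rV.
by apply: open_measurable; exact: ball_open.
Qed.

Fixpoint lebesgue_measure_rV n : set 'rV[R]_n -> \bar R :=
  match n with
  | 0 => \d_(0 : 'rV[R]_0)
  | m.+1 => pushforward (lebesgue_measure \x @lebesgue_measure_rV m)%E
              (@consrV m)
  end.

Local Open Scope ereal_scope.

Let ball0_cover n :
  \bigcup_k ball (0%R : 'rV[R]_n) k.+1%:R = [set: 'rV[R]_n].
Proof.
apply/seteqP; split => // x _; exists (Num.trunc `|x|) => //.
by rewrite -ball_normE/= sub0r normrN truncnS_gt.
Qed.

Section sigma_finite_ball.
Variables (n : nat) (m : {measure set 'rV[R]_n -> \bar R}).
Hypothesis mb : forall k, m (ball (0%R : 'rV[R]_n) k.+1%:R) < +oo.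

Let m' : set 'rV[R]_n -> \bar R := m.

HB.instance Definition _ := Measure.on m'.

Let m'_sigma_finite : sigma_finite setT m'.
Proof.
exists (fun k => ball (0%R : 'rV[R]_n) k.+1%:R) => [|k].
  exact/esym/ball0_cover.
by split; [exact: measurable_ball_rV|exact: mb].
Qed.

HB.instance Definition _ := Measure_isSigmaFinite.Build _ _ _ m'
  m'_sigma_finite.

Lemma sigma_finite_ball :
  exists m0 : {sigma_finite_measure set 'rV[R]_n -> \bar R},
    m = m0 :> (set _ -> _).
Proof. by exists m'. Qed.

End sigma_finite_ball.

Lemma lebesgue_measure_rV_sigma_finite n :
  exists m : {sigma_finite_measure set 'rV[R]_n -> \bar R},
    @lebesgue_measure_rV n = m :> (set _ -> _).
Proof.
suff [m [-> /sigma_finite_ball//]] :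
    exists m : {measure set 'rV[R]_n -> \bar R},
    @lebesgue_measure_rV n = m :> (set _ -> _) /\
    forall k, m (ball (0%R : 'rV[R]_n) k.+1%:R) < +oo.
elim: n => [|n [m [mE mb]]].
  exists \d_(0%R : 'rV[R]_0) => //; split => // k.
  by rewrite /= diracE; case: (_ \in _); rewrite ltry.
have [sm smE] := sigma_finite_ball mb.
pose M : {measure set 'rV[R]_n.+1 -> \bar R} :=
  measure_function_pushforward__canonical__measure_function_Measure
    (@lebesgue_measure R \x sm) (@measurable_consrV n).
exists M; split => [|k]; first by rewrite /= mE smE.
rewrite /M/= /pushforward.
have -> : (0%R : 'rV[R]_n.+1) = consrV (0%R, 0%R).
  by apply/rowP => i; rewrite !mxE; case: unlift => [j|]//; rewrite mxE.
rewrite consrV_ball product_measure1E//; last 2 first.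
  exact: measurable_ball.
  exact: measurable_ball_rV.
by rewrite lte_mul_pinfty//= -?smE// lebesgue_measure_ball// ltry.
Qed.

Let leb0 n : @lebesgue_measure_rV n set0 = 0.
Proof. by have [m ->] := lebesgue_measure_rV_sigma_finite n. Qed.

Let leb_ge0 n A : 0 <= @lebesgue_measure_rV n A.
Proof. by have [m ->] := lebesgue_measure_rV_sigma_finite n. Qed.

Let leb_sigma_additive n : semi_sigma_additive (@lebesgue_measure_rV n).
Proof.
have [m ->] := lebesgue_measure_rV_sigma_finite n.
exact: measure_semi_sigma_additive.
Qed.

HB.instance Definition _ n := isMeasure.Build _ _ _ (@lebesgue_measure_rV n)
  (@leb0 n) (@leb_ge0 n) (@leb_sigma_additive n).

Let leb_sigma_finite n : sigma_finite setT (@lebesgue_measure_rV n).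
Proof.
by have [m ->] := lebesgue_measure_rV_sigma_finite n; exact: sigma_finiteT.
Qed.

HB.instance Definition _ n := Measure_isSigmaFinite.Build _ _ _
  (@lebesgue_measure_rV n) (@leb_sigma_finite n).

Lemma lebesgue_measure_rV_box n (a b : 'rV[R]_n) :
  (forall i, a 0 i <= b 0 i)%R ->
  lebesgue_measure_rV
    [set v : 'rV[R]_n | forall i, v 0%R i \in `[a 0%R i, b 0%R i]] =
  (\prod_i (b 0 i - a 0 i))%:E.
Proof.
elim: n => [|n ih] in a b * => ab.
  rewrite /= big_ord0 diracE mem_set//= => i; by case: i.
rewrite big_ord_recl.
pose tl (v : 'rV[R]_n.+1) : 'rV[R]_n := \row_j v 0%R (lift ord0 j).
have -> : (\prod_(i < n) (b 0 (lift ord0 i) - a 0 (lift ord0 i)) =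
           \prod_i (tl b 0 i - tl a 0 i))%R.
  by apply: eq_bigr => i _; rewrite !mxE.
rewrite EFinM -ih; last by move=> i; rewrite !mxE.
rewrite /= /pushforward.
have -> : @consrV n @^-1`
    [set v : 'rV[R]_n.+1 | forall i, v 0%R i \in `[a 0%R i, b 0%R i]] =
  `[a 0%R ord0, b 0%R ord0] `*`
  [set v : 'rV[R]_n | forall i, v 0%R i \in `[tl a 0%R i, tl b 0%R i]].
  apply/seteqP; split => -[x v] /=.
    move=> xv; split => [|i]; first by have := xv ord0; rewrite consrV0.
    by have := xv (lift ord0 i); rewrite consrV_lift !mxE.
  move=> [xab vab] i; have [j ->|->] := unliftP ord0 i.
    by have := vab j; rewrite consrV_lift !mxE.
  by rewrite consrV0.
rewrite product_measure1E//=.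
- rewrite lebesgue_measure_itv/= lte_fin.
  have := ab ord0; rewrite le_eqVlt => /orP[/eqP ->|->]; last by [].
  by rewrite ltxx subrr.
- rewrite -[X in measurable X]setCK; apply: measurableC.
  apply: open_measurable_rV; rewrite openC.
  rewrite (_ : mkset _ = \bigcap_(i in setT) ((fun v : 'rV[R]_n => v 0%R i)
      @^-1` `[tl a 0%R i, tl b 0%R i])); last first.
    by apply/seteqP; split => v /= h i; [move=> _; exact: h|exact: (h i)].
  apply: closed_bigI => i _; apply: closed_comp => [v _|].
    exact: coord_continuous.
  exact: interval_closed.
Qed.

End lebesgue_measure_rV.

Section log_concave_functions.
Context {R : realType} {n : nat}.
Local Notation V := 'rV[R]_n.
Local Notation leb := (@lebesgue_measure_rV R n).

(* the norm `|x| of the library on 'rV[R]_n is the sup norm *)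
Definition euclidean_norm (x : V) : R := Num.sqrt (\sum_i x 0 i ^+ 2).

Definition convex_efun (phi : V -> \bar R) :=
  forall (x y : V) (t : R), 0 <= t <= 1 ->
  (phi (t *: x + (1 - t) *: y)%R <= t%:E * phi x + (1 - t)%:E * phi y)%E.

Definition log_concave (f : V -> R) := exists phi : V -> \bar R,
  [/\ forall x, phi x != -oo%E,
      convex_efun phi &
      forall x, (f x)%:E = expeR (- phi x)%E].

Definition upper_semicontinuous (f : V -> R) :=
  lower_semicontinuous (fun x => (- f x)%:E).

Definition LC (f : V -> R) :=
  [/\ log_concave f,
      upper_semicontinuous f &
      (0 < \int[leb]_x (f x)%:E < +oo)%E].

(* lne 0 = -oo, so that potential f is +oo where f vanishes; for f = exp (- phi)
   this is phi itself, see potential_unique *)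
Definition potential (f : V -> R) (x : V) : \bar R := (- lne (f x)%:E)%E.

Lemma potential_unique (f : V -> R) (phi : V -> \bar R) :
  (forall x, (f x)%:E = expeR (- phi x)%E) -> potential f = phi.
Proof.
by move=> fphi; apply/funext => x; rewrite /potential fphi expeRK oppeK.
Qed.

Definition gradient (g : V -> R) (x : V) : V :=
  \row_i 'D_(delta_mx 0 i) g x.

(* For alpha < n, the kernel is given the value 0 instead of +oo on the
   diagonal x = y, which is Lebesgue-negligible; for alpha >= n, the value on
   the diagonal is that of |x - y| ^ (alpha - n), i.e., 1 if alpha = n and 0
   otherwise. *)
Definition riesz_potential (alpha : R) (f : V -> R) (y : V) : \bar R :=
  (\int[leb]_x (f x / euclidean_norm (x - y) `^ (n%:R - alpha))%:E)%E.

Definition riesz_energy (alpha : R) (f : V -> R) : \bar R :=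
  (\int[leb]_y (riesz_potential alpha f y * (f y)%:E))%E.

Definition closed_support (f : V -> R) : set V := closure [set x | 0 < f x].

(* The gradient of phi is meaningful for almost every y in closed_support f:
   the points where phi is infinite or not differentiable (where gradient
   returns an unspecified value) are Lebesgue-negligible in it. *)
Definition riesz_energy_measure (alpha : R) (f : V -> R) : set V -> \bar R :=
  pushforward
    (fun B => \int[leb]_(y in closed_support f `&` B)
                (riesz_potential alpha f y * (f y)%:E))%E
    (gradient (fine \o potential f)).

Definition even_measure (mu : set V -> \bar R) :=
  forall A : set V, measurable A -> mu [set - x | x in A] = mu A.

Definition concentrated_in (mu : set V -> \bar R) (A : set V) :=
  mu (~` A) = 0%E.

End log_concave_functions.

(* Main.v *)
(* For an even measurable psi : R^n -> [0, +oo], let f be exp (- phi) with phi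
   the Legendre conjugate of psi, let E(f) be its Riesz energy and let A(psi) be
   the mu-average of psi.  The solution is a maximizer of E(f) * exp (- 2 A(psi)),
   a quantity that does not change when a constant is added to psi; the constant
   is finally used to adjust the energy.

   Existence.  As psi is even, phi(y) >= |<x, y>| - psi(x) for all x; averaging
   over mu, which is not carried by a hyperplane, gives phi(y) >= c |y| - A(psi):
   the functional is bounded and maximizing sequences stay dominated by an
   integrable function.  The energies do not vanish in the limit, so the f_k are
   bounded below on a common ball; along a subsequence on which f_k converges at
   the rational points, log-concavity then gives limsup f_k <= f for
   psi = liminf psi_k, while Fatou's lemma controls A.

   Euler-Lagrange.  Let U be open and let h be the sum of the indicators of U
   and - U.  Passing from psi to psi + t h increases f to some f_t, and where phi
   has partial derivatives, f_t >= f * exp (t h (grad phi)) for small t.  Since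
   2 <I(f), f_t - f> <= E(f_t) - E(f), maximality and Fatou's lemma give
   R(U) <= mu(U) for the energy measure R.  Both measures have the same total
   mass, so this one-sided inequality on open sets forces R = mu.

   Partial derivatives of phi exist almost everywhere because the exceptional
   sets, indexed by rational slopes, meet every line parallel to a coordinate
   axis in at most one point. *)

Require Import Defs.
From HB Require Import structures.
From mathcomp Require Import all_boot all_order all_algebra.
From mathcomp Require Import all_classical all_reals all_analysis.
From mathcomp Require Import measurable_realfun ring lra.

Set Implicit Arguments.
Unset Strict Implicit.
Unset Printing Implicit Defensive.

Import Order.TTheory GRing.Theory Num.Theory.
Import numFieldNormedType.Exports.

Local Open Scope classical_set_scope.
Local Open Scope ring_scope.

(** The unknown is [psi] rather than [f]: the average against [mu] is linear in [psi], and a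
    perturbation [psi + t h] is in general not convex, so the competition ranges over all even
    measurable functions. Two directions oppose each other in the existence part. Fatou's lemma
    controls the average of liminf psi_k only, whereas conjugation gives limsup f_k <= f for free
    only with psi = limsup psi_k. Rational points bridge the gap: a lower bound on f_k at one point
    for infinitely many k passes, by log-concavity, to a nearby rational point, where convergence
    makes it hold for all large k. Averages A along a maximizing sequence stay bounded because, once
    inf psi = 0, both f <= 1 and f <= exp (A - k |y|) hold, hence f <= exp ((A - k |y|) / 2); the
    energy is then at most of order exp A and the gain at most of order exp (- A). The variation
    uses only a lower bound of f_t, which asks [h] to be lower semicontinuous: hence indicators of
    open sets, symmetrized because [psi] must stay even. *)

Section row_vectors.
Context {R : realType} {n : nat}.
Local Notation V := 'rV[R]_n.
Implicit Types (x y z : V).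

Lemma coord_le_norm x i : `|x 0 i| <= `|x|.
Proof.
rewrite [leRHS]/Num.norm/= mx_normrE.
by apply/bigmax_geP; right => /=; exists (0, i).
Qed.

Lemma norm_le_coord x (e : R) : 0 <= e -> (forall i, `|x 0 i| <= e) -> `|x| <= e.
Proof.
move=> e0 xe; rewrite [leLHS]/Num.norm/= mx_normrE.
by apply/bigmax_leP; split => //= -[i j] _; rewrite (ord1 i).
Qed.

Definition dot x y : R := \sum_i x 0 i * y 0 i.

Lemma dotC x y : dot x y = dot y x.
Proof. by apply: eq_bigr => i _; rewrite mulrC. Qed.

Lemma dotDr x y z : dot x (y + z) = dot x y + dot x z.
Proof.
by rewrite /dot -big_split; apply: eq_bigr => i _; rewrite mxE mulrDr.
Qed.

Lemma dotZr a x y : dot x (a *: y) = a * dot x y.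
Proof. by rewrite /dot mulr_sumr; apply: eq_bigr => i _; rewrite mxE mulrCA. Qed.

Lemma dotNr x y : dot x (- y) = - dot x y.
Proof. by rewrite -scaleN1r dotZr mulN1r. Qed.

Lemma dotNl x y : dot (- x) y = - dot x y.
Proof. by rewrite dotC dotNr dotC. Qed.

Lemma dotDl x y z : dot (x + y) z = dot x z + dot y z.
Proof. by rewrite dotC dotDr !(dotC z). Qed.

Lemma dotBl x y z : dot (x - y) z = dot x z - dot y z.
Proof. by rewrite dotDl dotNl. Qed.

Lemma dotZl a x y : dot (a *: x) y = a * dot x y.
Proof. by rewrite dotC dotZr dotC. Qed.

Lemma dot_delta x i : dot x (delta_mx 0 i) = x 0 i.
Proof.
rewrite /dot (bigD1 i)//= mxE !eqxx mulr1 big1 ?addr0// => j ji.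
by rewrite mxE eqxx /= (negbTE ji) mulr0.
Qed.

Lemma dot_le_norm x y : `|dot x y| <= n%:R * (`|x| * `|y|).
Proof.
apply: le_trans (ler_norm_sum _ _ _) _.
apply: (@le_trans _ _ (\sum_(i < n) `|x| * `|y|)); last first.
  by rewrite sumr_const card_ord mulr_natl.
by apply: ler_sum => i _; rewrite normrM ler_pM// coord_le_norm.
Qed.

Lemma continuous_dot x : continuous (dot x).
Proof.
suff H s : continuous (fun z : V => \sum_(i <- s) x 0 i * z 0 i) by exact: H.
elim: s => [|i s ih] y.
  rewrite (_ : (fun z : V => _) = cst 0).
    exact: cst_continuous.
  by apply/funext => z; rewrite big_nil.
rewrite (_ : (fun z : V => _) =
  (fun z => x 0 i * z 0 i + \sum_(j <- s) x 0 j * z 0 j)); last first.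
  by apply/funext => z; rewrite big_cons.
apply: (@continuousD _ _ _ (fun z : V => x 0 i * z 0 i) _ y _ (ih y)).
exact: (@cvgMr _ _ (nbhs y) (nbhs_filter y) (fun z : V => z 0 i) _ _
  (@coord_continuous R 1 n 0 i y)).
Qed.

Lemma dotxx_gt0 x : x != 0 -> 0 < dot x x.
Proof.
move=> x0; rewrite lt0r; apply/andP; split; last first.
  by apply: sumr_ge0 => i _; rewrite -expr2 sqr_ge0.
apply: contra x0 => /eqP /psumr_eq0P xx0; apply/eqP/rowP => i.
rewrite mxE; apply/eqP; rewrite -sqrf_eq0 expr2 xx0// => j _.
by rewrite -expr2 sqr_ge0.
Qed.

Lemma norm_le_euclidean x : `|x| <= euclidean_norm x.
Proof.
apply: norm_le_coord => [|i]; first exact: sqrtr_ge0.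
rewrite -sqrtr_sqr ler_sqrt; last by apply: sumr_ge0 => j _; rewrite sqr_ge0.
rewrite (bigD1 i)//= lerDl; apply: sumr_ge0 => j _; exact: sqr_ge0.
Qed.

Lemma euclidean_le_norm x : euclidean_norm x <= n%:R * `|x|.
Proof.
have nx0 : 0 <= n%:R * `|x| by rewrite mulr_ge0.
rewrite -(ger0_norm nx0) -sqrtr_sqr ler_sqrt; last exact: sqr_ge0.
apply: (@le_trans _ _ (\sum_(i < n) `|x| ^+ 2)).
  apply: ler_sum => i _; rewrite -real_normK ?num_real//.
  by rewrite ler_pXn2r ?nnegrE// coord_le_norm.
rewrite sumr_const card_ord -[leLHS]mulr_natl exprMn ler_wpM2r ?sqr_ge0//.
by rewrite -natrX ler_nat; case: n {x nx0} => // m; rewrite leq_pmulr.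
Qed.

Lemma euclidean_normN x : euclidean_norm (- x) = euclidean_norm x.
Proof. by congr (Num.sqrt _); apply: eq_bigr => i _; rewrite mxE sqrrN. Qed.

Lemma continuous_measurable_rV (f : V -> R) :
  continuous f -> measurable_fun setT f.
Proof.
move=> cf; apply: measurability; first exact: RGenOpens.measurableE.
move=> _ [_ [a [b ->] <-]]; rewrite setTI; apply: open_measurable_rV.
by apply: open_comp => [x _|]; [exact: cf|exact: interval_open].
Qed.

Lemma measurable_coord i : measurable_fun setT (fun x : V => x 0 i).
Proof. by apply: continuous_measurable_rV; exact: coord_continuous. Qed.

Lemma measurable_norm_rV : measurable_fun setT (fun x : V => `|x|).
Proof. by apply: continuous_measurable_rV; exact: norm_continuous. Qed.

(** Open sets are countable unions of balls with rational data, and a ball of the sup norm is an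
    intersection of coordinate conditions. *)
Lemma measurable_fun_rV d (T : measurableType d) (f : T -> V) :
  (forall i, measurable_fun setT (fun t => f t 0 i)) -> measurable_fun setT f.
Proof.
move=> mf; apply: (@measurability _ _ _ _ _ _ (@open V)) => //.
move=> _ [U oU <-]; rewrite setTI (open_rV_bigcup oU) preimage_bigcup.
rewrite bigcup_mkcond; apply: countable_bigcupT_measurable => [|[q r]].
  exact: countableP.
(* A ball of nonpositive radius is empty by definition, which the intersection over the coordinates
   misses when [n = 0]. *)
case: ifPn => // _ /=; have [r0|r0] := leP (ratr r : R) 0.
  rewrite (_ : _ @^-1` _ = set0)//; apply/seteqP; split => // t [/=].
  by rewrite ltNge r0.
rewrite (_ : _ @^-1` _ = \bigcap_i
    (fun t => f t 0 i) @^-1` ball (ratr (q 0 i) : R) (ratr r)).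
  rewrite -[X in measurable X]setCK setC_bigcap; apply: measurableC.
  rewrite bigcup_mkcond; apply: countable_bigcupT_measurable => [|i].
    exact: countableP.
  case: ifPn => // _; apply: measurableC.
  by rewrite -[X in measurable X]setTI; apply: mf => //; exact: measurable_ball.
apply/seteqP; split => t /= ft.
  by move=> i _; have [_ /(_ 0 i)] := ft; rewrite !mxE.
split => // i j; rewrite ord1 mxE; exact: (ft j).
Qed.

Lemma measurable_addr_rV d (T : measurableType d) (f g : T -> V) :
  measurable_fun setT f -> measurable_fun setT g ->
  measurable_fun setT (fun t => f t + g t).
Proof.
move=> mf mg; apply: measurable_fun_rV => i.
under eq_fun do rewrite mxE.
by apply: measurable_funD; apply: (measurableT_comp (measurable_coord i)).
Qed.

Lemma measurable_scaler_rV d (T : measurableType d) (f : T -> V) a :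
  measurable_fun setT f -> measurable_fun setT (fun t => a *: f t).
Proof.
move=> mf; apply: measurable_fun_rV => i.
under eq_fun do rewrite mxE.
apply: measurable_funM => //.
by apply: (measurableT_comp (measurable_coord i)).
Qed.

Lemma measurable_euclidean_norm : measurable_fun setT (@euclidean_norm R n).
Proof.
rewrite (_ : @euclidean_norm R n =
  Num.sqrt \o (fun x : V => \sum_i x 0 i ^+ 2))//.
apply: measurableT_comp.
  by apply: continuous_measurable_fun; exact: sqrt_continuous.
apply: measurable_sum => i; apply: measurable_funX; exact: measurable_coord.
Qed.

Lemma measurable_dot x : measurable_fun setT (dot x).
Proof.
apply: measurable_sum => i; apply: measurable_funM => //.
exact: measurable_coord.
Qed.

End row_vectors.

(** * Lebesgue measure on row vectors *)

Section lebesgue_invariance.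
Context {R : realType} {n : nat}.
Local Notation V := 'rV[R]_n.
Local Notation leb := (@lebesgue_measure_rV R n).

Definition closed_box (a b : V) : set V :=
  [set x | forall i, x 0 i \in `[a 0 i, b 0 i]].

Let boxes : set (set V) := [set A | exists a b, A = closed_box a b].

Lemma measurable_closed_box a b : measurable (closed_box a b).
Proof.
rewrite (_ : closed_box a b = \bigcap_i (fun x : V => x 0 i) @^-1`
    `[a 0 i, b 0 i]%classic); last first.
  by apply/seteqP; split => x /= h i; [move=> _; exact: h|exact: (h i)].
rewrite -[X in measurable X]setCK setC_bigcap; apply: measurableC.
rewrite bigcup_mkcond; apply: countable_bigcupT_measurable => [|i].
  exact: countableP.
case: ifPn => // _; apply: measurableC.
by rewrite -[X in measurable X]setTI; exact: measurable_coord.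
Qed.

Lemma closed_box_norm (x : V) (r : R) : 0 <= r ->
  closed_box (\row_i (x 0 i - r)) (\row_i (x 0 i + r)) =
  [set y | `|y - x| <= r].
Proof.
move=> r0; apply/seteqP; split => y /= h.
  apply: norm_le_coord => // i; rewrite !mxE.
  by have := h i; rewrite in_itv/= !mxE ler_distl.
move=> i; rewrite in_itv/= !mxE -ler_distl.
by apply: le_trans h; have := coord_le_norm (y - x) i; rewrite !mxE.
Qed.

(** Closed boxes are the sets of known volume, so they serve as the generators in the uniqueness
    argument for measures below. *)
Let measurable_boxes : @measurable _ V = <<s boxes >>.
Proof.
apply/seteqP; split; last first.
  apply: smallest_sub; first exact: sigma_algebra_measurable.
  by move=> _ [a [b ->]]; exact: measurable_closed_box.
apply: smallest_sub; first exact: smallest_sigma_algebra.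
move=> U oU.
pose B (p : 'rV[rat]_n * rat) : set V := closed_box
  (\row_i (ratr (p.1 0 i) - ratr p.2)) (\row_i (ratr (p.1 0 i) + ratr p.2)).
have -> : U = \bigcup_(p in [set p | B p `<=` U]) B p.
  apply/seteqP; split => [x Ux|x [p /= pU /pU]//].
  have /nbhs_ballP[e /= e0 xeU] : nbhs x U by exact: open_nbhs_nbhs.
  have /rat_in_itvoo[r /[!in_itv]/= /andP[r0 re]] : 0 < e / 2.
    by rewrite divr_gt0.
  have /(_ _)/cid h i : exists q : rat, `|x 0 i - ratr q| < ratr r.
    have /rat_in_itvoo[q] : x 0 i - ratr r < x 0 i + ratr r.
      by rewrite ltrD2l gtrN.
    rewrite in_itv/= => /andP[q1 q2]; exists q.
    by rewrite distrC ltr_distl q1 q2.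
  exists (\row_i sval (h i), r) => /=.
    move=> y By; apply: xeU; split => // i j; rewrite (ord1 i).
    have := By j; rewrite in_itv/= !mxE -ler_distl /ball/= => yq.
    rewrite (splitr e) -(subrKA (ratr (sval (h j)))).
    rewrite (le_lt_trans (ler_normD _ _))// ltrD//.
      exact: lt_trans (svalP (h j)) re.
    by rewrite distrC (le_lt_trans yq).
  by move=> i; rewrite in_itv/= !mxE -ler_distl ltW//; exact: (svalP (h i)).
have sB p : <<s boxes >> (B p) by apply: sub_sigma_algebra; eexists; eexists.
rewrite bigcup_mkcond.
pose F k : set V := if pickle_inv k is Some p then
   (if p \in [set p | B p `<=` U] then B p else set0) else set0.
rewrite (_ : \bigcup_p _ = \bigcup_k F k); last first.
  apply/seteqP; split => x.
    by move=> [p _ xp]; exists (pickle p) => //; rewrite /F pickleK_inv.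
  by move=> [k _]; rewrite /F; case: pickle_inv => // p xp; exists p.
apply: sigma_algebra_bigcup => k.
rewrite /F; case: pickle_inv => [p|]; last exact: sigma_algebra0.
by case: ifPn => // _; exact: sigma_algebra0.
Qed.

Lemma lebesgue_measure_closed_box (a b : V) : (forall i, a 0 i <= b 0 i) ->
  leb (closed_box a b) = (\prod_i (b 0 i - a 0 i))%:E.
Proof. exact: lebesgue_measure_rV_box. Qed.

Lemma measurable_affine (s : R) (v : V) :
  measurable_fun setT (fun x : V => s *: x + v).
Proof.
apply: measurable_addr_rV; last exact: measurable_cst.
by apply: measurable_scaler_rV; exact: measurable_id.
Qed.

(** The push-forward of Lebesgue measure has the right value on closed boxes, a generating class
    stable under intersection. *)
Lemma lebesgue_measure_rV_affine (s : R) (v : V) (A : set V) :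
  s = 1 \/ s = -1 -> measurable A ->
  leb ((fun x => s *: x + v) @^-1` A) = leb A.
Proof.
move=> s1 mA.
pose m2 : {measure set V -> \bar R} :=
  measure_function_pushforward__canonical__measure_function_Measure
    leb (measurable_affine s v).
rewrite -[LHS]/(m2 A); apply/esym.
pose b k : V := const_mx k%:R.
apply: (measure_unique boxes (fun k : nat => closed_box (- b k) (b k))) => //.
- move=> _ _ [a1 [b1 ->]] [a2 [b2 ->]].
  exists (\row_i Num.max (a1 0 i) (a2 0 i)), (\row_i Num.min (b1 0 i) (b2 0 i)).
  apply/seteqP; split => x /=.
    move=> [h1 h2] i; rewrite in_itv/= !mxE ge_max le_min.
    by have := h1 i; have := h2 i; rewrite !in_itv/= => /andP[-> ->] /andP[-> ->].
  move=> h; split => i; have := h i; rewrite !in_itv/= !mxE ge_max le_min.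
    by move=> /andP[/andP[-> _] /andP[-> _]].
  by move=> /andP[/andP[_ ->] /andP[_ ->]].
- by move=> k; eexists; eexists.
- apply/seteqP; split => // x _; exists (Num.truncn `|x|).+1 => //= i.
  rewrite in_itv/= !mxE -ler_norml (le_trans (coord_le_norm x i))//.
  by rewrite ltW// truncnS_gt.
- move=> _ [a1 [b1 ->]]; rewrite /m2/= /pushforward.
  have [ab|/existsNP[i /negP]] :=
    pselect (forall i, a1 0 i <= b1 0 i); last first.
    rewrite -ltNge => ba.
    rewrite (_ : closed_box a1 b1 = set0) ?preimage_set0 ?measure0//.
    apply/seteqP; split => // x /(_ i); rewrite in_itv/= => /andP[ax xb].
    by have := le_lt_trans (le_trans ax xb) ba; rewrite ltxx.
  rewrite [LHS]lebesgue_measure_closed_box//; apply/esym; case: s1 => ->.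
    rewrite (_ : _ @^-1` _ = closed_box (a1 - v) (b1 - v)); last first.
      apply/seteqP; split => x /= h i; have := h i;
        by rewrite !in_itv/= !mxE mul1r lerBlDr lerBrDr.
    apply: (eq_trans (lebesgue_measure_closed_box _)) => [i|]; last first.
      by congr (_%:E); apply: eq_bigr => i _; rewrite !mxE opprB addrA subrK.
    by rewrite !mxE lerD2r.
  rewrite (_ : _ @^-1` _ = closed_box (v - b1) (v - a1)); last first.
    apply/seteqP; split => x /= h i; have := h i; rewrite !in_itv/= !mxE mulN1r
      => /andP[h1 h2]; apply/andP; split; lra.
  apply: (eq_trans (lebesgue_measure_closed_box _)) => [i|]; last first.
    by congr (_%:E); apply: eq_bigr => i _; rewrite !mxE; ring.
  by rewrite !mxE lerD2l lerN2.
- move=> k; have ab i : (- b k) 0 i <= b k 0 i.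
    by rewrite !mxE ge0_cp// ?oppr_le0 ?ler0n.
  by rewrite [X in (X < _)%E](lebesgue_measure_closed_box ab) ltry.
Qed.

End lebesgue_invariance.

Lemma natmule_bounded_eq0 (R : realType) (b : \bar R) (c : R) :
  (0 <= b -> (forall m, b *+ m <= c%:E) -> b = 0)%E.
Proof.
case: b => [b| |] //; last by move=> _ /(_ 1%N).
rewrite lee_fin => b0 bc; congr (_%:E); apply/eqP.
rewrite eq_le b0 andbT leNgt; apply/negP => b_gt0.
have := bc (Num.truncn (c / b)).+1; rewrite -EFin_natmul lee_fin -mulr_natl.
by rewrite leNgt -ltr_pdivrMr// truncnS_gt.
Qed.

Section lebesgue_rV_consequences.
Context {R : realType} {n : nat}.
Local Notation V := 'rV[R]_n.
Local Notation leb := (@lebesgue_measure_rV R n).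
Local Open Scope ereal_scope.

Lemma integral_affine (s : R) (v : V) (F : V -> \bar R) :
  (s = 1 \/ s = -1)%R -> measurable_fun setT F -> (forall x, 0 <= F x) ->
  \int[leb]_x F (s *: x + v)%R = \int[leb]_x F x.
Proof.
move=> s1 mF F0.
have := @ge0_integral_pushforward _ _ _ _ _ _ (measurable_affine s v) leb setT F
  measurableT mF (fun _ _ => F0 _).
rewrite preimage_setT => <-.
apply: eq_measure_integral => [|? A mA _]; first exact: measurable_affine.
exact: lebesgue_measure_rV_affine.
Qed.

Lemma measurable_norm_ball (r : R) : measurable [set y : V | (`|y| <= r)%R].
Proof.
rewrite -[X in measurable X]setTI.
have := @measurable_norm_rV R n measurableT `]-oo, r]%classic.
by move=> /(_ (measurable_itv _)); rewrite set_itvE.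
Qed.

Lemma lebesgue_norm_ball (r : R) : (0 <= r)%R ->
  leb [set y : V | (`|y| <= r)%R] = ((2 * r) ^+ n)%:E.
Proof.
move=> r0; have := closed_box_norm (0 : V) r0.
rewrite (_ : [set y : V | (`|y - 0| <= r)%R] = [set y : V | (`|y| <= r)%R]).
  move=> <-; apply: eq_trans (lebesgue_measure_closed_box _) _ => [i|].
    by rewrite !mxE; lra.
  congr (_%:E); rewrite (eq_bigr (fun=> 2 * r)%R) => [|i _].
    by rewrite prodr_const card_ord.
  by rewrite !mxE; ring.
by apply/seteqP; split => y /=; rewrite subr0.
Qed.

(** The translates of a bounded piece of [N] by the vectors [v / (j + 1)] are pairwise disjoint,
    have equal measure and lie in one ball, so this measure is [0]. This replaces Fubini's theorem
    in the direction [v]. *)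
Lemma lebesgue_null_line (N : set V) (v : V) : measurable N ->
  (forall y t, N y -> t != 0%R -> ~ N (y + t *: v)%R) -> leb N = 0.
Proof.
move=> mN Nv; apply/(negligibleP leb mN).
have -> : N = \bigcup_k (N `&` [set y : V | (`|y| <= k%:R)%R]).
  rewrite -setI_bigcupr; apply/esym/setIidPl => x _.
  by exists (Num.truncn `|x|).+1 => //=; rewrite ltW// truncnS_gt.
apply: negligible_bigcup => k.
set B := _ `&` _; have mB : measurable B.
  by apply: measurableI => //; exact: measurable_norm_ball.
apply/(negligibleP leb mB).
pose F (j : nat) : set V := (fun x => 1 *: x + - (j.+1%:R^-1 *: v))%R @^-1` B.
have mF j : measurable (F j).
  by rewrite -[X in measurable X]setTI; exact: measurable_affine.
have FB j : leb (F j) = leb B.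
  by apply: lebesgue_measure_rV_affine => //; left.
have tF : trivIset setT F.
  move=> i j _ _ [x [[Ni _] [Nj _]]]; apply/eqP; apply: contrapT => /negP ij.
  apply: (Nv _ (i.+1%:R^-1 - j.+1%:R^-1)%R Ni).
    by rewrite subr_eq0 (inj_eq invr_inj) eqr_nat eqSS.
  by move: Nj; rewrite scalerBl addrA subrK.
have FU : \bigcup_j F j `<=` [set y : V | (`|y| <= k%:R + `|v|)%R].
  move=> x [j _ [_ /=]]; rewrite scale1r => xk.
  rewrite -(subrK (j.+1%:R^-1 *: v)%R x) (le_trans (ler_normD _ _))// lerD//.
  rewrite normrZ ler_piMl// normrV ?unitfE// invf_le1 ger0_norm//.
  by rewrite ler1n.
have kv0 : (0 <= k%:R + `|v| :> R)%R by rewrite addr_ge0.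
have sumF m : leb B *+ m <= ((2 * (k%:R + `|v|)) ^+ n)%:E.
  rewrite -lebesgue_norm_ball//.
  apply: le_trans (le_measure leb _ _ FU); last 2 first.
  - by rewrite inE; exact: bigcup_measurable.
  - by rewrite inE; exact: measurable_norm_ball.
  rewrite [X in _ <= X](measure_bigcup leb setT F (fun j _ => mF j) tF).
  apply: le_trans (nneseries_lim_ge m _) => //.
  rewrite big_mkcond/= (eq_bigr (fun=> leb B)) => [|i _]; last first.
    by rewrite in_setT.
  by rewrite sumr_const_nat subn0.
exact: natmule_bounded_eq0 (measure_ge0 leb B) sumF.
Qed.

Lemma lebesgue_hyperplane (u : V) : (u != 0)%R -> leb [set y | dot u y = 0%R] = 0.
Proof.
move=> u0; apply: (lebesgue_null_line (v := u)).
  rewrite -[X in measurable X]setTI.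
  exact: (measurable_dot u measurableT (measurable_set1 0%R)).
move=> y t /= uy t0; rewrite dotDr uy add0r dotZr => /eqP.
by rewrite mulf_eq0 (negbTE t0)/= gt_eqF// dotxx_gt0.
Qed.

End lebesgue_rV_consequences.

(** * Integrability of powers of the norm against an exponential *)

Section dyadic_integrability.
Context {R : realType} {n : nat}.
Local Notation V := 'rV[R]_n.
Local Notation leb := (@lebesgue_measure_rV R n).

Lemma geometric_nneseries_lty (C q : R) : 0 <= C -> 0 <= q < 1 ->
  (\sum_(0 <= k <oo) (C * q ^+ k)%:E < +oo)%E.
Proof.
move=> C0 /andP[q0 q1]; apply: (@le_lt_trans _ _ (C / (1 - q))%:E); last first.
  exact: ltry.
apply: lime_le.
  by apply: is_cvg_nneseries => k _ _; rewrite lee_fin mulr_ge0// exprn_ge0.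
apply: nearW => m; rewrite sumEFin lee_fin.
have := @geometric_seriesE R C q; rewrite lt_eqF// => /(_ erefl) E.
have -> : (\sum_(0 <= k < m) C * q ^+ k)%R = series (geometric C q) m by [].
rewrite E/= ler_pM2r ?invr_gt0 ?subr_gt0// -[leRHS]mulr1 ler_wpM2l//.
by rewrite gerBl exprn_ge0.
Qed.

(** Comparison with a sum of multiples of indicators of balls replaces polar coordinates. There are
    two families of balls because the integrand may be singular at [0] and must also be controlled
    at infinity. *)
Lemma integral_shells_lty (w : V -> R) (a r a' r' : nat -> R) (C q : R) :
  measurable_fun setT w -> (forall z, 0 <= w z) -> 0 <= q < 1 ->
  (forall k, 0 <= a k) -> (forall k, 0 <= a' k) ->
  (forall k, 0 <= r k) -> (forall k, 0 <= r' k) ->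
  (forall k, a k * (2 * r k) ^+ n + a' k * (2 * r' k) ^+ n <= C * q ^+ k) ->
  (forall z, exists k, `|z| <= r k /\ w z <= a k \/ `|z| <= r' k /\ w z <= a' k) ->
  (\int[leb]_z (w z)%:E < +oo)%E.
Proof.
move=> mw w0 q01 a0 a'0 r0 r'0 Cq wa.
pose I (e : R) : V -> R := \1_[set z | `|z| <= e].
have mI e : measurable_fun setT (I e).
  by apply: measurable_indic; exact: measurable_norm_ball.
have I0 e z : 0 <= I e z by [].
have iI e : 0 <= e -> (\int[leb]_z (I e z)%:E = ((2 * e) ^+ n)%:E)%E.
  move=> e0; rewrite integral_indic//; last exact: measurable_norm_ball.
  by rewrite setIT; exact: lebesgue_norm_ball.
pose t k z := (a k * I (r k) z)%:E + (a' k * I (r' k) z)%:E.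
have t0 k z : (0 <= t k z)%E.
  by rewrite /t -EFinD lee_fin addr_ge0// mulr_ge0.
have mt k : measurable_fun setT (t k).
  by apply: emeasurable_funD; apply/measurable_EFinP; apply: measurable_funM.
apply: (@le_lt_trans _ _ (\int[leb]_z \sum_(0 <= k <oo) t k z)%E).
  apply: ge0_le_integral => //.
  - by move=> z _; rewrite lee_fin.
  - exact/measurable_EFinP.
  - by apply: ge0_emeasurable_sum.
  - move=> z _; have [k wk] := wa z.
    apply: le_trans (nneseries_lim_ge k.+1 _) => //.
    rewrite big_nat_recr//= -[X in (X <= _)%E]add0e leeD//; first exact: sume_ge0.
    rewrite /t -EFinD lee_fin; case: wk => -[zr wz].
      by rewrite -[leLHS]addr0 lerD// ?mulr_ge0// /I indicE mem_set// mulr1.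
    by rewrite -[leLHS]add0r lerD// ?mulr_ge0// /I indicE mem_set// mulr1.
rewrite integral_nneseries//.
have C0 : 0 <= C.
  by have := Cq 0%N; rewrite expr0 mulr1; apply: le_trans;
    rewrite addr_ge0// mulr_ge0// exprn_ge0// mulr_ge0.
apply: le_lt_trans (geometric_nneseries_lty C0 q01).
apply: lee_nneseries => [k _ _|k _]; first exact: integral_ge0.
rewrite /t ge0_integralD//; last 4 first.
- by move=> z _; rewrite lee_fin mulr_ge0.
- by apply/measurable_EFinP; apply: measurable_funM.
- by move=> z _; rewrite lee_fin mulr_ge0.
- by apply/measurable_EFinP; apply: measurable_funM.
under eq_integral do rewrite EFinM.
rewrite ge0_integralZl_EFin//; last 2 first.
  by move=> z _; rewrite lee_fin.
  exact/measurable_EFinP.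
under [X in (_ + X)%E]eq_integral do rewrite EFinM.
rewrite ge0_integralZl_EFin//; last 2 first.
  by move=> z _; rewrite lee_fin.
  exact/measurable_EFinP.
by rewrite !iI// -!EFinM -EFinD lee_fin.
Qed.

Lemma dyadic_small (x : R) : 0 < x <= 1 ->
  exists k, 2^-1 ^+ k.+1 < x <= 2^-1 ^+ k.
Proof.
move=> /andP[x0 x1].
have : exists k, 2^-1 ^+ k.+1 < x.
  have [k kx] : exists k, x^-1 < 2 ^+ k.
    exists (Num.truncn x^-1).+1; apply: lt_le_trans (truncnS_gt _) _.
    by rewrite -natrX ler_nat ltnW// ltn_expl.
  exists k; rewrite exprVn -[ltRHS]invrK ltf_pV2 ?posrE ?exprn_gt0 ?invr_gt0//.
  by apply: lt_le_trans kx _; rewrite ler_weXn2l ?ler1n.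
move=> /ex_minnP[k kx km]; exists k; rewrite kx/=.
case: k kx km => [|k] kx km; first by rewrite expr0.
by rewrite leNgt; apply/negP => /km; rewrite ltnn.
Qed.

Lemma dyadic_large (x : R) : 1 < x -> exists k, 2 ^+ k < x <= 2 ^+ k.+1.
Proof.
move=> x1.
have : exists k, x <= 2 ^+ k.+1.
  exists (Num.truncn x).+1; apply: le_trans (ltW (truncnS_gt _)) _.
  rewrite -natrX ler_nat ltnW// (leq_trans (ltnSn _))//.
  by rewrite (leq_trans _ (ltn_expl _ _))// ?leqnSn.
move=> /ex_minnP[k kx km]; exists k; rewrite kx andbT.
case: k kx km => [|k] kx km; first by rewrite expr0.
by rewrite ltNge; apply/negP => /km; rewrite ltnn.
Qed.

(** With [x = (N / c) * s], the logarithm of the product is [N * ln (N / c) + N * (ln s - s)], and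
    [ln s <= s]. *)
Lemma powR_expR_bound (N c : R) : 0 < N -> 0 < c ->
  exists2 M, 0 <= M & forall x, 0 < x -> x `^ N * expR (- (c * x)) <= M.
Proof.
move=> N0 c0; exists (expR (N * ln (N / c))); first exact: expR_ge0.
move=> x x0; rewrite /powR gt_eqF// -expRD ler_expR.
have Nc0 : 0 < N / c by rewrite divr_gt0.
have -> : x = (N / c) * (x * c / N) by field; rewrite !gt_eqF.
rewrite lnM ?posrE// ?divr_gt0 ?mulr_gt0// mulrDr -addrA gerDl.
have -> : c * (N / c * (x * c / N)) = N * (x * c / N) by field; rewrite !gt_eqF.
rewrite -mulrBr pmulr_rle0// subr_le0.
by rewrite ltW// ln_sublinear// divr_gt0// mulr_gt0.
Qed.

(** The shell of radius about [2 ^ (- k)] contributes at most a multiple of [2 ^ (- b k)], summable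
    since [b > 0]; at infinity the integrand is at most [M / |z| ^ (n + 1)]. *)
Lemma powR_norm_exp_lty (b c : R) : 0 < b -> 0 < c ->
  (\int[leb]_z (`|z| `^ (b - n%:R) * expR (- (c * `|z|)))%:E < +oo)%E.
Proof.
move=> b0 c0; set p := b - n%:R.
(* The exponent [b + 1] is chosen so that [p - (b + 1) = - (n + 1)]. *)
have [M M0 HM] := @powR_expR_bound (b + 1) c ltac:(lra) c0.
pose h : R := 2^-1.
have h0 : 0 < h by rewrite invr_gt0.
(* On one dyadic shell [|z| ^ p] varies by at most this factor, whatever the sign of [p]. *)
pose D := 2 `^ `|p|.
have D0 : 0 <= D by exact: powR_ge0.
apply: (@integral_shells_lty _ (fun k => D * (h ^+ k) `^ p) (fun k => h ^+ k)
  (fun k => M * (h ^+ k) ^+ n.+1) (fun k => 2 ^+ k.+1)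
  (D * 2 ^+ n + M * 4 ^+ n) (Num.max (h `^ b) h)).
- apply: measurable_funM.
    apply: (@measurableT_comp _ _ _ _ _ _ (@powR R ^~ p)) => //.
    exact: measurable_norm_rV.
  apply: measurableT_comp => //; apply: measurable_funN; apply: measurable_funM => //.
  exact: measurable_norm_rV.
- by move=> z; rewrite mulr_ge0// ?powR_ge0 ?expR_ge0.
- rewrite le_max (ltW h0) orbT gt_max [h < 1]invf_lt1// ltr1n andbT.
  rewrite /powR gt_eqF// -expR0 ltr_expR pmulr_rlt0// ln_lt0// h0/=.
  by rewrite invf_lt1// ltr1n.
- by move=> k; rewrite mulr_ge0// powR_ge0.
- by move=> k; rewrite mulr_ge0// !exprn_ge0// ltW.
- by move=> k; rewrite exprn_ge0// ltW.
- by move=> k; rewrite exprn_ge0.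
- move=> k.
  have hk0 : 0 < h ^+ k by rewrite exprn_gt0.
  have E1 : D * (h ^+ k) `^ p * (2 * h ^+ k) ^+ n = D * 2 ^+ n * (h `^ b) ^+ k.
    rewrite exprMn -mulrA [X in D * X]mulrCA -[in RHS]mulrA; congr (_ * (_ * _)).
    rewrite -[(h ^+ k) ^+ n]powR_mulrn ?ltW// -powRD; last first.
      by rewrite (gt_eqF hk0) implybT.
    rewrite subrK -[RHS]powR_mulrn ?powR_ge0//.
    rewrite -[h ^+ k](powR_mulrn _ (ltW h0)).
    by rewrite -!powRrM mulrC.
  have E2 : M * (h ^+ k) ^+ n.+1 * (2 * 2 ^+ k.+1) ^+ n = M * 4 ^+ n * h ^+ k.
    have -> : 2 * 2 ^+ k.+1 = 4 * (h ^+ k)^-1 :> R.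
      by rewrite /h exprVn invrK exprS; ring.
    move: (h ^+ k) hk0 (4 : R) => y y0 f.
    rewrite exprMn exprVn exprS; have := expf_neq0 n (lt0r_neq0 y0).
    by move: (y ^+ n) (f ^+ n) => z x z0; field.
  rewrite {}E1 {}E2 mulrDl lerD// ler_wpM2l// ?mulr_ge0// ?exprn_ge0//.
    by apply: lerXn2r; rewrite ?nnegrE ?le_max ?powR_ge0 ?lexx.
  by apply: lerXn2r; rewrite ?nnegrE ?le_max ?lexx ?(ltW h0) ?orbT.
- move=> z; have [z1|z1] := leP `|z| 1; last first.
    have [k /andP[k1 k2]] := dyadic_large z1; exists k; right; split=> //.
    have z0 : 0 < `|z| by lra.
    have -> : `|z| `^ p = `|z| `^ (b + 1) / `|z| ^+ n.+1.
      rewrite -powR_mulrn// -powRB; last by rewrite (gt_eqF z0) implybT.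
      by congr powR; rewrite /p -natr1; ring.
    rewrite mulrAC; apply: ler_pM => //.
      exact: HM.
    rewrite /h exprVn exprVn lef_pV2 ?posrE ?exprn_gt0//.
    by rewrite ler_pXn2r ?nnegrE ?exprn_ge0// ltW.
  have E0 : expR (- (c * `|z|)) <= 1.
    by rewrite -expR0 ler_expR oppr_le0 mulr_ge0// ltW.
  (* At the origin the power takes its default value, [1] for [p = 0] and [0] otherwise. *)
  have [z0|z0] := eqVneq `|z| 0.
    exists 0%N; left; rewrite expr0 z1; split=> //.
    rewrite powR1 mulr1; apply: le_trans (_ : D * 1 <= _); last by rewrite mulr1.
    apply: ler_pM => //; rewrite ?powR_ge0 ?expR_ge0//.
    rewrite z0 /D; have [->|p0] := eqVneq p 0; first by rewrite normr0 !powRr0.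
    by rewrite powR0// powR_ge0.
  have {}z0 : 0 < `|z| by rewrite lt0r z0 normr_ge0.
  have [|k /andP[k1 k2]] := @dyadic_small `|z|; first by rewrite z0 z1.
  have hk0 : 0 < h ^+ k by rewrite exprn_gt0.
  exists k; left; split => //; rewrite -[leRHS]mulr1; apply: ler_pM => //.
    have -> : `|z| = (`|z| / h ^+ k) * h ^+ k by rewrite divfK// gt_eqF.
    set s := `|z| / h ^+ k.
    have s1 : s <= 1 by rewrite ler_pdivrMr// mul1r.
    have hs : h < s by rewrite ltr_pdivlMr// -exprS.
    have s0 : 0 < s by apply: lt_trans hs.
    rewrite (powRM _ (ltW s0) (ltW hk0)); apply: ler_wpM2r.
      exact: powR_ge0.
    rewrite /D /powR !gt_eqF// ler_expR.
    apply: le_trans (ler_norm _) _; rewrite normrM ler_wpM2l//.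
    rewrite ler0_norm ?ln_le0// -lnV ?posrE// ler_ln ?posrE ?invr_gt0//.
    by rewrite -[leRHS]invrK lef_pV2 ?posrE ?invr_gt0// ltW.
Qed.

End dyadic_integrability.

Lemma ge0_integral_eq0P d (T : measurableType d) (R : realType)
    (mu : {measure set T -> \bar R}) (F : T -> \bar R) :
  measurable_fun setT F -> (forall x, 0 <= F x)%E ->
  (\int[mu]_x F x = 0 <-> mu [set x | F x != 0] = 0)%E.
Proof.
move=> mF F0.
have mN : measurable [set x | F x != 0%E].
  by rewrite -[X in measurable X]setTI; exact: emeasurable_neq.
have <- : (\int[mu]_x `|F x| = \int[mu]_x F x)%E.
  by apply: eq_integral => x _; rewrite gee0_abs.
rewrite ae_eq_integral_abs//; split => [[N [mN' N0 FN]]|N0].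
  apply/(negligibleP mu mN); exists N; split => //.
  move=> x /= /eqP Fx; apply: FN => /= FE.
  exact/Fx/FE.
exists [set x | F x != 0%E]; split => // x /= /not_implyP[_ Fx].
exact/eqP.
Qed.

(** * Riesz energy *)

Section riesz_energy_theory.
Context {R : realType} {n : nat}.
Local Notation V := 'rV[R]_n.
Local Notation leb := (@lebesgue_measure_rV R n).
Variable alpha : R.
Hypotheses (n_gt0 : (0 < n)%N) (alpha_gt0 : 0 < alpha).

Definition riesz_kernel (z : V) : R := (euclidean_norm z `^ (n%:R - alpha))^-1.
Local Notation K := riesz_kernel.

Lemma riesz_kernel_ge0 z : 0 <= K z.
Proof. by rewrite invr_ge0 powR_ge0. Qed.
Hint Resolve riesz_kernel_ge0 : core.

Lemma riesz_kernelN z : K (- z) = K z.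
Proof. by rewrite /K euclidean_normN. Qed.

Lemma euclidean_norm_gt0 (z : V) : z != 0 -> 0 < euclidean_norm z.
Proof. by move=> z0; rewrite (lt_le_trans _ (norm_le_euclidean z))// normr_gt0. Qed.

Lemma riesz_kernel_gt0 z : z != 0 -> 0 < K z.
Proof. by move=> z0; rewrite invr_gt0 powR_gt0// euclidean_norm_gt0. Qed.

Lemma measurable_riesz_kernel : measurable_fun setT K.
Proof.
rewrite (_ : K = (@powR R ^~ (alpha - n%:R)) \o @euclidean_norm R n).
  by apply: measurableT_comp => //; exact: measurable_euclidean_norm.
by apply/funext => z; rewrite /K -powRN opprB.
Qed.

Lemma measurable_riesz_kernelB d (T : measurableType d) (f g : T -> V) :
  measurable_fun setT f -> measurable_fun setT g ->
  measurable_fun setT (fun t => K (f t - g t)).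
Proof.
move=> mf mg; apply: (@measurableT_comp _ _ _ _ _ _ K).
  exact: measurable_riesz_kernel.
apply: measurable_addr_rV => //; under eq_fun do rewrite -scaleN1r.
exact: measurable_scaler_rV.
Qed.

(** The exponent [alpha - n] can have either sign: the power increases or decreases, so the upper or
    the lower comparison of the Euclidean norm with the sup norm is used. *)
Lemma riesz_kernel_le (z : V) :
  K z <= Num.max 1 (n%:R `^ (alpha - n%:R)) * `|z| `^ (alpha - n%:R).
Proof.
rewrite /K -powRN opprB; have n0 : (0 : R) <= n%:R by [].
have z0 : 0 <= `|z| by [].
have e0 : 0 <= euclidean_norm z by exact: sqrtr_ge0.
have [p0|p0] := leP 0 (alpha - n%:R).
  apply: (@le_trans _ _ ((n%:R * `|z|) `^ (alpha - n%:R))).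
    by apply: ge0_ler_powR => //; rewrite ?nnegrE ?mulr_ge0// euclidean_le_norm.
  by rewrite powRM// ler_wpM2r ?powR_ge0// le_max lexx orbT.
apply: (@le_trans _ _ (1 * `|z| `^ (alpha - n%:R))); last first.
  by rewrite ler_wpM2r ?powR_ge0// le_max lexx.
rewrite mul1r; have [zE|zn0] := eqVneq `|z| 0.
  have -> : euclidean_norm z = 0.
    by apply/eqP; rewrite eq_le e0 (le_trans (euclidean_le_norm z))// zE mulr0.
  by rewrite zE.
have {}zn0 : 0 < `|z| by rewrite lt0r zn0.
have ez := norm_le_euclidean z; have en0 := lt_le_trans zn0 ez.
rewrite -[_ - _]opprK !(powRN _ (- _)) lef_pV2 ?posrE ?powR_gt0//.
by apply: ge0_ler_powR; rewrite ?nnegrE ?oppr_ge0 ?(ltW p0).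
Qed.

Local Open Scope ereal_scope.

(** Local integrability of the kernel comes from [alpha > 0], through [powR_norm_exp_lty] with
    [b = alpha]. *)
Lemma riesz_kernel_exp_lty (c : R) : (0 < c)%R ->
  \int[leb]_z (K z * expR (- (c * `|z|)))%:E < +oo.
Proof.
move=> c0; set M := Num.max 1%R (n%:R `^ (alpha - n%:R))%R.
have M0 : (0 <= M)%R by rewrite le_max ler01.
have mE : measurable_fun setT (fun z : V => expR (- (c * `|z|))).
  apply: measurableT_comp => //; apply: measurable_funN.
  by apply: measurable_funM => //; exact: measurable_norm_rV.
have mp : measurable_fun setT (fun z : V => (`|z| `^ (alpha - n%:R))%R).
  apply: (@measurableT_comp _ _ _ _ _ _ (@powR R ^~ (alpha - n%:R)%R)) => //.
  exact: measurable_norm_rV.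
apply: (@le_lt_trans _ _ (\int[leb]_z (M%:E *
    (`|z| `^ (alpha - n%:R) * expR (- (c * `|z|)))%:E))).
  apply: ge0_le_integral => //.
  - by move=> z _; rewrite lee_fin mulr_ge0// expR_ge0.
  - apply/measurable_EFinP; apply: measurable_funM => //.
    exact: measurable_riesz_kernel.
  - apply/measurable_EFinP.
    by apply: measurable_funM => //; apply: measurable_funM.
  - move=> z _; rewrite -EFinM lee_fin mulrA ler_wpM2r ?expR_ge0//.
    exact: riesz_kernel_le.
rewrite ge0_integralZl_EFin//; last first.
  by apply/measurable_EFinP; apply: measurable_funM.
by rewrite lte_mul_pinfty ?lee_fin// powR_norm_exp_lty.
Qed.

Lemma exp_norm_lty (c : R) : (0 < c)%R ->
  \int[leb]_z (expR (- (c * `|z|)))%:E < +oo.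
Proof.
move=> c0; have := @powR_norm_exp_lty R n n%:R c.
rewrite ltr0n => /(_ n_gt0 c0); congr (_ < _); apply: eq_integral => z _.
by rewrite subrr powRr0 mul1r.
Qed.

(** The bilinear form of the energy, used to expand the energy of a perturbed function. *)
Definition riesz_form (f g : V -> R) : \bar R :=
  \int[leb]_y (riesz_potential alpha f y * (g y)%:E).

Lemma riesz_form_diag f : riesz_energy alpha f = riesz_form f f.
Proof. by []. Qed.

Section nonneg.
Variables f g : V -> R.
Hypotheses (mf : measurable_fun setT f) (mg : measurable_fun setT g).
Hypotheses (f0 : forall x, (0 <= f x)%R) (g0 : forall x, (0 <= g x)%R).

Let F (p : V * V) := (f p.1 * K (p.1 - p.2))%:E.
Let H (p : V * V) := (f p.1 * K (p.1 - p.2) * g p.2)%:E.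

Let mK : measurable_fun setT (fun p : V * V => K (p.1 - p.2)).
Proof. exact: measurable_riesz_kernelB. Qed.

Let mF : measurable_fun setT F.
Proof.
apply/measurable_EFinP; apply: measurable_funM => //.
exact: (measurableT_comp mf measurable_fst).
Qed.

Let mH : measurable_fun setT H.
Proof.
apply/measurable_EFinP; apply: measurable_funM.
  exact/measurable_EFinP.
exact: (measurableT_comp mg measurable_snd).
Qed.

Let F0 p : 0 <= F p. Proof. by rewrite lee_fin mulr_ge0. Qed.
Let H0 p : 0 <= H p. Proof. by rewrite lee_fin !mulr_ge0. Qed.

Lemma riesz_potential_ge0 y : 0 <= riesz_potential alpha f y.
Proof. by apply: integral_ge0 => x _; exact: (F0 (x, y)). Qed.

Lemma measurable_riesz_potential :
  measurable_fun setT (riesz_potential alpha f).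
Proof. exact: (measurable_fun_fubini_tonelli_G F mF F0). Qed.

Let mFy y : measurable_fun setT (fun x => F (x, y)).
Proof. exact: (measurableT_comp mF (measurable_pair2 y)). Qed.

Lemma riesz_potentialM y :
  riesz_potential alpha f y * (g y)%:E = \int[leb]_x H (x, y).
Proof.
apply/esym; transitivity (\int[leb]_x (F (x, y) * (g y)%:E)).
  by apply: eq_integral => x _; rewrite -EFinM.
by rewrite (ge0_integralZr _ measurableT (mFy y) (fun x _ => F0 (x, y)))// lee_fin.
Qed.

Lemma riesz_formE : riesz_form f g = \int[leb \x leb]_p H p.
Proof.
rewrite (fubini_tonelli2 H mH H0); apply: eq_integral => y _.
exact: riesz_potentialM.
Qed.

Lemma riesz_form_ge0 : 0 <= riesz_form f g.
Proof. by rewrite riesz_formE; apply: integral_ge0 => p _; exact: H0. Qed.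

Lemma riesz_form_swap : riesz_form f g =
  \int[leb]_x \int[leb]_y (f x * K (x - y) * g y)%:E.
Proof. by rewrite riesz_formE (fubini_tonelli1 H mH H0). Qed.

Lemma measurable_riesz_integrand : measurable_fun setT H.
Proof. exact: mH. Qed.

End nonneg.

Lemma riesz_form_sym (f g : V -> R) :
  measurable_fun setT f -> measurable_fun setT g ->
  (forall x, (0 <= f x)%R) -> (forall x, (0 <= g x)%R) ->
  riesz_form f g = riesz_form g f.
Proof.
move=> mf mg f0 g0; rewrite (riesz_form_swap mf mg f0 g0).
apply: eq_integral => x _; rewrite (riesz_potentialM mg g0 f0).
apply: eq_integral => y _; rewrite /= -[(y - x)%R]opprB riesz_kernelN.
by congr (_%:E); ring.
Qed.

Lemma le_riesz_form (f g f' g' : V -> R) :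
  measurable_fun setT f -> measurable_fun setT g ->
  measurable_fun setT f' -> measurable_fun setT g' ->
  (forall x, (0 <= f x <= f' x)%R) -> (forall x, (0 <= g x <= g' x)%R) ->
  riesz_form f g <= riesz_form f' g'.
Proof.
move=> mf mg mf' mg' ff' gg'.
have f0 x : (0 <= f x)%R by have /andP[] := ff' x.
have g0 x : (0 <= g x)%R by have /andP[] := gg' x.
have f'0 x : (0 <= f' x)%R by have /andP[fx] := ff' x; exact: le_trans.
have g'0 x : (0 <= g' x)%R by have /andP[gx] := gg' x; exact: le_trans.
rewrite !riesz_formE//; apply: ge0_le_integral => //.
- by move=> p _; rewrite lee_fin !mulr_ge0.
- exact: measurable_riesz_integrand.
- exact: measurable_riesz_integrand.
- move=> p _; rewrite lee_fin ler_pM ?mulr_ge0//.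
    by rewrite ler_wpM2r//; have /andP[] := ff' p.1.
  by have /andP[] := gg' p.2.
Qed.

Lemma riesz_formDr (f g h : V -> R) :
  measurable_fun setT f -> measurable_fun setT g -> measurable_fun setT h ->
  (forall x, (0 <= f x)%R) -> (forall x, (0 <= g x)%R) ->
  (forall x, (0 <= h x)%R) ->
  riesz_form f (fun x => g x + h x)%R = riesz_form f g + riesz_form f h.
Proof.
move=> mf mg mh f0 g0 h0.
have mP := measurable_riesz_potential mf f0.
have P0 := riesz_potential_ge0 f0.
rewrite /riesz_form -ge0_integralD//.
- by apply: eq_integral => y _; rewrite EFinD ge0_muleDr// lee_fin.
- by move=> y _; rewrite mule_ge0// lee_fin.
- by apply: emeasurable_funM => //; exact/measurable_EFinP.
- by move=> y _; rewrite mule_ge0// lee_fin.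
- by apply: emeasurable_funM => //; exact/measurable_EFinP.
Qed.

Lemma riesz_formZr (f g : V -> R) (c : R) :
  measurable_fun setT f -> measurable_fun setT g ->
  (forall x, (0 <= f x)%R) -> (forall x, (0 <= g x)%R) -> (0 <= c)%R ->
  riesz_form f (fun x => c * g x)%R = c%:E * riesz_form f g.
Proof.
move=> mf mg f0 g0 c0.
have mP := measurable_riesz_potential mf f0.
have P0 := riesz_potential_ge0 f0.
rewrite /riesz_form -ge0_integralZl_EFin//.
- by apply: eq_integral => y _; rewrite EFinM muleCA.
- by move=> y _; rewrite mule_ge0// lee_fin.
- by apply: emeasurable_funM => //; exact/measurable_EFinP.
Qed.

Lemma riesz_energyZ (f : V -> R) (c : R) : measurable_fun setT f ->
  (forall x, (0 <= f x)%R) -> (0 <= c)%R ->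
  riesz_energy alpha (fun x => c * f x)%R = (c ^+ 2)%:E * riesz_energy alpha f.
Proof.
move=> mf f0 c0; have cf0 x : (0 <= c * f x)%R by rewrite mulr_ge0.
have mcf : measurable_fun setT (fun x => c * f x)%R by exact: measurable_funM.
rewrite !riesz_form_diag (riesz_formZr mcf mf cf0 f0 c0).
by rewrite (riesz_form_sym mcf mf cf0 f0) (riesz_formZr mf mf f0 f0 c0) muleA.
Qed.

(** By the triangle inequality, exp (- c |x| - c |y|) is at most exp (- (c / 2) |x - y|) times exp
    (- (c / 2) |y|); after a translation the double integral splits into a product of two finite
    ones. *)
Lemma riesz_energy_exp_lty (c : R) : (0 < c)%R ->
  riesz_energy alpha (fun x : V => expR (- (c * `|x|))) < +oo.
Proof.
move=> c0; have c20 : (0 < c / 2)%R by rewrite divr_gt0.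
pose e (a : R) (x : V) := expR (- (a * `|x|)).
have me a : measurable_fun setT (e a).
  apply: measurableT_comp => //; apply: measurable_funN.
  by apply: measurable_funM => //; exact: measurable_norm_rV.
have e0 a x : (0 <= e a x)%R by exact: expR_ge0.
pose J := \int[leb]_z (K z * e (c / 2) z)%:E.
have J0 : 0 <= J by apply: integral_ge0 => z _; rewrite lee_fin mulr_ge0.
have mK := measurable_riesz_kernel.
apply: (@le_lt_trans _ _ (\int[leb]_y (J * (e (c / 2) y)%:E))); last first.
  rewrite ge0_integralZl//; last 2 first.
    exact/measurable_EFinP.
    by move=> z _; rewrite lee_fin.
  by rewrite lte_mul_pinfty// ?exp_norm_lty// ge0_fin_numE// riesz_kernel_exp_lty.
apply: ge0_le_integral => //.
- by move=> y _; rewrite mule_ge0// riesz_potential_ge0.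
- apply: emeasurable_funM; first exact: measurable_riesz_potential (me c) (e0 c).
  by apply/measurable_EFinP; exact: me.
- by apply: emeasurable_funM => //; exact/measurable_EFinP.
move=> y _; rewrite -[X in X <= _]/(riesz_potential alpha (e c) y * (e c y)%:E).
rewrite (riesz_potentialM (me c) (e0 c) (e0 c)).
have -> : J = \int[leb]_x (K (1 *: x + - y) * e (c / 2) (1 *: x + - y))%:E.
  rewrite (@integral_affine _ _ 1 (- y) (fun z => (K z * e (c / 2) z)%:E))//.
  - by left.
  - by apply/measurable_EFinP; exact: measurable_funM.
  - by move=> z; rewrite lee_fin mulr_ge0.
have mA : measurable_fun setT (fun x : V => (1 *: x + - y)%R).
  exact: measurable_affine.
have mJ : measurable_fun setT
    (fun x : V => (K (1 *: x + - y) * e (c / 2) (1 *: x + - y))%:E).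
  apply/measurable_EFinP; apply: measurable_funM.
    exact: (measurableT_comp mK mA).
  exact: (measurableT_comp (me (c / 2)%R) mA).
have J_ge0 (x : V) : setT x ->
    0 <= (K (1 *: x + - y) * e (c / 2) (1 *: x + - y))%:E.
  by rewrite lee_fin mulr_ge0.
have ey0 : 0 <= (e (c / 2)%R y)%:E by rewrite lee_fin.
rewrite -(ge0_integralZr leb measurableT mJ J_ge0 ey0).
apply: ge0_le_integral => //.
- by move=> x _; rewrite lee_fin !mulr_ge0.
- exact: (measurableT_comp (measurable_riesz_integrand (me c) (me c))
    (measurable_pair2 y)).
- exact: (emeasurable_funM mJ (measurable_cst _)).
- move=> x _; rewrite -EFinM lee_fin scale1r /= mulrAC [leLHS]mulrC -mulrA.
  rewrite ler_wpM2l// /e -!expRD ler_expR.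
  have := ler_wpM2l (ltW c20) (ler_normB x y).
  have := mulr_ge0 (ltW c20) (normr_ge0 x); lra.
Qed.

Lemma lebesgue_rV_set1 (y : V) : leb [set y] = 0.
Proof.
apply: (lebesgue_null_line (v := const_mx 1%R)) => [|_ t -> t0 /rowP/=].
  rewrite (_ : [set y] = closed_box y y); first exact: measurable_closed_box.
  apply/seteqP; split => [_ -> i|x yx]; first by rewrite in_itv/= lexx.
  by apply/rowP => i; have := yx i; rewrite in_itv/= => /le_anti.
move=> /(_ (Ordinal n_gt0)); rewrite !mxE mulr1 => /eqP.
by rewrite -subr_eq0 addrAC subrr add0r (negbTE t0).
Qed.

(** The kernel is positive off the diagonal, so a potential that vanishes at a single point forces
    [f] to vanish almost everywhere. *)
Lemma riesz_energy_eq0 (f : V -> R) :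
  measurable_fun setT f -> (forall x, (0 <= f x)%R) ->
  riesz_energy alpha f = 0 <-> \int[leb]_x (f x)%:E = 0.
Proof.
move=> mf f0.
have mfE : measurable_fun setT (EFin \o f) by exact/measurable_EFinP.
have fE0 x : 0 <= (EFin \o f) x by rewrite lee_fin.
have mP := measurable_riesz_potential mf f0.
have P0 := riesz_potential_ge0 f0.
have mN : measurable [set x | (EFin \o f) x != 0].
  by rewrite -[X in measurable X]setTI; exact: emeasurable_neq.
have mKy y : measurable_fun setT (fun x => (f x * K (x - y))%:E).
  apply/measurable_EFinP; apply: measurable_funM => //.
  exact: measurable_riesz_kernelB.
have mPf : measurable_fun setT (fun y => riesz_potential alpha f y * (f y)%:E).
  by apply: emeasurable_funM => //; exact/measurable_EFinP.
have Pf0 y : 0 <= riesz_potential alpha f y * (f y)%:E.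
  by rewrite mule_ge0// lee_fin.
rewrite -[X in _ <-> X]/(\int[leb]_x (EFin \o f) x = 0).
rewrite (ge0_integral_eq0P leb mfE fE0) (ge0_integral_eq0P leb mPf Pf0).
have mset (F : V -> \bar R) : measurable_fun setT F ->
    measurable [set x | F x != 0].
  by move=> mF; rewrite -[X in measurable X]setTI; exact: emeasurable_neq.
split => [Ef0|fN0]; last first.
  apply: subset_measure0 fN0 => //; first exact: mset.
  by move=> x /=; apply: contra => /eqP; rewrite /= => ->; rewrite mule0.
(* If [f] is not almost everywhere [0], its potential vanishes nowhere, so [f] and the integrand of
   the energy are nonzero on the same set. *)
have [//|fN0] := eqVneq (leb [set x | (EFin \o f) x != 0]) 0.
rewrite -[RHS]Ef0; congr (leb _); apply/seteqP; split => y /=; last first.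
  by apply: contra => /eqP; rewrite /= => ->; rewrite mule0.
move=> fy; rewrite mule_eq0 negb_or fy andbT; apply: contra fN0 => /eqP.
rewrite -[X in X = _]/(\int[leb]_x (f x * K (x - y))%:E).
rewrite (ge0_integral_eq0P leb (mKy y)) => [Ky|x]; last first.
  by rewrite lee_fin mulr_ge0.
have mU := measurableU _ _ (mset _ (mKy y)) (measurable_closed_box y y).
apply/eqP; apply: (@subset_measure0 _ _ _ leb _ _ mN mU).
  move=> x /= fx; have [xy|xy] := eqVneq x y.
    by right => i; rewrite xy in_itv/= lexx.
  left; rewrite eqe mulf_neq0// gt_eqF// riesz_kernel_gt0//.
  by rewrite subr_eq0.
apply: null_set_setU => //; [exact: mset|exact: measurable_closed_box|].
rewrite (_ : closed_box y y = [set y]); first exact: lebesgue_rV_set1.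
apply/seteqP; split => [x yx|_ -> i]; last by rewrite in_itv/= lexx.
by apply/rowP => i; have := yx i; rewrite in_itv/= => /le_anti.
Qed.

Lemma riesz_energy_usc (f_ : nat -> V -> R) (f D : V -> R) :
  (forall k, measurable_fun setT (f_ k)) -> measurable_fun setT f ->
  measurable_fun setT D ->
  (forall k x, (0 <= f_ k x <= D x)%R) -> (forall x, (0 <= f x <= D x)%R) ->
  riesz_energy alpha D < +oo ->
  (forall y (e : R), (0 < e)%R ->
    exists N, forall k, (N <= k)%N -> (f_ k y <= f y + e)%R) ->
  forall e : R, (0 < e)%R -> exists N, forall k, (N <= k)%N ->
    riesz_energy alpha (f_ k) <= riesz_energy alpha f + e%:E.
Proof.
move=> mf_ mf mD f_D fD ED flim e e0.
(* Only limsup f_k <= f is known. The maximum with [f] converges to [f] and stays below [D], so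
   dominated convergence applies to it, and it bounds [f_ k] from above. *)
pose h k x := Num.max (f_ k x) (f x).
have mh k : measurable_fun setT (h k) by exact: measurable_maxr.
have f0 x : (0 <= f x)%R by have /andP[] := fD x.
have D0 x : (0 <= D x)%R by have /andP[fx] := fD x; exact: le_trans.
have h0 k x : (0 <= h k x)%R by rewrite le_max f0 orbT.
have hD k x : (h k x <= D x)%R.
  by rewrite ge_max; have /andP[_ ->] := fD x; have /andP[_ ->] := f_D k x.
pose H (g : V -> R) (p : V * V) := (g p.1 * K (p.1 - p.2) * g p.2)%:E.
have Hlim p : (H (h k) p) @[k --> \oo] --> H f p.
  have hlim y : h k y @[k --> \oo] --> f y.
    apply/cvgrPdist_le => d d0; have [N HN] := flim y d d0.
    exists N => // k /= /HN fk; rewrite distrC ger0_norm ?subr_ge0.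
      by rewrite lerBlDr ge_max [(d + _)%R]addrC fk lerDl ltW.
    by rewrite le_max lexx orbT.
  apply: cvg_EFin; first exact: nearW.
  by apply: cvgM; [apply: cvgM => //; exact: cvg_cst|].
have EDfin : riesz_energy alpha D \is a fin_num.
  by rewrite ge0_fin_numE// riesz_form_diag riesz_form_ge0.
have mH g : measurable_fun setT g -> measurable_fun setT (H g).
  by move=> mg; exact: measurable_riesz_integrand.
have iD : (leb \x leb).-integrable setT (H D).
  apply/integrableP; split; first exact: mH.
  under eq_integral.
    move=> p _; rewrite gee0_abs; last by rewrite lee_fin !mulr_ge0.
    over.
  by rewrite -(riesz_formE mD mD D0 D0).
have HD : forall p (k : nat), setT p -> `|H (h k) p| <= H D p.
  move=> p k _; rewrite gee0_abs; last by rewrite lee_fin !mulr_ge0.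
  by rewrite lee_fin !ler_pM// mulr_ge0.
have [_ _] := @dominated_convergence _ _ _ (leb \x leb) setT measurableT
  (fun k => H (h k)) (H f) (H D) (fun k => mH _ (mh k)) (mH _ mf)
  (aeW _ (fun p _ => Hlim p)) iD (aeW _ HD).
rewrite -(riesz_formE mf mf f0 f0).
have Effin : riesz_form f f \is a fin_num.
  rewrite ge0_fin_numE ?riesz_form_ge0//; apply: le_lt_trans ED.
  exact: le_riesz_form.
rewrite -(fineK Effin) => /fine_cvgP[Ffin /cvgrPdist_le/(_ e e0) Fcvg].
have [N _ HN] := filterI Ffin Fcvg.
exists N => k Nk; have [/= hfin] := HN k Nk.
rewrite -(riesz_formE (mh k) (mh k) (h0 k) (h0 k)) in hfin *.
rewrite ler_distlC => /andP[_ he].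
apply: (@le_trans _ _ (riesz_form (h k) (h k))).
  apply: le_riesz_form => // x; have /andP[-> _] := f_D k x;
    by rewrite le_max lexx.
rewrite riesz_form_diag -(fineK Effin) -(fineK hfin) -EFinD lee_fin.
by rewrite (le_trans he).
Qed.

End riesz_energy_theory.

(** * Legendre conjugates *)

Section conjugate.
Context {R : realType} {n : nat}.
Local Notation V := 'rV[R]_n.
Implicit Types (psi : V -> \bar R) (x y z : V).

Definition proper psi := (forall x, psi x != -oo%E) /\ exists x, (psi x < +oo)%E.

Definition conjugate psi y : \bar R :=
  ereal_sup [set ((dot x y)%:E - psi x)%E | x in setT].

(** For proper [psi] the conjugate is never [-oo], so the exponential is finite and [fine] loses
    nothing. *)
Definition exp_conjugate psi y : R := fine (expeR (- conjugate psi y)%E).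
Local Notation f_ := exp_conjugate.

Lemma conjugate_neNy psi y : proper psi -> conjugate psi y != -oo%E.
Proof.
move=> [psiNy [x psix]]; rewrite -ltNye.
apply: (@lt_le_trans _ _ ((dot x y)%:E - psi x)%E); last first.
  by apply: ereal_sup_ubound; exists x.
by case: (psi x) (psiNy x) psix => // r _ _; rewrite ltNye.
Qed.

Lemma exp_conjugateE psi y : proper psi ->
  (f_ psi y)%:E = expeR (- conjugate psi y)%E.
Proof.
move=> /(@conjugate_neNy _ y); rewrite /f_.
by case: (conjugate psi y).
Qed.

Lemma exp_conjugate_ge0 psi y : 0 <= f_ psi y.
Proof. by rewrite fine_ge0// expeR_ge0. Qed.
Hint Resolve exp_conjugate_ge0 : core.

(** A lower bound on [f] becomes a family of affine lower bounds on [psi]; most later arguments use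
    this form, which avoids suprema and infinite values of the conjugate. *)
Lemma exp_conjugate_geP psi y (b : R) : proper psi -> 0 < b ->
  b <= f_ psi y <-> forall x, ((dot x y + ln b)%:E <= psi x)%E.
Proof.
move=> ppsi b0; rewrite -lee_fin exp_conjugateE//.
have -> : (b%:E <= expeR (- conjugate psi y))%E =
          (conjugate psi y <= (- ln b)%:E)%E.
  rewrite -[in LHS](@lnK R b)// -[X in (X <= _)%E]/(expeR (ln b)%:E) lee_expeR.
  by rewrite EFinN leeNr.
have E x : ((dot x y + ln b)%:E <= psi x)%E =
    ((dot x y)%:E - psi x <= (- ln b)%:E)%E.
  have := ppsi.1 x; case: (psi x) => [r| |]//= _; last by rewrite leNye leey.
  by rewrite -EFinB !lee_fin; apply/idP/idP; lra.
split=> [psib x|psib].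
  by rewrite E; apply: le_trans psib; apply: ereal_sup_ubound; exists x.
by apply: ge_ereal_sup => _ [x _ <-]; rewrite -E.
Qed.

Lemma exp_conjugate_ltP psi y (b : R) : proper psi -> 0 < b ->
  f_ psi y < b <-> exists x, (psi x < (dot x y + ln b)%:E)%E.
Proof.
move=> ppsi b0; rewrite ltNge; split.
  move=> /negP fb; apply: contrapT => /forallNP psib; apply: fb.
  by apply/(exp_conjugate_geP y ppsi b0) => x; rewrite leNgt; apply/negP.
move=> [x psix]; apply/negP => /(exp_conjugate_geP y ppsi b0)/(_ x).
by rewrite leNgt psix.
Qed.

(** For [b > 0] the set is a union over [x] of sets given by one strict affine inequality.
    Measurability and upper semicontinuity of [f] both come from this. *)
Lemma open_exp_conjugate_lt psi (b : R) : proper psi ->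
  open [set y | f_ psi y < b].
Proof.
move=> ppsi; have [b0|b0] := leP b 0.
  rewrite (_ : [set _ | _] = set0); first exact: open0.
  by apply/seteqP; split => // y /=; rewrite ltNge (le_trans b0).
rewrite (_ : [set _ | _] = \bigcup_x [set y | (psi x < (dot x y + ln b)%:E)%E]).
  apply: bigcup_open => x _; have := ppsi.1 x.
  case: (psi x) => [r _|_|]; last by rewrite eqxx.
    rewrite (_ : [set _ | _] = dot x @^-1` [set t | r - ln b < t]).
      by apply: open_comp => [y _|]; [exact: continuous_dot|exact: open_gt].
    by apply/seteqP; split => y /=; rewrite lte_fin ltrBlDr.
  rewrite (_ : [set _ | _] = set0); first exact: open0.
  by apply/seteqP; split.
apply/seteqP; split => y /=.
  by move=> /(exp_conjugate_ltP y ppsi b0)[x psix]; exists x.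
by move=> [x _ psix]; apply/(exp_conjugate_ltP y ppsi b0); exists x.
Qed.

Lemma measurable_exp_conjugate psi : proper psi -> measurable_fun setT (f_ psi).
Proof.
move=> ppsi; apply: measurability; first exact: RGenInftyO.measurableE.
move=> _ [_ [b ->] <-]; rewrite setTI; apply: open_measurable_rV.
rewrite (_ : _ @^-1` _ = [set y | f_ psi y < b]).
  exact: open_exp_conjugate_lt.
by apply/seteqP; split => y /=; rewrite in_itv.
Qed.

Lemma exp_conjugate_usc psi : proper psi -> upper_semicontinuous (f_ psi).
Proof.
move=> ppsi; apply/lower_semicontinuousP => a.
rewrite (_ : [set _ | _] = [set y | f_ psi y < - a]).
  exact: open_exp_conjugate_lt.
by apply/seteqP; split => y /=; rewrite lte_fin ltrNr.
Qed.

Lemma conjugate_convex psi : proper psi -> convex_efun (conjugate psi).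
Proof.
move=> ppsi x y t /andP[t0 t1]; apply: ge_ereal_sup => _ [z _ <-].
have t1' : 0 <= 1 - t by rewrite subr_ge0.
have zle u : ((dot z u)%:E - psi z <= conjugate psi u)%E.
  by apply: ereal_sup_ubound; exists z.
apply: (@le_trans _ _ (t%:E * ((dot z x)%:E - psi z) +
    (1 - t)%:E * ((dot z y)%:E - psi z))%E); last first.
  by apply: leeD; apply: lee_wpmul2l.
have := ppsi.1 z; case: (psi z) => [r| |] // _; last by rewrite leNye.
by rewrite -!EFinB -!EFinM -EFinD lee_fin dotDr !dotZr; lra.
Qed.

Lemma exp_conjugate_log_concave psi : proper psi -> log_concave (f_ psi).
Proof.
move=> ppsi; exists (conjugate psi); split.
- by move=> y; exact: conjugate_neNy.
- exact: conjugate_convex.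
- by move=> y; exact: exp_conjugateE.
Qed.

(** For each [x], the affine bounds at [y] and at [z] are averaged. Thresholds [a] and [b] in place
    of the values of [f] serve where these values are only known to be bounded below. *)
Lemma exp_conjugate_combination psi y z (s a b : R) : proper psi ->
  0 <= s <= 1 -> 0 < a <= f_ psi y -> 0 < b <= f_ psi z ->
  expR (s * ln a + (1 - s) * ln b) <= f_ psi (s *: y + (1 - s) *: z).
Proof.
move=> ppsi /andP[s0 s1] /andP[a0 /(exp_conjugate_geP _ ppsi a0) fy].
move=> /andP[b0 /(exp_conjugate_geP _ ppsi b0) fz].
apply/(exp_conjugate_geP _ ppsi (expR_gt0 _)) => x.
rewrite expRK dotDr !dotZr; have := fy x; have := fz x; have := ppsi.1 x.
case: (psi x) => [r _|_ _ _|]; last by rewrite eqxx.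
  by rewrite !lee_fin; nra.
by rewrite leey.
Qed.

Lemma eq_from_ge (u v : R) : 0 <= u -> 0 <= v ->
  (forall b, 0 < b -> (b <= u <-> b <= v)) -> u = v.
Proof.
move=> u0 v0 uv; apply/eqP; rewrite eq_le; apply/andP; split.
  have [->//|un0] := eqVneq u 0; have {}un0 : 0 < u by rewrite lt0r un0.
  by apply/(uv _ un0).
have [->//|vn0] := eqVneq v 0; have {}vn0 : 0 < v by rewrite lt0r vn0.
by apply/(uv _ vn0).
Qed.

Lemma exp_conjugateN psi y : proper psi -> (forall x, psi (- x) = psi x) ->
  f_ psi (- y) = f_ psi y.
Proof.
move=> ppsi epsi; apply: eq_from_ge => // b b0.
split=> /(exp_conjugate_geP _ ppsi b0) h; apply/(exp_conjugate_geP _ ppsi b0) => x.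
  by have := h (- x); rewrite dotNl dotNr opprK epsi.
by have := h (- x); rewrite dotNl -dotNr epsi.
Qed.

Lemma properD psi (c : R) : proper psi -> proper (fun x => psi x + c%:E)%E.
Proof.
move=> [psiNy [x psix]]; split => [{psix}{}x|].
  by have := psiNy x; case: (psi x).
by exists x; case: (psi x) (psiNy x) psix => // r _ _; rewrite ltry.
Qed.

Lemma exp_conjugateD psi (c : R) y : proper psi ->
  f_ (fun x => psi x + c%:E)%E y = expR c * f_ psi y.
Proof.
move=> ppsi; have pc := properD c ppsi.
apply: eq_from_ge => //; first by rewrite mulr_ge0// expR_ge0.
move=> b b0; have bc0 : 0 < b / expR c by rewrite divr_gt0// expR_gt0.
rewrite mulrC -ler_pdivrMr ?expR_gt0//.
have E x : ((dot x y + ln b)%:E <= psi x + c%:E)%E =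
    ((dot x y + ln (b / expR c))%:E <= psi x)%E.
  rewrite ln_div ?posrE ?expR_gt0// expRK.
  have := ppsi.1 x; case: (psi x) => [r| |]//= _; last by rewrite !leey.
  by rewrite !lee_fin addrA lerBlDr.
split=> [/(exp_conjugate_geP _ pc b0) h|/(exp_conjugate_geP _ ppsi bc0) h].
  by apply/(exp_conjugate_geP _ ppsi bc0) => x; rewrite -E.
by apply/(exp_conjugate_geP _ pc b0) => x; rewrite E.
Qed.

Lemma le_exp_conjugate psi psi' y : proper psi -> proper psi' ->
  (forall x, psi x <= psi' x)%E -> f_ psi y <= f_ psi' y.
Proof.
move=> ppsi ppsi' le_psi; have [->//|fn0] := eqVneq (f_ psi y) 0.
have {}fn0 : 0 < f_ psi y by rewrite lt0r fn0/=.
apply/(exp_conjugate_geP _ ppsi' fn0) => x; apply: le_trans (le_psi x).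
by move: x; apply/(exp_conjugate_geP _ ppsi fn0).
Qed.

End conjugate.

Section sphere.
Context {R : realType} {n : nat}.
Local Notation V := 'rV[R]_n.

Lemma sphere_cluster (u : nat -> V) : (forall m, `|u m| = 1) ->
  exists2 v : V, `|v| = 1 &
    forall j, exists2 m, (j <= m)%N & `|u m - v| <= j.+1%:R^-1.
Proof.
move=> u1; pose S := [set x : V | `|x| = 1].
have cS : compact S.
  apply: bounded_closed_compact.
    exists 1; split; first exact: num_real.
    by move=> M M1 x /= ->; exact: ltW.
  rewrite (_ : S = (fun x : V => `|x|) @^-1` [set 1])//.
  apply: preimage_closed => [x _|]; first exact: norm_continuous.
  exact: closed_eq.
have uS : (u @ \oo) S by exists 0%N => // m _; exact: u1.
have [v [v1 clv]] := cS (u @ \oo) (fmap_proper_filter u eventually_filter) uS.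
exists v => // j.
have uj : (u @ \oo) [set u m | m in [set m | (j <= m)%N]].
  by exists j => // m /= jm; exists m.
have [] := clv _ _ uj (nbhsx_ballx v j.+1%:R^-1 _).
  by rewrite invr_gt0.
move=> _ [[m jm <-]]; rewrite -ball_normE/= distrC => /ltW umv.
by exists m.
Qed.

End sphere.

(** * Coercivity *)

Section coercivity.
Context {R : realType} {n : nat}.
Local Notation V := 'rV[R]_n.
Variable mu : {measure set V -> \bar R}.
Hypothesis mu_finite : (mu setT < +oo)%E.
Hypothesis mu_neq0 : mu setT != 0%E.
Hypothesis mu_subspace : forall W : {vspace V}, W != fullv ->
  ~ concentrated_in mu [set x | x \in W].
Hypothesis mu_moment : (\int[mu]_x (euclidean_norm x)%:E < +oo)%E.

Definition mass := fine (mu setT).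

Lemma massE : mu setT = mass%:E.
Proof. by rewrite fineK// ge0_fin_numE. Qed.

Lemma mass_gt0 : 0 < mass.
Proof. by rewrite fine_gt0// mu_finite lt0e mu_neq0 measure_ge0. Qed.

Local Open Scope ereal_scope.

Lemma integral_cst_mass (c : R) : (0 <= c)%R ->
  \int[mu]_x c%:E = (c * mass)%:E.
Proof. by move=> c0; rewrite integral_cst// massE. Qed.

Let M1 := \int[mu]_x (`|x|)%:E.

Let mnE : measurable_fun setT (fun x : V => (`|x|)%:E).
Proof. by apply/measurable_EFinP; exact: measurable_norm_rV. Qed.

Let M1fin : M1 \is a fin_num.
Proof.
rewrite ge0_fin_numE; last by apply: integral_ge0 => x _; rewrite lee_fin.
apply: le_lt_trans mu_moment; apply: ge0_le_integral => //.
- by apply/measurable_EFinP; exact: measurable_euclidean_norm.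
- by move=> x _; rewrite lee_fin norm_le_euclidean.
Qed.

Definition abs_moment (t : V) := \int[mu]_x (`|dot x t|)%:E.
Local Notation N := abs_moment.

Lemma measurable_abs_dot (t : V) : measurable_fun setT (fun x => (`|dot x t|)%:E).
Proof.
apply/measurable_EFinP; apply: measurableT_comp => //.
by under eq_fun do rewrite dotC; exact: measurable_dot.
Qed.
Hint Resolve measurable_abs_dot : core.

Let N0 t : 0 <= N t.
Proof. by apply: integral_ge0 => x _; rewrite lee_fin. Qed.

Let N_lip s t : N s <= N t + (n%:R * `|s - t|)%:E * M1.
Proof.
have c0 : (0 <= n%:R * `|s - t|)%R by rewrite mulr_ge0.
rewrite -ge0_integralZl_EFin//.
rewrite -ge0_integralD//; last by apply: emeasurable_funM.
apply: ge0_le_integral => //.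
- by apply: emeasurable_funD => //; apply: emeasurable_funM.
move=> x _; rewrite -EFinM -EFinD lee_fin.
rewrite -[in leLHS](subrK t s) addrC dotDr (le_trans (ler_normD _ _))// lerD2l.
by rewrite (le_trans (dot_le_norm _ _))// mulrA mulrAC.
Qed.

Let NZ (a : R) t : N (a *: t)%R = (`|a|)%:E * N t.
Proof.
rewrite -ge0_integralZl_EFin//.
by apply: eq_integral => x _; rewrite dotZr normrM EFinM.
Qed.

(** If the integral vanishes, [mu] is carried by the hyperplane orthogonal to [t], here the kernel
    of [x |-> x *m t^T], against [mu_subspace]. *)
Let N_eq0 t : N t = 0 -> t = 0%R.
Proof.
have mt : measurable_fun setT (fun x => (`|dot x t|)%:E) by [].
have t0 x : 0 <= (`|dot x t|)%:E by rewrite lee_fin.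
move=> /(ge0_integral_eq0P mu mt t0) Nt; apply/eqP; apply: contrapT => /negP tn0.
pose W : {vspace V} := lker (linfun (mulmxr t^T : V -> 'rV[R]_1)).
have WE x : (x \in W) = (dot x t == 0%R).
  rewrite memv_ker lfunE/=; have E : (x *m t^T) 0%R 0%R = dot x t.
    by rewrite mxE; apply: eq_bigr => i _; rewrite mxE.
  apply/eqP/eqP => [xt|xt]; first by rewrite -E xt mxE.
  by apply/matrixP => i j; rewrite (ord1 i) (ord1 j) E xt mxE.
apply: (@mu_subspace W).
  apply/eqP => WT; have := WE t; rewrite WT memvf => /esym/eqP tt.
  by have := dotxx_gt0 tn0; rewrite tt ltxx.
rewrite /concentrated_in -Nt; congr (mu _); apply/seteqP; split => x /=.
  by move/negP; rewrite WE => xt; rewrite eqe normr_eq0.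
by rewrite eqe normr_eq0 => xt; apply/negP; rewrite WE.
Qed.

(** [abs_moment] is homogeneous, Lipschitz and nonzero off [0]; on the compact unit sphere it is
    therefore bounded away from [0]. *)
Lemma abs_moment_coercive :
  exists2 c : R, (0 < c)%R & forall t, (c * `|t|)%:E <= N t.
Proof.
apply: contrapT => nc.
have /(_ _)/cid H m : exists t : V, N t < (m.+1%:R^-1 * `|t|)%:E.
  apply: contrapT => /forallNP h; apply: nc; exists m.+1%:R^-1%R => // t.
  by rewrite leNgt; apply/negP.
pose t m := projT1 (H m).
have tE m : N (t m) < (m.+1%:R^-1 * `|t m|)%:E by exact: projT2 (H m).
have t_gt0 m : (0 < `|t m|)%R.
  have := le_lt_trans (N0 _) (tE m); rewrite lte_fin.
  by rewrite pmulr_rgt0.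
pose u m := (`|t m|^-1 *: t m)%R.
have u1 m : `|u m|%R = 1%R.
  by rewrite normrZ normfV normr_id mulVf// gt_eqF.
have Nu m : N (u m) <= (m.+1%:R^-1)%:E.
  rewrite NZ normfV normr_id.
  have -> : (m.+1%:R^-1 = `|t m|^-1 * (m.+1%:R^-1 * `|t m|) :> R)%R.
    by rewrite mulrCA mulVf ?mulr1// gt_eqF.
  by rewrite EFinM lee_pmul2l ?lte_fin ?invr_gt0// ltW.
have [v v1 vE] := sphere_cluster u1.
suff /N_eq0 v0 : N v = 0 by move: v1; rewrite v0 normr0 => /eqP; rewrite eq_sym oner_eq0.
apply/eqP; rewrite eq_le N0 andbT.
(* [N v] is at most [N (u m)], itself at most [1 / (j + 1)], plus the Lipschitz error
   [n * M1 / (j + 1)]. *)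
pose L : R := (1 + n%:R * fine M1)%R.
have L0 : (0 <= fine M1)%R.
  by rewrite fine_ge0//; apply: integral_ge0 => x _; rewrite lee_fin.
have NvL j : N v <= (j.+1%:R^-1 * L)%:E.
  have [m jm um] := vE j; apply: le_trans (N_lip v (u m)) _.
  rewrite -(fineK M1fin) -EFinM mulrDr mulr1 EFinD; apply: leeD.
    apply: le_trans (Nu m) _.
    by rewrite lee_fin lef_pV2 ?posrE// ler_nat.
  rewrite lee_fin [leRHS]mulrCA -mulrA ler_wpM2l// ler_wpM2r//.
  by rewrite distrC.
apply/lee_addgt0Pr => e e0; rewrite add0e.
pose j := Num.truncn (L / e).
apply: le_trans (NvL j) _; rewrite lee_fin mulrC ler_pdivrMr//.
by rewrite mulrC -ler_pdivrMr// ltW// truncnS_gt.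
Qed.

Definition admissible (psi : V -> \bar R) :=
  [/\ measurable_fun setT psi, forall x, 0 <= psi x &
      forall x, psi (- x)%R = psi x].

Definition moment (psi : V -> \bar R) := \int[mu]_x psi x.

Lemma moment_ge0 psi : admissible psi -> 0 <= moment psi.
Proof. by move=> [_ psi0 _]; apply: integral_ge0 => x _. Qed.

Lemma admissible_proper psi : admissible psi -> moment psi < +oo -> proper psi.
Proof.
move=> [mpsi psi0 _] momfin; split => [x|].
  by rewrite -ltNye (lt_le_trans _ (psi0 x))// ltNy0.
apply: contrapT => /forallNP psiy; move: momfin.
rewrite (_ : moment psi = +oo) ?ltxx//.
transitivity (\int[mu]_x (cst +oo) x).
  apply: eq_integral => x _; apply/eqP; rewrite -leye_eq leNgt.
  exact/negP.
by rewrite integral_cst// gt0_mulye// lt0e mu_neq0 measure_ge0.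
Qed.

Lemma abs_dot_le psi (y : V) (b : R) : admissible psi -> proper psi ->
  (0 < b <= exp_conjugate psi y)%R ->
  forall x, (`|dot x y| + ln b)%:E <= psi x.
Proof.
move=> [_ _ epsi] ppsi /andP[b0 /(exp_conjugate_geP _ ppsi b0) h] x.
have [d0|d0] := leP 0%R (dot x y); first by rewrite ger0_norm.
by rewrite ltr0_norm//; have := h (- x)%R; rewrite dotNl epsi.
Qed.

(** Otherwise [abs_dot_le] bounds [psi] from below by the logarithm of a value of [f] above [1],
    against [inf psi = 0]. *)
Lemma exp_conjugate_le1 psi y : admissible psi -> proper psi ->
  (forall e : R, (0 < e)%R -> exists x, psi x < e%:E) ->
  (exp_conjugate psi y <= 1)%R.
Proof.
move=> apsi ppsi inf0; rewrite leNgt; apply/negP => f1.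
have f0 : (0 < exp_conjugate psi y)%R by rewrite (lt_trans ltr01).
have := abs_dot_le apsi ppsi (y := y) (b := exp_conjugate psi y).
rewrite f0 lexx => /(_ erefl) h.
have [x] := inf0 (ln (exp_conjugate psi y)) (ln_gt0 f1).
rewrite ltNge => /negP; apply; apply: le_trans (h x).
by rewrite lee_fin lerDr.
Qed.

(** Integrating [abs_dot_le] over [mu] gives [c |y| + mass * ln (f y) <= A * mass]. *)
Lemma exp_conjugate_le_exp psi (A c : R) : (0 < c)%R ->
  (forall t, (c * `|t|)%:E <= N t) ->
  admissible psi -> moment psi <= (A * mass)%:E ->
  forall y, (exp_conjugate psi y <= expR (A - c / mass * `|y|))%R.
Proof.
move=> c0 cN apsi momA y; have m0 := mass_gt0.
have ppsi : proper psi.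
  by apply: admissible_proper => //; apply: le_lt_trans momA (ltry _).
have [->|fn0] := eqVneq (exp_conjugate psi y) 0%R; first exact: expR_ge0.
have {}fn0 : (0 < exp_conjugate psi y)%R by rewrite lt0r fn0 exp_conjugate_ge0.
have := abs_dot_le apsi ppsi (y := y) (b := exp_conjugate psi y).
rewrite fn0 lexx => /(_ erefl) h.
set b := exp_conjugate psi y in fn0 h *.
have [mpsi psi0 _] := apsi.
(* Positive and negative parts of [ln b], so that only nonnegative functions are integrated. *)
pose p : R := Num.max 0%R (ln b); pose q : R := Num.max 0%R (- ln b)%R.
have p0 : (0 <= p)%R by rewrite le_max lexx.
have q0 : (0 <= q)%R by rewrite le_max lexx.
have pq : (p - q = ln b)%R.
  rewrite /p /q; case: (leP 0%R (ln b)) => lb; case: (leP 0%R (- ln b)%R) => lb'; lra.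
have hpq : N y + (p * mass)%:E <= moment psi + (q * mass)%:E.
  rewrite -!integral_cst_mass// -!ge0_integralD//.
  apply: ge0_le_integral => //.
  - by move=> x _; rewrite -EFinD lee_fin addr_ge0.
  - exact: emeasurable_funD.
  - exact: emeasurable_funD.
  move=> x _; have := h x; case: (psi x) (psi0 x) => [r| |] // _.
    by rewrite -!EFinD !lee_fin; lra.
  by move=> _; rewrite addye// leey.
have : (c * `|y|)%:E + (p * mass)%:E <= (A * mass)%:E + (q * mass)%:E.
  apply: le_trans (leeD (cN y) (lexx _)) _; apply: le_trans hpq _.
  exact: leeD.
rewrite -!EFinD lee_fin => H.
rewrite -[leLHS]lnK ?posrE// ler_expR -pq -(ler_pM2r m0).
have E : (c / mass * `|y| * mass = c * `|y|)%R by field; rewrite gt_eqF.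
by rewrite !mulrBl E; lra.
Qed.

End coercivity.

(* The limits are those along a nonprincipal ultrafilter on [nat]. *)
Lemma diagonal_extraction (R : realType) (T : countType) (u : nat -> T -> R) :
  (forall k q, 0 <= u k q <= 1) ->
  exists2 s : nat -> nat, (forall k, (k <= s k)%N) &
    forall q, exists l, forall e, 0 < e ->
      exists N, forall k, (N <= k)%N -> `|u (s k) q - l| <= e.
Proof.
move=> u01; have [G [UG GN]] := ultraFilterLemma eventually_filter.
have PG : ProperFilter G by exact: ultra_proper.
have /(_ _)/cid lim q : exists l, forall e, 0 < e ->
    G [set k | `|u k q - l| <= e].
  have cI := @segment_compact R 0 1.
  have FI : (u^~ q @ G) `[0, 1]%classic.
    by apply: (@filterS _ G _ setT) filterT => k _ /=; rewrite in_itv/= u01.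
  have [l [_ cl]] := cI (u^~ q @ G) (fmap_proper_filter _ PG) FI.
  exists l => e e0; case: (in_ultra_setVsetC [set k | `|u k q - l| <= e] UG) => //.
  move=> Ge; have Fe : G [set k | e < `|u k q - l|].
    by apply: filterS Ge => k /= /negP; rewrite -ltNge.
  have [x [/= ex]] := cl [set x : R | e < `|x - l|] _ Fe (nbhsx_ballx l e e0).
  by rewrite -ball_normE/= distrC => /lt_trans /(_ ex); rewrite ltxx.
pose l q := projT1 (lim q).
have lE q e : 0 < e -> G [set k | `|u k q - l q| <= e] by exact: (projT2 (lim q)).
(* A tail and finitely many closeness conditions all belong to the filter, hence share an index;
   stage [k] treats the points whose code is less than [k]. *)
have /(_ _)/cid sub k : exists m, (k <= m)%N /\ forall i : 'I_k,
    if unpickle i is Some q then `|u m q - l q| <= k.+1%:R^-1 else true.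
  apply: (@filter_ex _ G); apply: filterI.
    by apply: GN; exists k.
  apply: (@filter_forall nat 'I_k (fun i m => is_true
    (if unpickle i is Some q then `|u m q - l q| <= k.+1%:R^-1 else true))) => i.
  case: (unpickle i) => [q|]; last exact: nearW.
  by apply: lE; rewrite invr_gt0.
exists (fun k => projT1 (sub k)) => [k|q]; first by case: (projT2 (sub k)).
exists (l q) => e e0; exists (maxn (pickle q).+1 (Num.truncn e^-1)) => k.
rewrite geq_max => /andP[qk ek]; have [_ /(_ (Ordinal qk))/=] := projT2 (sub k).
rewrite pickleK => /le_trans; apply.
rewrite -[leRHS]invrK lef_pV2 ?posrE ?invr_gt0//.
by rewrite (le_trans (ltW (truncnS_gt _)))// ler_nat.
Qed.

Lemma limn_einf_ge (R : realType) (u : nat -> \bar R) (c : \bar R) N :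
  (forall k, (N <= k)%N -> c <= u k)%E -> (c <= limn_einf u)%E.
Proof.
move=> cu; rewrite limn_einf_lim (cvg_lim _ (@cvg_einfs_sup _ u))//.
apply: le_trans (ereal_sup_ubound (ex_intro2 _ _ N I erefl)).
by apply: le_ereal_inf_tmp => _ [k /= Nk <-]; exact: cu.
Qed.

Lemma limn_einf_gt (R : realType) (u : nat -> \bar R) (c : \bar R) :
  (c < limn_einf u)%E -> exists N, forall k, (N <= k)%N -> (c < u k)%E.
Proof.
rewrite limn_einf_lim (cvg_lim _ (@cvg_einfs_sup _ u))//.
move=> /ereal_sup_gt[_ [N _ <-] cN]; exists N => k Nk.
by apply: lt_le_trans cN _; apply: ereal_inf_lbound; exists k.
Qed.

Lemma quadratic_limit1_le (R : realFieldType) (z a c r : R) :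
  (forall t, 0 < t < 1 -> (1 - t) ^+ 2 * z + a + t * c <= r) -> z + a <= r.
Proof.
move=> H; rewrite leNgt; apply/negP => rlt.
(* [3 |z| + |c|] bounds the coefficient of [t] in the error [(1 - t) ^ 2 * z - z + t * c]. *)
pose K := 3 * `|z| + `|c| + 1.
have K0 : 0 < K by rewrite ltr_wpDl// addr_ge0// mulr_ge0.
pose g := z + a - r; have g0 : 0 < g by rewrite subr_gt0.
pose t := Num.min (1 / 2) (g / (2 * K)).
have t0 : 0 < t by rewrite lt_min !divr_gt0// mulr_gt0.
have t1 : t < 1 by rewrite gt_min; apply/orP; left; lra.
have tK : t * K <= g / 2.
  apply: le_trans (_ : g / (2 * K) * K <= _).
    by rewrite ler_wpM2r ?(ltW K0)// ge_min lexx orbT.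
  by rewrite le_eqVlt; apply/orP; left; apply/eqP; field; rewrite gt_eqF.
have := H t; rewrite t0 t1 => /(_ erefl).
have A0 : 0 <= `|z| by [].
have h1 : t * z <= t * `|z| by rewrite ler_wpM2l ?(ltW t0)// ler_norm.
have h2 : - (t * t * `|z|) <= t * t * z.
  rewrite -mulrN ler_wpM2l ?mulr_ge0 ?(ltW t0)//.
  exact: lerNnormlW.
have h3 : t * t * `|z| <= t * `|z|.
  by rewrite ler_wpM2r// ler_piMr ?(ltW t0) ?(ltW t1).
have h4 : - (t * `|c|) <= t * c.
  rewrite -mulrN ler_wpM2l ?(ltW t0)//; exact: lerNnormlW.
move: tK; rewrite /K /g in g0 *; lra.
Qed.

(** * Compactness of conjugates *)

Section compactness.
Context {R : realType} {n : nat}.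
Local Notation V := 'rV[R]_n.
Local Notation leb := (@lebesgue_measure_rV R n).
Local Notation f_ := (@exp_conjugate R n).
Variable alpha : R.
Hypotheses (n_gt0 : (0 < n)%N) (alpha_gt0 : 0 < alpha).

(** A witness [x] of [f t < d] also serves, up to sign, at every [t'] with [|<x, t'>| >= <x, t>]. It
    is nonzero, because [psi >= 0] and [d <= 1], and can be normalized; so [f < d] outside a slab
    whose width is proportional to [|t|]. *)
Lemma exp_conjugate_slab (psi : V -> \bar R) t (d : R) : proper psi ->
  (forall x, 0 <= psi x)%E -> (forall x, psi (- x) = psi x) ->
  0 < d <= 1 -> f_ psi t < d ->
  exists2 u : V, `|u| = 1 &
    forall t', n%:R * `|t| <= `|dot u t'| -> f_ psi t' < d.
Proof.
move=> ppsi psi0 epsi /andP[d0 d1] /(exp_conjugate_ltP _ ppsi d0)[x psix].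
have dx : 0 < dot x t + ln d by rewrite -lte_fin (le_lt_trans (psi0 x)).
have xn0 : x != 0.
  apply/eqP => x0; move: dx; rewrite x0 /dot big1 ?add0r => [|i _].
    by rewrite ltNge ln_le0.
  by rewrite mxE mul0r.
have nx : 0 < `|x| by rewrite normr_gt0.
exists (`|x|^-1 *: x) => [|t']; first by rewrite normrZ normfV normr_id mulVf ?gt_eqF.
rewrite dotZl normrM normfV normr_id [leRHS]mulrC ler_pdivlMr// => tt'.
have xtt' : dot x t <= `|dot x t'|.
  apply: le_trans tt'; apply: le_trans (ler_norm _) _.
  by apply: le_trans (dot_le_norm _ _) _; rewrite mulrAC mulrA.
apply/(exp_conjugate_ltP _ ppsi d0).
have [d'0|d'0] := leP 0 (dot x t').
  exists x; apply: lt_le_trans psix _; rewrite lee_fin lerD2r.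
  by rewrite ger0_norm in xtt'.
exists (- x); rewrite epsi dotNl; apply: lt_le_trans psix _.
by rewrite lee_fin lerD2r; rewrite ltr0_norm in xtt'.
Qed.

(** Otherwise some of the functions are small outside ever thinner slabs. Along normals converging
    to some [v] they tend to [0] off the hyperplane orthogonal to [v], and upper semicontinuity of
    the energy contradicts the lower bound [e0]. *)
Lemma nondegenerate (psi_ : nat -> V -> \bar R) (D : V -> R) (e0 : R) :
  (forall k, proper (psi_ k)) -> (forall k x, 0 <= psi_ k x)%E ->
  (forall k x, psi_ k (- x) = psi_ k x) ->
  measurable_fun setT D -> (forall k y, f_ (psi_ k) y <= D y) ->
  (riesz_energy alpha D < +oo)%E -> 0 < e0 ->
  (forall k, e0%:E <= riesz_energy alpha (f_ (psi_ k)))%E ->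
  exists m, forall k, (m <= k)%N -> forall t, `|t| <= m.+1%:R^-1 ->
    m.+1%:R^-1 <= f_ (psi_ k) t.
Proof.
move=> ppsi psi0 epsi mD fD ED e0_gt0 Ee0; apply: contrapT => /forallNP nd.
have /(_ _)/cid H m : exists p : nat * V, [/\ (m <= p.1)%N, `|p.2| = 1 &
    forall y, n%:R / m.+1%:R <= `|dot p.2 y| ->
      f_ (psi_ p.1) y < m.+1%:R^-1].
  have /existsNP[k /not_implyP[mk /existsNP[t /not_implyP[tm /negP]]]] := nd m.
  rewrite -ltNge => ft.
  have m01 : 0 < (m.+1%:R^-1 : R) <= 1.
    by rewrite invr_gt0 ltr0n/= invf_le1// ler1n.
  have [u u1 uf] := exp_conjugate_slab (ppsi k) (psi0 k) (epsi k) m01 ft.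
  exists (k, u); split => // y my; apply: uf; apply: le_trans my.
  by rewrite ler_wpM2l.
pose u m := (projT1 (H m)).2.
have [|v v1 vE] := @sphere_cluster R n u.
  by move=> m; have [] := projT2 (H m).
(* The term [n * |y|] pays for replacing the normal [u m] by its limit [v]. *)
have /(_ _)/cid H2 j : exists k, forall y,
    (n%:R + n%:R * `|y|) / j.+1%:R <= `|dot v y| -> f_ (psi_ k) y < j.+1%:R^-1.
  have [m jm um] := vE j; exists (projT1 (H m)).1 => y yj.
  have [_ _ fm] := projT2 (H m).
  have mj : (m.+1%:R^-1 : R) <= j.+1%:R^-1 by rewrite lef_pV2 ?posrE// ler_nat.
  apply: lt_le_trans (mj); apply: fm.
  rewrite -/(u m); have -> : dot (u m) y = dot v y - dot (v - u m) y.
    by rewrite dotBl; ring.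
  apply: le_trans (lerB_dist _ _); rewrite lerBrDr.
  apply: le_trans yj; rewrite mulrDl.
  apply: lerD; first by apply: ler_wpM2l.
  apply: le_trans (dot_le_norm _ _) _; rewrite mulrA mulrAC ler_wpM2l ?mulr_ge0//.
  by rewrite distrC.
pose g j := f_ (psi_ (projT1 (H2 j))).
have gE j y : (n%:R + n%:R * `|y|) / j.+1%:R <= `|dot v y| -> g j y < j.+1%:R^-1.
  exact: (projT2 (H2 j)).
pose P : set V := [set y | dot v y = 0].
have vn0 : v != 0 by rewrite -normr_eq0 v1 oner_eq0.
have mP : measurable P.
  rewrite -[X in measurable X]setTI.
  exact: (measurable_dot v measurableT (measurable_set1 0)).
(* A majorant of the pointwise limits: on the hyperplane only the bound [D] is available, but the
   hyperplane is null. *)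
pose f y := D y * \1_P y.
have D0 y : 0 <= D y by apply: le_trans (fD 0%N y); exact: exp_conjugate_ge0.
have mf : measurable_fun setT f by apply: measurable_funM.
have f0 y : 0 <= f y by rewrite mulr_ge0.
have Ef : riesz_energy alpha f = 0%E.
  apply/(riesz_energy_eq0 alpha n_gt0 mf f0).
  have mfE : measurable_fun setT (EFin \o f) by exact/measurable_EFinP.
  apply/(ge0_integral_eq0P leb mfE); first by move=> y; rewrite lee_fin.
  apply: (@subset_measure0 _ _ _ leb _ P) => //.
  - by rewrite -[X in measurable X]setTI; exact: emeasurable_neq.
  - move=> y /=; rewrite eqe /f indicE.
    by case: (boolP (y \in P)) => [/set_mem//|_]; rewrite mulr0 eqxx.
  - exact: lebesgue_hyperplane.
have gD j y : 0 <= g j y <= D y by rewrite exp_conjugate_ge0 fD.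
have fD' y : 0 <= f y <= D y.
  by rewrite f0 /f ler_piMr// indicE; case: (_ \in _).
have e20 : 0 < e0 / 2 by rewrite divr_gt0.
have gf y e : 0 < e -> exists N, forall k, (N <= k)%N -> g k y <= f y + e.
  move=> e_gt0; have [yP|yP] := eqVneq (dot v y) 0.
    exists 0%N => k _; have -> : f y = D y.
      by rewrite /f indicE mem_set// mulr1.
    by apply: le_trans (fD _ _) _; rewrite lerDl ltW.
  have yP0 : 0 < `|dot v y| by rewrite normr_gt0.
  pose c := (n%:R + n%:R * `|y|) / `|dot v y|.
  exists (maxn (Num.truncn c) (Num.truncn e^-1)) => k; rewrite geq_max => /andP[ck ek].
  have : g k y < k.+1%:R^-1.
    apply: gE; rewrite ler_pdivrMr// [leRHS]mulrC -ler_pdivrMr//.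
    by rewrite (le_trans (ltW (truncnS_gt _)))// ler_nat.
  move=> /ltW /le_trans; apply; apply: le_trans (_ : e <= _); last first.
    by rewrite lerDr.
  rewrite -[leRHS]invrK lef_pV2 ?posrE ?invr_gt0//.
  by rewrite (le_trans (ltW (truncnS_gt _)))// ler_nat.
have [N HN] := riesz_energy_usc (fun j => measurable_exp_conjugate (ppsi _))
  mf mD gD fD' ED gf e20.
have := le_trans (Ee0 _) (HN N (leqnn N)); rewrite Ef add0e lee_fin.
by lra.
Qed.

(** [w] lies on the segment from [y] to a point of the ball where [f >= d]. As [a <= 1], the weight
    [s] of [ln a] may be raised to [1]. *)
Lemma exp_conjugate_interpolation (psi : V -> \bar R) (r d s a : R) y w :
  proper psi -> (forall y, f_ psi y <= 1) -> 0 < d ->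
  (forall b, `|b| <= r -> d <= f_ psi b) -> 0 < s < 1 ->
  0 < a <= f_ psi y -> `|w - s *: y| <= (1 - s) * r ->
  expR (ln a + (1 - s) * ln d) <= f_ psi w.
Proof.
move=> ppsi f1 d0 fd /andP[s0 s1] /andP[a0 fa] wy.
have s1' : 0 < 1 - s by rewrite subr_gt0.
have -> : w = s *: y + (1 - s) *: ((1 - s)^-1 *: (w - s *: y)).
  by rewrite scalerA mulfV ?gt_eqF// scale1r addrC subrK.
apply: le_trans (_ : expR (s * ln a + (1 - s) * ln d) <= _).
  rewrite ler_expR lerD2r; have : ln a <= 0 by rewrite ln_le0// (le_trans fa).
  by nra.
apply: exp_conjugate_combination => //; first by rewrite !ltW.
  by rewrite a0 fa.
rewrite d0 fd// normrZ gtr0_norm ?invr_gt0//.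
by rewrite mulrC ler_pdivrMr// mulrC.
Qed.

Lemma rational_approx (y : V) (e : R) : 0 < e ->
  exists q : 'rV[rat]_n, `|map_mx ratr q - y| <= e.
Proof.
move=> e0; have /(_ _)/cid h i : exists q : rat, `|ratr q - y 0 i| <= e.
  have /rat_in_itvoo[q] : y 0 i - e < y 0 i + e by lra.
  rewrite in_itv/= => /andP[q1 q2]; exists q.
  by rewrite ler_distl (ltW q1) (ltW q2).
exists (\row_i projT1 (h i)); apply: norm_le_coord; first exact: ltW.
by move=> i; rewrite !mxE; exact: (projT2 (h i)).
Qed.

(** Suppose the values at [y] are at least [a = f_ psi y + e] infinitely often. Interpolation with
    the ball carries this, up to a small loss, to a rational point [w] near [(1 - t) y]; there the
    values converge, so the bound holds for all large [k]. A second interpolation carries it to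
    [(1 - t) ^ 2 y]. An eventual bound passes to the lower limit of the [psi_], and letting [t] tend
    to [0] gives a contradiction. *)
Lemma exp_conjugate_compactness (psi_ : nat -> V -> \bar R) m :
  (forall k, proper (psi_ k)) -> (forall k y, f_ (psi_ k) y <= 1) ->
  (forall k, (m <= k)%N -> forall t : V, `|t| <= m.+1%:R^-1 ->
    m.+1%:R^-1 <= f_ (psi_ k) t) ->
  exists2 s : nat -> nat, (forall k, (k <= s k)%N) &
    let psi x := limn_einf (fun k => psi_ (s k) x) in
    proper psi -> forall y e, 0 < e ->
      exists N, forall k, (N <= k)%N -> f_ (psi_ (s k)) y <= f_ psi y + e.
Proof.
move=> ppsi f1 fball.
have [s sk sq] := @diagonal_extraction R _
  (fun k (q : 'rV[rat]_n) => f_ (psi_ k) (map_mx ratr q))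
  (fun k q => introT andP (conj (exp_conjugate_ge0 _ _) (f1 k _))).
exists s => // psi psip y e e0; apply: contrapT => nN.
pose a := f_ psi y + e.
have a0 : 0 < a by rewrite ltr_wpDl// exp_conjugate_ge0.
have freq N : exists2 k, (N <= k)%N & a <= f_ (psi_ (s k)) y.
  move/forallNP : nN => /(_ N)/existsNP[k /not_implyP[Nk /negP]].
  by rewrite -ltNge => /ltW ?; exists k.
pose d : R := m.+1%:R^-1.
have d0 : 0 < d by rewrite invr_gt0.
have ld : ln d <= 0 by rewrite ln_le0// invf_le1// ler1n.
have key t : 0 < t < 1 -> forall x,
    (((1 - t) ^+ 2 * dot x y + ln a + t * (2 * ln d - 1))%:E <= psi x)%E.
  move=> /andP[t0 t1] x; pose r := 1 - t.
  have r01 : 0 < r < 1 by rewrite /r; lra.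
  have rt : 1 - r = t by rewrite /r; ring.
  have td : 0 < t * d by rewrite mulr_gt0.
  have [q qy] := rational_approx (r *: y) td.
  set w : V := map_mx ratr q in qy.
  have [l lE] := sq q.
  have la : expR (ln a + t * ln d) <= l.
    apply/ler_addgt0Pr => h h0; have [N HN] := lE h h0.
    have [k Nk ak] := freq (maxn N m); rewrite geq_max in Nk.
    have /andP[{}Nk mk] := Nk; have := HN k Nk; rewrite ler_distl => /andP[_].
    apply: le_trans; rewrite -rt.
    apply: (@exp_conjugate_interpolation _ d _ _ _ y) => //; rewrite ?rt//.
      by apply: fball; apply: leq_trans (sk k).
    by rewrite a0.
  (* The extra factor exp (- t) makes [a1] strictly less than the limit [l], so that the values at
     [w] are eventually at least [a1]. *)
  pose a1 := expR (ln a + t * (ln d - 1)).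
  have a10 : 0 < a1 by exact: expR_gt0.
  have a1l : 0 < l - a1.
    by rewrite subr_gt0 (lt_le_trans _ la)// ltr_expR; nra.
  have [N HN] := lE _ a1l.
  apply: (@limn_einf_ge _ _ _ (maxn N m)) => k; rewrite geq_max => /andP[Nk mk].
  have fw : a1 <= f_ (psi_ (s k)) w.
    by have := HN k Nk; rewrite ler_distl => /andP[+ _]; rewrite opprB addrC subrK.
  have wy : `|r ^+ 2 *: y - r *: w| <= (1 - r) * d.
    rewrite expr2 -scalerA -scalerBr normrZ [X in _ * X]distrC rt.
    rewrite gtr0_norm; last by case/andP: r01.
    by apply: le_trans qy; rewrite ler_piMl//; case/andP: r01 => _ /ltW.
  have := @exp_conjugate_interpolation (psi_ (s k)) d d r a1 w (r ^+ 2 *: y).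
  move=> /(_ (ppsi _) (f1 _) d0 (fball _ (leq_trans mk (sk k))) r01).
  rewrite a10 fw => /(_ erefl wy) /(exp_conjugate_geP _ (ppsi _) (expR_gt0 _)).
  move=> /(_ x); rewrite expRK /a1 expRK dotZr rt; congr (_ <= _)%E.
  by congr (_%:E); rewrite /r; ring.
have : f_ psi y < a by rewrite ltrDl.
rewrite ltNge => /negP; apply.
apply/(exp_conjugate_geP _ psip a0) => x; rewrite leNgt; apply/negP => psix.
have [r psir] : exists r, psi x = r%:E.
  by move: psix (psip.1 x); case: (psi x) => [r| |] // _ _; exists r.
move: psix; rewrite psir lte_fin => rlt.
apply/negP: rlt; rewrite -leNgt; apply: (@quadratic_limit1_le _ _ _ (2 * ln d - 1)).
by move=> t /key/(_ x); rewrite psir.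
Qed.

End compactness.

(** * The maximizer *)

Section maximizer.
Context {R : realType} {n : nat}.
Local Notation V := 'rV[R]_n.
Local Notation leb := (@lebesgue_measure_rV R n).
Local Notation f_ := (@exp_conjugate R n).
Variable alpha : R.
Hypotheses (n_gt0 : (0 < n)%N) (alpha_gt0 : 0 < alpha).
Variable mu : {measure set V -> \bar R}.
Hypothesis mu_finite : (mu setT < +oo)%E.
Hypothesis mu_neq0 : mu setT != 0%E.
Hypothesis mu_moment : (\int[mu]_x (euclidean_norm x)%:E < +oo)%E.
Variable c : R.
Hypothesis c_gt0 : 0 < c.
Hypothesis mu_coercive : forall t, ((c * `|t|)%:E <= abs_moment mu t)%E.

Local Notation moment := (moment mu).
Local Notation mass := (mass mu).
Local Notation E psi := (riesz_energy alpha (f_ psi)).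

Let mass_gt0 : 0 < mass. Proof. exact: mass_gt0. Qed.

Definition feasible psi := admissible psi /\ (moment psi < +oo)%E.

Lemma feasible_proper psi : feasible psi -> proper psi.
Proof. by move=> [apsi]; exact: admissible_proper. Qed.

Definition average psi := fine (moment psi) / mass.

Lemma average_ge0 psi : feasible psi -> 0 <= average psi.
Proof. by move=> [apsi _]; rewrite divr_ge0 ?fine_ge0 ?moment_ge0// ltW. Qed.

Lemma averageE psi : feasible psi -> moment psi = (average psi * mass)%:E.
Proof.
move=> [apsi momfin]; rewrite divfK ?gt_eqF// fineK// ge0_fin_numE//.
exact: moment_ge0.
Qed.

Let decay (a : R) (y : V) := expR (- (a * `|y|)).

Let measurable_decay a : measurable_fun setT (decay a).
Proof.
apply: measurableT_comp => //; apply: measurable_funN.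
by apply: measurable_funM => //; exact: measurable_norm_rV.
Qed.

Let decay_ge0 a y : 0 <= decay a y. Proof. exact: expR_ge0. Qed.

Let measurable_decayZ b a : measurable_fun setT (fun y => b * decay a y).
Proof. exact: measurable_funM. Qed.

Let k := c / mass.
Let k_gt0 : 0 < k. Proof. by rewrite divr_gt0. Qed.

Lemma exp_conjugate_decay psi y : feasible psi ->
  f_ psi y <= expR (average psi) * decay k y.
Proof.
move=> fpsi; rewrite -expRD.
by apply: (exp_conjugate_le_exp mu_finite mu_neq0 c_gt0 mu_coercive);
  [case: fpsi|rewrite averageE].
Qed.

(** The minimum of [1] and [exp B] is at most [exp (B / 2)]. Halving the exponent lets the quadratic
    energy grow only like the exponential of the average. *)
Lemma exp_conjugate_decay_half psi y : feasible psi ->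
  (forall e : R, 0 < e -> exists x, (psi x < e%:E)%E) ->
  f_ psi y <= expR (average psi / 2) * decay (k / 2) y.
Proof.
move=> fpsi inf0; have := exp_conjugate_decay y fpsi; rewrite -!expRD => fk.
have f1 := exp_conjugate_le1 y fpsi.1 (feasible_proper fpsi) inf0.
have [B0|B0] := leP 0 (average psi / 2 + - (k / 2 * `|y|)).
  by apply: le_trans f1 _; rewrite -[leLHS]expR0 ler_expR.
by apply: le_trans fk _; rewrite ler_expR; lra.
Qed.

Lemma riesz_energy_decay_lty b a : 0 <= b -> 0 < a ->
  (riesz_energy alpha (fun y => b * decay a y)%R < +oo)%E.
Proof.
move=> b0 a0; rewrite riesz_energyZ// lte_mul_pinfty ?lee_fin ?sqr_ge0//.
exact: riesz_energy_exp_lty.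
Qed.

Lemma le_riesz_energy (f g : V -> R) :
  measurable_fun setT f -> measurable_fun setT g -> (forall x, 0 <= f x <= g x) ->
  (riesz_energy alpha f <= riesz_energy alpha g)%E.
Proof. by move=> mf mg fg; exact: le_riesz_form. Qed.

Lemma riesz_energy_ge0 (f : V -> R) :
  measurable_fun setT f -> (forall x, 0 <= f x) -> (0 <= riesz_energy alpha f)%E.
Proof. by move=> mf f0; exact: riesz_form_ge0. Qed.

Lemma riesz_energy_feasible psi : feasible psi ->
  E psi = (fine (E psi))%:E.
Proof.
move=> fpsi; have mf := measurable_exp_conjugate (feasible_proper fpsi).
rewrite fineK// ge0_fin_numE; last first.
  by apply: riesz_energy_ge0 => // x; exact: exp_conjugate_ge0.
apply: le_lt_trans (riesz_energy_decay_lty (expR_ge0 (average psi)) k_gt0).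
apply: le_riesz_energy => // y.
by rewrite exp_conjugate_ge0 exp_conjugate_decay.
Qed.

Definition gain psi := fine (E psi) * expR (- (2 * average psi)).

Lemma gain_ge0 psi : feasible psi -> 0 <= gain psi.
Proof.
move=> fpsi; rewrite mulr_ge0 ?expR_ge0// fine_ge0// riesz_energy_ge0//.
  exact: (measurable_exp_conjugate (feasible_proper fpsi)).
by move=> x; exact: exp_conjugate_ge0.
Qed.

Lemma feasibleD psi (a : R) : feasible psi -> (forall x, 0 <= psi x + a%:E)%E ->
  let psi' := (fun x => psi x + a%:E)%E in
  [/\ feasible psi', average psi' = average psi + a & gain psi' = gain psi].
Proof.
move=> fpsi psia psi'; have [[mpsi psi0 epsi] momfin] := fpsi.
have ppsi := feasible_proper fpsi.
have apsi' : admissible psi'.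
  split=> //; last by move=> x; rewrite /psi' epsi.
  by apply: emeasurable_funD => //; exact: measurable_cst.
have mom' : moment psi' = (fine (moment psi) + a * mass)%:E.
  (* The constant is split into positive and negative parts, so that integrals of nonnegative
     functions are compared without subtraction. *)
  have psiE x : psi' x + (Num.max 0 (- a))%:E = psi x + (Num.max 0 a)%:E.
    rewrite /psi' -addeA -EFinD; congr (_ + _%:E)%E.
    by case: (leP 0 a) => a0; case: (leP 0 (- a)) => a0'; lra.
  have : (moment psi' + (Num.max 0 (- a) * mass)%:E =
          moment psi + (Num.max 0 a * mass)%:E)%E.
    rewrite -!(integral_cst_mass mu_finite) ?le_max ?lexx//.
    have [mpsi' psi'0 _] := apsi'.
    rewrite -!ge0_integralD//; try (by move=> x _; rewrite lee_fin le_max lexx).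
    by apply: eq_integral => x _; exact: psiE.
  have -> : moment psi = (fine (moment psi))%:E.
    by rewrite fineK// ge0_fin_numE// moment_ge0.
  have := moment_ge0 mu apsi'; case: (moment psi') => [r| |] //= _.
  rewrite -!EFinD => -[H]; congr (_%:E).
  have : Num.max 0 a - Num.max 0 (- a) = a.
    by case: (leP 0 a) => a0; case: (leP 0 (- a)) => a0'; lra.
  by move: H; move: (Num.max _ _) (Num.max _ _) => p q H <-; lra.
have fpsi' : feasible psi' by split => //; rewrite mom' ltry.
have avg' : average psi' = average psi + a.
  by rewrite /average mom'/= mulrDl mulfK ?gt_eqF.
split => //; rewrite /gain avg'.
have fE : f_ psi' = (fun y => expR a * f_ psi y).
  by apply/funext => y; exact: exp_conjugateD.
rewrite fE riesz_energyZ ?expR_ge0//; last 2 first.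
  exact: measurable_exp_conjugate.
  by move=> x; exact: exp_conjugate_ge0.
rewrite (riesz_energy_feasible fpsi) -EFinM /= mulrAC mulrC -expRM_natl -expRD.
by congr (_ * expR _); ring.
Qed.

Lemma feasible_normalize psi : feasible psi -> exists psi',
  [/\ feasible psi', (forall e : R, 0 < e -> exists x, (psi' x < e%:E)%E) &
      gain psi' = gain psi].
Proof.
move=> fpsi; have [[mpsi psi0 epsi] momfin] := fpsi.
pose i := ereal_inf (range psi).
have i0 : (0 <= i)%E by apply: le_ereal_inf_tmp => _ [x _ <-].
have ifin : i \is a fin_num.
  rewrite ge0_fin_numE//; have [_ [x psix]] := feasible_proper fpsi.
  by apply: le_lt_trans psix; apply: ereal_inf_lbound; exists x.
have [|fpsi' avg' gain'] := @feasibleD psi (- fine i) fpsi.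
  move=> x; rewrite EFinN sube_ge0// fineK//.
  by apply: ereal_inf_lbound; exists x.
exists (fun x => psi x + (- fine i)%:E)%E; split => // e e0.
have [_ [x _ <-]] := lb_ereal_inf_adherent e0 ifin.
by move=> psix; exists x; rewrite EFinN lteBlDr// fineK// addeC.
Qed.

(** The energy is at most [C * expR (average psi)]. A lower bound on the gain therefore bounds the
    average, which is how the lemma is used. *)
Lemma gain_le : exists C, forall psi, feasible psi ->
  (forall e : R, 0 < e -> exists x, (psi x < e%:E)%E) ->
  gain psi <= C * expR (- average psi).
Proof.
have k2 : 0 < k / 2 by rewrite divr_gt0.
exists (fine (riesz_energy alpha (decay (k / 2)))) => psi fpsi inf0.
set C := fine _.
have CE : riesz_energy alpha (decay (k / 2)) = C%:E.
  rewrite fineK// ge0_fin_numE; first exact: riesz_energy_exp_lty.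
  exact: riesz_energy_ge0.
have : (E psi <= (expR (average psi / 2) ^+ 2 * C)%:E)%E.
  rewrite EFinM -CE -riesz_energyZ ?expR_ge0//.
  apply: le_riesz_energy => //.
    exact: (measurable_exp_conjugate (feasible_proper fpsi)).
  by move=> y; rewrite exp_conjugate_ge0 exp_conjugate_decay_half.
rewrite (riesz_energy_feasible fpsi) lee_fin => EC.
apply: le_trans (ler_wpM2r (expR_ge0 _) EC) _.
rewrite le_eqVlt; apply/orP; left; apply/eqP.
rewrite mulrAC mulrC -expRM_natl -expRD; congr (_ * expR _).
by field.
Qed.

Lemma gain_gt0_exists : exists2 psi, feasible psi & 0 < gain psi.
Proof.
(* Its moment is finite by [mu_moment], and its [f] is at least [1] on the sup-norm ball of radius
   [1 / n]. *)
pose psi (x : V) : \bar R := (euclidean_norm x)%:E.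
have fpsi : feasible psi.
  split => //; split.
  - by apply/measurable_EFinP; exact: measurable_euclidean_norm.
  - by move=> x; rewrite lee_fin sqrtr_ge0.
  - by move=> x; rewrite /psi euclidean_normN.
exists psi => //; have ppsi := feasible_proper fpsi.
have mf := measurable_exp_conjugate ppsi.
have f0 x : 0 <= f_ psi x by exact: exp_conjugate_ge0.
rewrite lt0r gain_ge0// andbT mulf_neq0//; last by rewrite gt_eqF// expR_gt0.
rewrite fine_eq0; last by rewrite riesz_energy_feasible.
apply/eqP => /(riesz_energy_eq0 alpha n_gt0 mf f0).
apply/eqP; rewrite gt_eqF//.
pose B := [set y : V | `|y| <= n%:R^-1].
have n0 : 0 < (n%:R : R) by rewrite ltr0n.
have mB : measurable B by exact: measurable_norm_ball.
have B0 : (0 < \int[leb]_y (\1_B y)%:E)%E.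
  rewrite integral_indic// setIT.
  rewrite [X in (_ < X)%E](@lebesgue_norm_ball R n n%:R^-1) ?invr_ge0//.
  by rewrite lte_fin exprn_gt0// mulr_gt0// invr_gt0.
apply: lt_le_trans B0 _.
apply: ge0_le_integral => //.
- by apply/measurable_EFinP; exact: measurable_indic.
- exact/measurable_EFinP.
move=> y _; rewrite lee_fin indicE; case: (boolP (y \in B)) => // /set_mem yB.
apply/(exp_conjugate_geP _ ppsi ltr01) => x; rewrite ln1 addr0 lee_fin.
apply: le_trans (ler_norm _) _; apply: le_trans (dot_le_norm _ _) _.
apply: le_trans (norm_le_euclidean x).
by rewrite mulrCA ler_piMr// -ler_pdivlMl// mulr1.
Qed.

Lemma gain_limit_bound (S Q X : R) : 0 < S -> 0 < Q ->
  (forall h, 0 < h <= S -> (S - h) * ((1 - 2 * h) * Q) <= X + h) -> S * Q <= X.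
Proof.
move=> S0 Q0 H; apply/ler_addgt0Pr => e e0.
(* Expanding the left side of [H] loses at most [h * (Q + 2 * S * Q)], and [X + h] adds another
   [h]. *)
pose K := 1 + Q + 2 * S * Q.
have K0 : 0 < K by rewrite /K addr_gt0 ?addr_gt0 ?mulr_gt0.
pose h := Num.min S (e / K).
have h0 : 0 < h by rewrite lt_min S0 divr_gt0.
have hK : h * K <= e by rewrite -ler_pdivlMr// ge_min lexx orbT.
have := H h; rewrite h0 ge_min lexx => /(_ erefl).
have hhQ : 0 <= h * h * Q by rewrite !mulr_ge0 ?ltW.
by move: hK; rewrite /K; lra.
Qed.

Theorem gain_maximizer : exists psi, [/\ feasible psi, 0 < gain psi &
  forall psi', feasible psi' -> gain psi' <= gain psi].
Proof.
have [C CE] := gain_le.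
have [psi1 fpsi1 gpsi1] := gain_gt0_exists.
pose G := [set gain psi | psi in feasible].
have C0 : 0 < C.
  have [psi' [fpsi' inf0 gE]] := feasible_normalize fpsi1.
  rewrite -gE in gpsi1; have := lt_le_trans gpsi1 (CE _ fpsi' inf0).
  by rewrite pmulr_lgt0// expR_gt0.
have GC : ubound G C.
  move=> _ [psi fpsi <-]; have [psi' [fpsi' inf0 <-]] := feasible_normalize fpsi.
  apply: le_trans (CE _ fpsi' inf0) _; rewrite ler_piMr ?(ltW C0)//.
  by rewrite -[leRHS]expR0 ler_expR oppr_le0 average_ge0.
have Gsup : has_sup G by split; [exists (gain psi1), psi1|exists C].
pose S := sup G.
have gS psi : feasible psi -> gain psi <= S.
  by move=> fpsi; apply: ub_le_sup; [case: Gsup|exists psi].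
have S0 : 0 < S by apply: lt_le_trans gpsi1 (gS _ fpsi1).
(* The bound by [S / 2], valid at every index, controls averages and energies; the last bound makes
   the sequence maximizing. *)
have /(_ _)/cid H m : exists psi, [/\ feasible psi,
    (forall e : R, 0 < e -> exists x, (psi x < e%:E)%E),
    S / 2 < gain psi & S - m.+1%:R^-1 < gain psi].
  have e0 : 0 < Num.min (S / 2) m.+1%:R^-1.
    by rewrite lt_min divr_gt0//= invr_gt0.
  have [_ [psi fpsi <-]] := sup_adherent e0 Gsup; rewrite -/S => gpsi.
  have [psi' [fpsi' inf0 gE]] := feasible_normalize fpsi.
  exists psi'; rewrite gE; split => //; apply: le_lt_trans gpsi.
    have : Num.min (S / 2) m.+1%:R^-1 <= S / 2 by rewrite ge_min lexx.
    by lra.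
  by rewrite lerD2l lerN2 ge_min lexx orbT.
pose P m := projT1 (H m).
have fP m : feasible (P m) by have [] := projT2 (H m).
have infP m e : 0 < e -> exists x, (P m x < e%:E)%E.
  by have [_ + _ _] := projT2 (H m); apply.
have gP2 m : S / 2 < gain (P m) by have [] := projT2 (H m).
have gPS m : S - m.+1%:R^-1 < gain (P m) by have [] := projT2 (H m).
have pP m : proper (P m) by exact: feasible_proper.
pose A := ln (C / (S / 2)).
have S20 : 0 < S / 2 by rewrite divr_gt0.
have avgP m : average (P m) <= A.
  have := lt_le_trans (gP2 m) (CE _ (fP m) (infP m)).
  rewrite expRN ltr_pdivlMr ?expR_gt0// mulrC -ltr_pdivlMr// => /ltW h.
  by rewrite -[leLHS]expRK ler_ln ?posrE ?expR_gt0 ?divr_gt0.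
pose D y := expR A * decay k y.
have mD : measurable_fun setT D := measurable_decayZ _ _.
have DE psi y : feasible psi -> average psi <= A -> f_ psi y <= D y.
  move=> fpsi pA; apply: le_trans (exp_conjugate_decay y fpsi) _.
  by rewrite ler_wpM2r// ler_expR.
have ED : (riesz_energy alpha D < +oo)%E.
  exact: riesz_energy_decay_lty (expR_ge0 _) k_gt0.
have EP m : E (P m) = (gain (P m) * expR (2 * average (P m)))%:E.
  rewrite riesz_energy_feasible// /gain -mulrA -expRD addNr expR0 mulr1//.
(* Averages are nonnegative, so the energy is at least the gain. *)
have EPS m : ((S / 2)%:E <= E (P m))%E.
  rewrite EP lee_fin; apply: le_trans (ltW (gP2 m)) _.
  rewrite ler_peMr ?gain_ge0// -[leLHS]expR0 ler_expR mulr_ge0//.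
  exact: average_ge0.
have P0 m x : (0 <= P m x)%E by have [[_ + _] _] := fP m; apply.
have [|m ball] := @nondegenerate _ _ alpha n_gt0 P D (S / 2) pP P0
  (fun m => let: And3 _ _ e := (fP m).1 in e) mD _ ED S20 EPS.
  by move=> m y; exact: DE.
have [|s sk] := @exp_conjugate_compactness _ _ P m pP _ ball.
  by move=> j y; exact: (exp_conjugate_le1 y (fP j).1 (pP j) (infP j)).
set psi := fun x => _ => /= lim.
have mpsi : measurable_fun setT psi.
  rewrite (_ : psi = fun x => - limn_esup (-%E \o (fun j => P (s j) x)))%E.
    apply: measurableT_comp; first exact: oppe_measurable.
    apply: measurable_fun_limn_esup => j.
    apply: measurableT_comp; first exact: oppe_measurable.
    by have [[]] := fP (s j).
  by apply/funext => x; rewrite limn_esupN oppeK.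
have apsi : admissible psi.
  split => // x; first by apply: (@limn_einf_ge _ _ _ 0%N) => j _.
  by congr limn_einf; apply/funext => j; have [[_ _ ->]] := fP (s j).
have fatou_psi : (moment psi <= limn_einf (fun j => moment (P (s j))))%E.
  by apply: fatou => // j; have [[]] := fP (s j).
have momA : (moment psi <= (A * mass)%:E)%E.
  apply: le_trans fatou_psi _.
  rewrite limn_einf_lim (cvg_lim _ (@cvg_einfs_sup _ _))//.
  apply: ge_ereal_sup => _ [j _ <-]; apply: le_trans (_ : moment (P (s j)) <= _)%E.
    by apply: ereal_inf_lbound; exists j => /=.
  by rewrite averageE// lee_fin ler_wpM2r ?(ltW mass_gt0).
have fpsi : feasible psi by split => //; apply: le_lt_trans momA (ltry _).
have psiA : average psi <= A.
  by move: momA; rewrite averageE// lee_fin ler_pM2r.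
have ppsi := feasible_proper fpsi.
have mf := measurable_exp_conjugate ppsi.
(* At a late index the energy is at most that of [psi] plus [h], by upper semicontinuity, and the
   average exceeds that of [psi] minus [h], by Fatou's lemma; then [h] tends to [0]. *)
have gpsi : S <= gain psi.
  rewrite /gain expRN ler_pdivlMr ?expR_gt0//.
  apply: gain_limit_bound => //; first exact: expR_gt0.
  move=> h /andP[h0 hS].
  have [|||N1 HN1] := riesz_energy_usc (f_ := fun j => f_ (P (s j)))
      _ mf mD _ _ ED (lim ppsi) h0.
  - by move=> j; exact: measurable_exp_conjugate.
  - by move=> j y; rewrite exp_conjugate_ge0 DE.
  - by move=> y; rewrite exp_conjugate_ge0 DE.
  have : (((average psi - h) * mass)%:E < limn_einf (fun j => moment (P (s j))))%E.
    apply: lt_le_trans fatou_psi; rewrite averageE// lte_fin ltr_pM2r//.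
    by rewrite gtrBl.
  move=> /limn_einf_gt[N2 HN2].
  pose j := maxn (maxn N1 N2) (Num.truncn h^-1).
  have jN1 : (N1 <= j)%N by rewrite /j -maxnA leq_maxl.
  have jN2 : (N2 <= j)%N by rewrite /j maxnAC leq_maxr.
  have jh : (Num.truncn h^-1 <= j)%N by rewrite leq_maxr.
  have := HN1 j jN1; rewrite EP (riesz_energy_feasible fpsi) -EFinD lee_fin.
  apply: le_trans.
  have := HN2 j jN2; rewrite averageE// lte_fin ltr_pM2r// => aj.
  have hj : S - h <= gain (P (s j)).
    apply: le_trans (ltW (gPS (s j))); rewrite lerD2l lerN2.
    rewrite -[leRHS]invrK lef_pV2 ?posrE ?invr_gt0//.
    rewrite (le_trans (ltW (truncnS_gt _)))// ler_nat ltnS.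
    exact: leq_trans jh (sk j).
  apply: (@le_trans _ _ ((S - h) * expR (2 * average (P (s j))))); last first.
    by rewrite ler_wpM2r ?expR_ge0.
  rewrite ler_wpM2l ?subr_ge0//.
  apply: (@le_trans _ _ (expR (- (2 * h)) * expR (2 * average psi))).
    by rewrite ler_wpM2r ?expR_ge0//; apply: le_trans (expR_ge1Dx _).
  by rewrite -expRD ler_expR; lra.
exists psi; split => //; first exact: lt_le_trans gpsi.
by move=> psi' /gS/le_trans; apply.
Qed.

End maximizer.

(** * Almost everywhere differentiability *)

Section log_concave_line.
Context {R : realType}.

(* The hypotheses are log-concavity of [phi] along chords ending at [0], and
   along chords containing [0]. *)
Variable phi : R -> R.
Hypothesis phi0_gt0 : 0 < phi 0.
Hypothesis phi_scale : forall s t, 0 <= s <= 1 -> 0 < phi t ->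
  expR (s * ln (phi t) + (1 - s) * ln (phi 0)) <= phi (s * t).
Hypothesis phi_mid : forall t t', 0 < t -> 0 < t' -> 0 < phi t -> 0 < phi (- t') ->
  t' * ln (phi t) + t * ln (phi (- t')) <= (t + t') * ln (phi 0).

Let k t := ln (phi 0) - ln (phi t).
Let slope t := k t / t.

Let phi_scale_gt0 s t : 0 <= s <= 1 -> 0 < phi t -> 0 < phi (s * t).
Proof. by move=> s01 pt; apply: lt_le_trans (phi_scale s01 pt); exact: expR_gt0. Qed.

Let k_scale s t : 0 <= s <= 1 -> 0 < phi t -> k (s * t) <= s * k t.
Proof.
move=> s01 pt; have := phi_scale s01 pt.
rewrite -[leRHS]lnK ?posrE ?phi_scale_gt0// ler_expR /k; lra.
Qed.

Let slope_incr t t' : 0 < t <= t' -> 0 < phi t' -> 0 < phi t /\ slope t <= slope t'.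
Proof.
move=> /andP[t0 tt'] pt'; have t'0 : 0 < t' by apply: lt_le_trans tt'.
have s01 : 0 <= t / t' <= 1.
  by rewrite divr_ge0 ?(ltW t0) ?(ltW t'0)//= ler_pdivrMr// mul1r.
have tE : t = t / t' * t' by rewrite divfK// gt_eqF.
split; first by rewrite tE phi_scale_gt0.
rewrite /slope ler_pdivrMr// mulrAC -mulrA mulrC.
by have := k_scale s01 pt'; rewrite -tE.
Qed.

Let slope_incrN t t' : 0 < t <= t' -> 0 < phi (- t') ->
  0 < phi (- t) /\ slope (- t') <= slope (- t).
Proof.
move=> /andP[t0 tt'] pt'; have t'0 : 0 < t' by apply: lt_le_trans tt'.
have s01 : 0 <= t / t' <= 1.
  by rewrite divr_ge0 ?(ltW t0) ?(ltW t'0)//= ler_pdivrMr// mul1r.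
have tE : - t = t / t' * (- t') by rewrite mulrN divfK// gt_eqF.
split; first by rewrite tE phi_scale_gt0.
rewrite /slope !invrN !mulrN lerN2 ler_pdivrMr// mulrAC -mulrA mulrC.
by have := k_scale s01 pt'; rewrite -tE.
Qed.

Let slope_le t t' : 0 < t -> 0 < t' -> 0 < phi t -> 0 < phi (- t') ->
  slope (- t') <= slope t.
Proof.
move=> t0 t'0 pt pt'; have := phi_mid t0 t'0 pt pt'.
rewrite /slope invrN mulrN ler_pdivlMr// mulNr mulrAC -mulNr ler_pdivrMr//.
by rewrite /k; lra.
Qed.

(** The slopes at [0] of the convex function [- ln phi] are monotone on each side. The first two
    hypotheses give points of positivity on both sides, and the third excludes a rational strictly
    between the left and right derivatives. *)
Lemma log_concave_line_derivable :
  (exists j, 0 < phi j.+1%:R^-1) -> (exists j, 0 < phi (- j.+1%:R^-1)) ->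
  (forall r : rat, exists j,
    phi 0 * expR (- (ratr r / j.+1%:R)) <= phi j.+1%:R^-1 \/
    phi 0 * expR (ratr r / j.+1%:R) <= phi (- j.+1%:R^-1)) ->
  exists p, forall e, 0 < e -> exists2 d, 0 < d &
    forall t, 0 < `|t| < d -> 0 < phi t /\ `|slope t - p| <= e.
Proof.
move=> [j1 pj1] [j2 pj2] noB.
pose P := [set slope t | t in [set t | 0 < t /\ 0 < phi t]].
pose N := [set slope (- t) | t in [set t | 0 < t /\ 0 < phi (- t)]].
have j0 j : 0 < j.+1%:R^-1 :> R by rewrite invr_gt0.
have Pinf : has_inf P.
  split; first by exists (slope j1.+1%:R^-1), j1.+1%:R^-1.
  exists (slope (- j2.+1%:R^-1)) => _ [t [t0 pt] <-].
  exact: slope_le.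
have Nsup : has_sup N.
  split; first by exists (slope (- j2.+1%:R^-1)), j2.+1%:R^-1.
  exists (slope j1.+1%:R^-1) => _ [t [t0 pt] <-].
  exact: slope_le.
have Ple t : 0 < t -> 0 < phi t -> inf P <= slope t.
  by move=> t0 pt; apply: ge_inf; [case: Pinf|exists t].
have Nge t : 0 < t -> 0 < phi (- t) -> slope (- t) <= sup N.
  by move=> t0 pt; apply: ub_le_sup; [case: Nsup|exists t].
have NP : sup N <= inf P.
  apply: ge_sup; first by case: Nsup.
  move=> _ [t' [t'0 pt'] <-]; apply: lb_le_inf; first by case: Pinf.
  by move=> _ [t [t0 pt] <-]; exact: slope_le.
have PN : inf P = sup N.
  apply/eqP; rewrite eq_le NP andbT leNgt; apply/negP => /rat_in_itvoo[r].
  rewrite in_itv/= => /andP[Nr rP]; have [j [hj|hj]] := noB r.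
    have pj : 0 < phi j.+1%:R^-1.
      by apply: lt_le_trans hj; rewrite mulr_gt0// expR_gt0.
    have := lt_le_trans rP (Ple _ (j0 j) pj).
    rewrite ltNge => /negP; apply; rewrite /slope ler_pdivrMr// /k.
    move: hj; rewrite -[leRHS]lnK ?posrE// -[X in X * _]lnK ?posrE// -expRD.
    by rewrite ler_expR; move: (ratr r / _) => x; lra.
  have pj : 0 < phi (- j.+1%:R^-1).
    by apply: lt_le_trans hj; rewrite mulr_gt0// expR_gt0.
  have := le_lt_trans (Nge _ (j0 j) pj) Nr.
  rewrite ltNge => /negP; apply.
  rewrite /slope invrN mulrN lerNr ler_pdivrMr// mulNr /k.
  move: hj; rewrite -[leRHS]lnK ?posrE// -[X in X * _]lnK ?posrE// -expRD.
  by rewrite ler_expR; move: (ratr r / _) => x; lra.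
exists (inf P) => e e0.
have [_ [t1 [t10 pt1] <-] st1] := inf_adherent e0 Pinf.
have [_ [t2 [t20 pt2] <-] st2] := sup_adherent e0 Nsup.
exists (Num.min t1 t2) => [|t]; first by rewrite lt_min t10 t20.
rewrite lt_min => /andP[t0 /andP[tt1 tt2]].
have [t_gt0|t_lt0] := ltP 0 t.
  rewrite gtr0_norm// in tt1.
  have [|pt st] := @slope_incr t t1 _ pt1; first by rewrite t_gt0 ltW.
  split=> //; have := Ple t t_gt0 pt; rewrite ler_distl; lra.
have {}t_lt0 : t < 0 by rewrite lt_neqAle t_lt0 andbT -normr_gt0.
rewrite ltr0_norm// in tt2.
have [|pt st] := @slope_incrN (- t) t2 _ pt2; first by rewrite oppr_gt0 t_lt0 ltW.
rewrite !opprK in pt st; split=> //.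
have := Nge (- t); rewrite opprK oppr_gt0 => /(_ t_lt0 pt).
by rewrite ler_distl -PN in st2 *; lra.
Qed.

End log_concave_line.

Section almost_everywhere_gradient.
Context {R : realType} {n : nat}.
Local Notation V := 'rV[R]_n.
Local Notation leb := (@lebesgue_measure_rV R n).
Variable psi : V -> \bar R.
Hypothesis ppsi : proper psi.
Local Notation f := (exp_conjugate psi).

Let f0 y : 0 <= f y. Proof. exact: exp_conjugate_ge0. Qed.
Let mf : measurable_fun setT f. Proof. exact: measurable_exp_conjugate. Qed.

Lemma log_exp_conjugate_concave y z s : 0 <= s <= 1 -> 0 < f y -> 0 < f z ->
  expR (s * ln (f y) + (1 - s) * ln (f z)) <= f (s *: y + (1 - s) *: z).
Proof.
by move=> s01 fy fz; apply: exp_conjugate_combination => //;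
  rewrite ?fy ?fz/=.
Qed.

(* The difference quotients of [- ln f] along [v] at [y] exceed [r] on the right
   and stay below [r] on the left. *)
Definition kink (v : V) (r : rat) : set V := [set y | 0 < f y /\ forall j : nat,
  f (y + j.+1%:R^-1 *: v) < f y * expR (- (ratr r / j.+1%:R)) /\
  f (y - j.+1%:R^-1 *: v) < f y * expR (ratr r / j.+1%:R)].

(** By log-concavity, [f] then vanishes on the whole open ray from [y] in the direction [v]. *)
Definition endpoint (v : V) : set V :=
  [set y | 0 < f y /\ forall j : nat, f (y + j.+1%:R^-1 *: v) <= 0].

Let measurable_shift (v : V) : measurable_fun setT (fun y : V => f (y + v)).
Proof.
apply: (measurableT_comp mf); exact: measurable_addr_rV.
Qed.

Lemma measurable_kink v r : measurable (kink v r).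
Proof.
rewrite (_ : kink v r = [set y | 0 < f y] `&` \bigcap_(j in setT)
  ([set y | f (y + j.+1%:R^-1 *: v) < f y * expR (- (ratr r / j.+1%:R))] `&`
   [set y | f (y - j.+1%:R^-1 *: v) < f y * expR (ratr r / j.+1%:R)])); last first.
  by apply/seteqP; split => y /= [fy h]; split => // j; [move=> _|have := h j I];
    by [|exact: h].
have mlt (g h : V -> R) : measurable_fun setT g -> measurable_fun setT h ->
    measurable [set y | g y < h y].
  move=> mg mh; have := measurable_fun_ltr mg mh measurableT.
  move=> /(_ [set true]); rewrite setTI => /(_ _).
  rewrite (_ : _ @^-1` _ = [set y | g y < h y]); first exact.
  by apply/seteqP; split => y.
apply: measurableI; first exact: mlt.
apply: bigcap_measurableType => j _; apply: measurableI; apply: mlt.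
- exact: measurable_shift.
- exact: measurable_funM.
- exact: measurable_shift.
- exact: measurable_funM.
Qed.

Lemma measurable_endpoint v : measurable (endpoint v).
Proof.
rewrite (_ : endpoint v = [set y | 0 < f y] `&` \bigcap_(j in setT)
  [set y | f (y + j.+1%:R^-1 *: v) <= 0]); last first.
  by apply/seteqP; split => y /= [fy h]; split => // j; [move=> _|have := h j I];
    by [|exact: h].
apply: measurableI.
  rewrite -[X in measurable X]setTI.
  rewrite (_ : [set y | 0 < f y] = f @^-1` `]0, +oo[%classic).
    exact: mf.
  by apply/seteqP; split => y /=; rewrite in_itv/= andbT.
apply: bigcap_measurableType => j _; rewrite -[X in measurable X]setTI.
rewrite (_ : [set y | _] = (fun y => f (y + j.+1%:R^-1 *: v)) @^-1` `]-oo, 0]%classic).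
  exact: measurable_shift.
by apply/seteqP; split => y /=; rewrite in_itv.
Qed.

Let natinv_le (t : R) : 0 < t -> exists j : nat, j.+1%:R^-1 <= t.
Proof.
move=> t0; exists (Num.truncn t^-1).
rewrite -[leRHS]invrK lef_pV2 ?posrE ?invr_gt0//.
by rewrite ltW// truncnS_gt.
Qed.

Let segment (y v : V) (h t : R) : t != 0 ->
  y + h *: v = (1 - h / t) *: y + (1 - (1 - h / t)) *: (y + t *: v).
Proof.
move=> t0; apply/rowP => i; rewrite !mxE; field.
by rewrite t0.
Qed.

Let lt_ln (A B u : R) : 0 < u -> expR A < u * expR B -> A < ln u + B.
Proof. by move=> u0; rewrite -[X in X * _]lnK ?posrE// -expRD ltr_expR. Qed.

(** Between two kinks on one line with the same [r], the chord of the convex function [- ln f] would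
    have slope above [r] by the condition at the first point and below [r] by the condition at the
    second. *)
Lemma kink_null v r : leb (kink v r) = 0%E.
Proof.
apply: (lebesgue_null_line (v := v)); first exact: measurable_kink.
have main y t : 0 < t -> kink v r y -> ~ kink v r (y + t *: v).
  move=> t0 [fy hy] [fy' hy']; have [j jt] := natinv_le t0.
  have j0 : 0 < j.+1%:R^-1 :> R by rewrite invr_gt0.
  set h : R := j.+1%:R^-1 in jt j0.
  have tn0 : t != 0 by rewrite gt_eqF.
  have ht : 0 <= 1 - h / t <= 1.
    rewrite subr_ge0 ler_pdivrMr// mul1r jt/= gerBl.
    by rewrite divr_ge0// ltW.
  have ht' : 0 <= h / t <= 1 by lra.
  have [a _] := hy j; have [_ b] := hy' j.
  rewrite -/h (segment y v h tn0) in a.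
  have /(lt_ln fy) := le_lt_trans (log_exp_conjugate_concave ht fy fy') a.
  have bE : y + t *: v - h *: v = (h / t) *: y + (1 - h / t) *: (y + t *: v).
    by apply/rowP => i; rewrite !mxE; field.
  rewrite -/h bE in b.
  have /(lt_ln fy') := le_lt_trans (log_exp_conjugate_concave ht' fy fy') b.
  by rewrite -/h; lra.
move=> y t ky t0 ky'; have [t_gt0|t_lt0] := ltP 0 t; first exact: main ky'.
have {}t_lt0 : t < 0 by rewrite lt_neqAle t0 t_lt0.
apply: (main (y + t *: v) (- t)) => //; first by rewrite oppr_gt0.
by rewrite scaleNr addrK.
Qed.

(** [f] would be positive on the whole segment from an endpoint to a later one. *)
Lemma endpoint_null v : leb (endpoint v) = 0%E.
Proof.
apply: (lebesgue_null_line (v := v)); first exact: measurable_endpoint.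
have main y t : 0 < t -> endpoint v y -> ~ endpoint v (y + t *: v).
  move=> t0 [fy hy] [fy' _]; have [j jt] := natinv_le t0.
  have j0 : 0 < j.+1%:R^-1 :> R by rewrite invr_gt0.
  set h : R := j.+1%:R^-1 in jt j0.
  have ht : 0 <= 1 - h / t <= 1.
    rewrite subr_ge0 ler_pdivrMr// mul1r jt/= gerBl.
    by rewrite divr_ge0// ltW.
  have := hy j; rewrite -/h (@segment y v h t) ?gt_eqF//.
  rewrite leNgt => /negP; apply.
  by apply: lt_le_trans (log_exp_conjugate_concave ht fy fy'); exact: expR_gt0.
move=> y t ky t0 ky'; have [t_gt0|t_lt0] := ltP 0 t; first exact: main ky'.
have {}t_lt0 : t < 0 by rewrite lt_neqAle t0 t_lt0.
apply: (main (y + t *: v) (- t)) => //; first by rewrite oppr_gt0.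
by rewrite scaleNr addrK.
Qed.

Local Notation F := (fine \o potential f).

Lemma fine_potentialE y : 0 < f y -> F y = - ln (f y).
Proof. by move=> fy; rewrite /= /potential lne_EFin. Qed.

(** Differentiability of [- ln f] along [v], together with positivity of [f] near [y] on the line,
    which keeps the infinite values of the potential away. *)
Definition regular (v : V) (y : V) := 0 < f y /\
  forall e : R, 0 < e -> exists2 d, 0 < d & forall t, 0 < `|t| < d ->
    0 < f (y + t *: v) /\
    `|(ln (f y) - ln (f (y + t *: v))) / t - 'D_v F y| <= e.

Lemma regular_point v y : 0 < f y -> (forall r, ~ kink v r y) ->
  ~ endpoint v y -> ~ endpoint (- v) y -> regular v y.
Proof.
move=> fy nk ne ne'; pose phi t := f (y + t *: v).
have phi0 : phi 0 = f y by rewrite /phi scale0r addr0.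
have [||||||p pE] := @log_concave_line_derivable R phi.
- by rewrite phi0.
- move=> s t s01 pt; rewrite /phi.
  have -> : y + (s * t) *: v = s *: (y + t *: v) + (1 - s) *: y.
    by apply/rowP => i; rewrite !mxE; ring.
  by rewrite scale0r addr0; exact: log_exp_conjugate_concave.
- move=> t t' t0 t'0 pt pt'; rewrite phi0.
  have tt'0 : 0 < t + t' by rewrite addr_gt0.
  pose s := t' / (t + t').
  have s1 : 1 - s = t / (t + t') by rewrite /s; field; rewrite gt_eqF.
  have s01 : 0 <= s <= 1.
    by rewrite divr_ge0 ?(ltW t'0) ?(ltW tt'0)//= ler_pdivrMr// mul1r lerDr ltW.
  have := log_exp_conjugate_concave s01 pt pt'.
  have -> : s *: (y + t *: v) + (1 - s) *: (y + (- t') *: v) = y.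
    by apply/rowP => i; rewrite s1 /s !mxE; field; rewrite gt_eqF.
  rewrite -[leRHS]lnK ?posrE// ler_expR s1 /s.
  rewrite mulrAC [X in _ + X]mulrAC -mulrDl ler_pdivrMr// mulrC.
  by rewrite [X in _ <= X -> _]mulrC.
- apply: contrapT => /forallNP h; apply: ne; split => // j.
  by rewrite leNgt; apply/negP; exact: h.
- apply: contrapT => /forallNP h; apply: ne'; split => // j.
  by rewrite scalerN -scaleNr leNgt; apply/negP; exact: h.
- move=> r; apply: contrapT => /forallNP h; apply: (nk r); split => // j.
  have := h j; rewrite phi0 /phi scaleNr => /not_orP[/negP + /negP].
  by rewrite -!ltNge.
have DE : 'D_v F y = p.
  apply: cvg_lim => //; apply/cvgrPdist_le => e e0.
  have [d d0 dE] := pE e e0; exists d => //= t; rewrite /= sub0r normrN => td t0.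
  have [|pt] := dE t; first by rewrite normr_gt0 t0.
  rewrite distrC [t *: v + y]addrC.
  rewrite -[fine (potential f (y + _))]/(F (y + t *: v)) -[fine _]/(F y).
  rewrite (fine_potentialE pt) (fine_potentialE fy) phi0 opprK [- _ + _]addrC.
  by rewrite -[_ *: _]/(_ * _) mulrC.
split=> // e e0; have [d d0 dE] := pE e e0; exists d => // t td.
by have := dE t td; rewrite phi0 DE.
Qed.

End almost_everywhere_gradient.

Section negligible_domain.
Context d (T : measurableType d) {R : realType} (mu : {measure set T -> \bar R}).
Local Open Scope ereal_scope.

Lemma ge0_le_integralT (u v : T -> \bar R) : (forall x, 0 <= u x <= v x) ->
  \int[mu]_x u x <= \int[mu]_x v x.
Proof.
move=> uv; have u0 x : 0 <= u x by case/andP: (uv x).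
have v0 x : 0 <= v x by case/andP: (uv x) => /le_trans; apply.
rewrite !ge0_integralTE//; apply: ereal_sup_le => _ [h hu <-]; exists h => // x.
by apply: le_trans (hu x) _; case/andP: (uv x).
Qed.

(* [A] need not be measurable: the integral of a nonnegative function is a
   supremum over simple functions and hence monotone without measurability. *)
Lemma integral_eq_off_null (A B N : set T) (v : T -> \bar R) :
  measurable B -> measurable N -> mu N = 0 ->
  measurable_fun setT v -> (forall x, 0 <= v x) ->
  (forall x, ~ N x -> v x != 0 -> (A x <-> B x)) ->
  \int[mu]_(x in A) v x = \int[mu]_(x in B) v x.
Proof.
move=> mB mN N0 mv v0 AB.
(* [L] and [U] agree off [N] and are [0] and [+oo] on it, so they enclose the restriction of [v] to
   any set that agrees with [B] off [N] where [v] is nonzero. *)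
pose L := v \_ (B `\` N).
pose U x := if x \in N then +oo else (v \_ B) x.
have L0 x : 0 <= L x by rewrite /L patchE; case: ifP.
have U0 x : 0 <= U x by rewrite /U patchE; case: ifP => //; case: ifP.
have mvB : measurable_fun setT (v \_ B).
  by apply/(measurable_restrictT _ mB); exact: measurable_funTS.
have mL : measurable_fun setT L.
  apply/(measurable_restrictT _ (measurableD mB mN)); exact: measurable_funTS.
have mU : measurable_fun setT U.
  apply: measurable_fun_ifT => //.
  apply: (measurable_fun_bool true); rewrite setTI.
  rewrite (_ : _ @^-1` _ = N) => //.
  by apply/seteqP; split => x; [exact: set_mem|exact: mem_set].
have LU : \int[mu]_x L x = \int[mu]_x U x.
  apply: ge0_ae_eq_integral => //.
  exists N; split=> // x /= h; apply: contrapT => Nx; apply: h => _.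
  rewrite /L /U (memNset Nx) !patchE.
  case: (boolP (x \in B)) => Bx.
    by rewrite mem_set//; split => //; exact: set_mem.
  by rewrite memNset// => -[Bx' _]; move: Bx; rewrite mem_set.
have sq (C : set T) : (forall x, ~ N x -> v x != 0 -> (C x <-> B x)) ->
    \int[mu]_(x in C) v x = \int[mu]_x U x.
  move=> CB; rewrite integral_mkcond; apply/eqP; rewrite eq_le; apply/andP; split.
    apply: ge0_le_integralT => x; apply/andP; split.
      by rewrite patchE; case: ifP.
    rewrite /U.
    case: (boolP (x \in N)) => Nx; first by rewrite leey.
    have {}Nx : ~ N x by move=> /mem_set; exact/negP.
    rewrite !patchE; have [->|vx] := eqVneq (v x) 0; first by do 2 case: ifP.
    case: (boolP (x \in C)) => [/set_mem Cx|_]; last by case: ifP.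
    by rewrite mem_set//; exact/(CB x Nx vx).
  rewrite -LU; apply: ge0_le_integralT => x; rewrite L0/= /L !patchE.
  case: (boolP (x \in B `\` N)) => [/set_mem[Bx Nx]|_]; last by case: ifP.
  have [->|vx] := eqVneq (v x) 0; first by case: ifP.
  by rewrite mem_set//; exact/(CB x Nx vx).
by rewrite sq// sq.
Qed.

End negligible_domain.

Section regular_set.
Context {R : realType} {n : nat}.
Local Notation V := 'rV[R]_n.
Local Notation leb := (@lebesgue_measure_rV R n).
Variable psi : V -> \bar R.
Hypothesis ppsi : proper psi.
Local Notation f := (exp_conjugate psi).
Local Notation F := (fine \o potential f).
Local Notation e_ i := (delta_mx 0 i : V).

Let f0 y : 0 <= f y. Proof. exact: exp_conjugate_ge0. Qed.
Let mf : measurable_fun setT f. Proof. exact: measurable_exp_conjugate. Qed.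

Definition irregular : set V := [set y | exists i,
  [\/ exists r, kink psi (e_ i) r y, endpoint psi (e_ i) y |
      endpoint psi (- e_ i) y]].

Let irregularE : irregular = \bigcup_k
  (if unpickle k is Some (i, r) then
     kink psi (e_ i) r `|` endpoint psi (e_ i) `|` endpoint psi (- e_ i)
   else set0).
Proof.
apply/seteqP; split => y.
  move=> [i h].
  have [r hr] : exists r, (kink psi (e_ i) r `|` endpoint psi (e_ i) `|`
      endpoint psi (- e_ i)) y.
    case: h => [[r hr]|h|h]; first by exists r; left; left.
      by exists 0; left; right.
    by exists 0; right.
  by exists (pickle (i, r)) => //; rewrite pickleK.
move=> [k _]; case: (unpickle k) => [[i r]|]//= [[h|h]|h]; exists i.
- by apply: Or31; exists r.
- exact: Or32.
- exact: Or33.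
Qed.

Lemma measurable_irregular : measurable irregular.
Proof.
rewrite irregularE; apply: bigcupT_measurable => k.
case: (unpickle k) => [[i r]|]//.
apply: measurableU; last exact: measurable_endpoint.
by apply: measurableU; [exact: measurable_kink|exact: measurable_endpoint].
Qed.

Lemma irregular_null : leb irregular = 0%E.
Proof.
apply/(measure_negligible measurable_irregular).
rewrite irregularE; apply: negligible_bigcup => k.
case: (unpickle k) => [[i r]|]; last exact: negligible_set0.
have nul A : measurable A -> leb A = 0%E -> leb.-negligible A.
  by move=> mA A0; exists A; split.
apply: negligibleU; last first.
  by apply: nul; [exact: measurable_endpoint|exact: endpoint_null].
apply: negligibleU.
  by apply: nul; [exact: measurable_kink|exact: kink_null].
by apply: nul; [exact: measurable_endpoint|exact: endpoint_null].
Qed.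

Definition regular_set : set V := [set y | 0 < f y] `\` irregular.

Local Notation Om := regular_set.

Lemma measurable_regular_set : measurable Om.
Proof.
apply: measurableD; last exact: measurable_irregular.
rewrite -[X in measurable X]setTI.
rewrite (_ : [set y | 0 < f y] = f @^-1` `]0, +oo[%classic); first exact: mf.
by apply/seteqP; split => y /=; rewrite in_itv/= andbT.
Qed.

Lemma regular_setP i y : Om y -> regular psi (e_ i) y.
Proof.
move=> [fy ny]; apply: regular_point => //.
- by move=> r kr; apply: ny; exists i; apply: Or31; exists r.
- by move=> h; apply: ny; exists i; apply: Or32.
- by move=> h; apply: ny; exists i; apply: Or33.
Qed.

(** Off the regular set [gradient] may take unspecified values; replacing them by [0] gives a
    measurable map on the whole space, which is odd when [psi] is even. *)
Definition regular_gradient (y : V) : V := \row_i (\1_Om y * 'D_(e_ i) F y).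

Lemma regular_gradientE y : Om y -> regular_gradient y = gradient F y.
Proof.
by move=> Oy; apply/rowP => i; rewrite !mxE indicE mem_set//= mul1r.
Qed.

(** Each coordinate is a pointwise limit of difference quotients with steps [1 / (j + 1)], cut off
    outside the regular set. *)
Lemma measurable_regular_gradient : measurable_fun setT regular_gradient.
Proof.
apply: measurable_fun_rV => i.
pose q (j : nat) y := \1_Om y * ((ln (f y) - ln (f (y + j.+1%:R^-1 *: e_ i))) * j.+1%:R).
apply: (@measurable_fun_cvg _ _ _ _ q) => [j|y _].
  apply: measurable_funM; first exact: measurable_indic measurable_regular_set.
  apply: measurable_funM => //; apply: measurable_funB.
    by apply: measurableT_comp => //; exact: measurable_ln.
  apply: measurableT_comp; first exact: measurable_ln.
  by apply: measurableT_comp => //; exact: measurable_addr_rV.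
rewrite mxE /q indicE; case: (boolP (y \in Om)) => [/set_mem Oy|_]; last first.
  by under eq_fun do rewrite mul0r; rewrite mul0r; exact: cvg_cst.
under eq_fun do rewrite mul1r; rewrite mul1r.
have [fy H] := regular_setP i Oy.
apply/cvgrPdist_le => e e0; have [d d0 dE] := H e e0.
exists (Num.truncn d^-1) => // j /= dj.
have j0 : 0 < j.+1%:R^-1 :> R by rewrite invr_gt0.
have [|_] := dE j.+1%:R^-1.
  rewrite normr_gt0 gt_eqF//= gtr0_norm//.
  rewrite -[ltRHS]invrK ltf_pV2 ?posrE ?invr_gt0//.
  by apply: lt_le_trans (truncnS_gt _) _; rewrite ler_nat.
by rewrite invrK distrC.
Qed.

Hypothesis psiN : forall x, psi (- x) = psi x.

Let fN y : f (- y) = f y. Proof. exact: exp_conjugateN. Qed.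

(** Reflection exchanges the two sides: a kink for [r] becomes a kink for [- r], and an endpoint
    along [v] becomes one along [- v]. *)
Lemma regular_setN y : Om y -> Om (- y).
Proof.
have fNB (z v : V) (t : R) : f (- z + t *: v) = f (z - t *: v).
  by rewrite -fN opprD opprK.
have fNB' (z v : V) (t : R) : f (- z - t *: v) = f (z + t *: v).
  by rewrite -fN opprB opprK addrC.
move=> [fy ny]; split; first by rewrite /= fN.
move=> [i [[r [_ h]]|[_ h]|[_ h]]]; apply: ny; exists i.
- apply: Or31; exists (- r); split => // j.
  have [h1 h2] := h j; rewrite rmorphN mulNr opprK.
  by rewrite -fNB -fNB' -(fN y).
- apply: Or33; split => // j; rewrite scalerN -fNB; exact: h.
- by apply: Or32; split => // j; have := h j; rewrite scalerN fNB'.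
Qed.

Let opposite_limits (q D D' e : R) :
  `|- q - D| <= e / 2 -> `|q - D'| <= e / 2 -> `|D' + D| <= e.
Proof. by rewrite !ler_distl ler_norml => /andP[? ?] /andP[? ?]; lra. Qed.

Lemma regular_gradientN y : regular_gradient (- y) = - regular_gradient y.
Proof.
apply/rowP => i; rewrite !mxE !indicE.
have [Oy|nOy] := pselect (Om y); last first.
  rewrite !memNset ?mul0r ?oppr0// => /regular_setN.
  by rewrite opprK.
rewrite !mem_set//; last exact: regular_setN.
rewrite !mul1r; apply/eqP; rewrite -addr_eq0 -normr_le0.
apply/ler_addgt0Pr => e e0; rewrite add0r.
have [fy H] := regular_setP i Oy; have [_ H'] := regular_setP i (regular_setN Oy).
have e2 : 0 < e / 2 by rewrite divr_gt0.
have [d d0 dE] := H _ e2; have [d' d'0 dE'] := H' _ e2.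
(* The quotient at [y] with step [- t] and the quotient at [- y] with step [t] are opposite because
   [f] is even. *)
pose t := Num.min d d' / 2.
have m0 : 0 < Num.min d d' by rewrite lt_min d0 d'0.
have t0 : 0 < t by rewrite divr_gt0.
have tm : t < Num.min d d' by rewrite gtr_pMr// invf_lt1// ltr1n.
have /andP[td td'] : (t < d) && (t < d') by rewrite -lt_min.
have [|_] := dE (- t); first by rewrite normrN gtr0_norm// t0.
have [|_] := dE' t; first by rewrite gtr0_norm// t0.
rewrite fN -(fN (- y + _)) opprD opprK scaleNr invrN mulrN.
by move=> h h'; exact: opposite_limits h' h.
Qed.

End regular_set.

(** * The Euler-Lagrange inequality *)

Section euler_lagrange.
Context {R : realType} {n : nat}.
Local Notation V := 'rV[R]_n.
Local Notation leb := (@lebesgue_measure_rV R n).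
Variable alpha : R.
Variable psi : V -> \bar R.
Hypothesis ppsi : proper psi.
Local Notation f := (exp_conjugate psi).
Local Notation F := (fine \o potential f).
Local Notation e_ i := (delta_mx 0 i : V).
Local Notation Om := (regular_set psi).
Local Notation G := (regular_gradient psi).

Definition perturbation (h : V -> R) (t : R) : V -> \bar R :=
  fun x => (psi x + (t * h x)%:E)%E.

Lemma proper_perturbation h t : proper (perturbation h t).
Proof.
have [psiN [x psix]] := ppsi; split => [y|].
  by rewrite adde_eq_ninfty negb_or psiN.
by exists x; rewrite lte_add_pinfty// ltry.
Qed.

(* A supporting affine function of [- ln f] at [y + s *: e_ i] lies above the
   tangent at [y] by [s * (rho / 2)] as soon as [x 0 i - G y 0 i >= rho]. *)
Lemma tangent_margin y (rho : R) : Om y -> 0 < rho -> exists2 m, 0 < m &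
  forall x : V, rho <= `|x - G y| -> ((dot x y + ln (f y) + m)%:E <= psi x)%E.
Proof.
move=> Oy rho0; have fy : 0 < f y by case: Oy.
have r2 : 0 < rho / 2 by rewrite divr_gt0.
have /(_ _)/cid2 H i : exists2 s : R, 0 < s & forall x : V, rho <= `|x 0 i - G y 0 i| ->
    ((dot x y + ln (f y) + s * (rho / 2))%:E <= psi x)%E.
  have [_ /(_ _ r2)[d d0 dE]] := regular_setP ppsi i Oy.
  have GE : G y 0 i = 'D_(e_ i) F y by rewrite regular_gradientE// mxE.
  rewrite -GE in dE; move: (G y 0 i) dE => p dE.
  pose s := d / 2.
  have s0 : 0 < s by rewrite divr_gt0.
  have sd : s < d by rewrite ltr_pdivrMr// ltr_pMr// ltr1n.
  exists s => // x; rewrite ler_normr => /orP[xG|xG].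
    have [|f's] := dE s; first by rewrite gtr0_norm// s0.
    rewrite ler_norml => /andP[_]; rewrite lerBlDr ler_pdivrMr// => ls.
    have := (exp_conjugate_geP (y + s *: e_ i) ppsi f's).1 (lexx _) x.
    apply: le_trans; rewrite lee_fin dotDr dotZr dot_delta.
    have := ler_wpM2l (ltW s0) xG; lra.
  have [|f's] := dE (- s); first by rewrite normrN gtr0_norm// s0.
  rewrite ler_norml invrN mulrN => /andP[+ _].
  rewrite lerBrDr lerNr ler_pdivrMr// => ls.
  have := (exp_conjugate_geP (y + (- s) *: e_ i) ppsi f's).1 (lexx _) x.
  apply: le_trans; rewrite lee_fin dotDr dotZr dot_delta.
  have := ler_wpM2l (ltW s0) xG; lra.
pose s i := s2val (H i).
have s0 i : 0 < s i by rewrite /s; case: (H i).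
(* [K^-1] is a positive lower bound for the finitely many steps [s i]. *)
pose K := 1 + \sum_i (s i)^-1.
have sV0 i : 0 < (s i)^-1 by rewrite invr_gt0.
have K0 : 0 < K by rewrite /K ltr_pwDl// sumr_ge0// => i _; exact: ltW.
have Ks i : K^-1 <= s i.
  rewrite -[leRHS]invrK lef_pV2 ?posrE//.
  rewrite /K (bigD1 i)//= addrCA lerDl addr_ge0// sumr_ge0// => j _.
  exact: ltW.
exists (K^-1 * (rho / 2)) => [|x xG]; first by rewrite mulr_gt0 ?invr_gt0.
have [i ix] : exists i, rho <= `|x 0 i - G y 0 i|.
  have x0 : mx_norm (x - G y) != 0 by rewrite gt_eqF// (lt_le_trans rho0).
  have [[a i] /= xE] := mx_norm_neq0 x0.
  exists i; move: xE; rewrite (ord1 a) => xE.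
  by rewrite (le_trans xG)// [leLHS]xE !mxE.
have := s2valP' (H i) x ix; apply: le_trans.
by rewrite lee_fin lerD2l; apply: ler_wpM2r (Ks i); exact: ltW.
Qed.

(** Near [G y] the perturbation raises [psi] by at least [t * h (G y)]; at distance [rho] or more,
    the margin of [tangent_margin] already covers this rise when [t] is small. *)
Lemma perturbation_ge (h : V -> R) y : (forall x, 0 <= h x) -> Om y ->
  (exists2 rho : R, 0 < rho & forall x : V, `|x - G y| < rho -> h (G y) <= h x) ->
  exists2 t0, 0 < t0 & forall t, 0 <= t <= t0 ->
    f y * expR (t * h (G y)) <= exp_conjugate (perturbation h t) y.
Proof.
move=> h0 Oy [rho rho0 hrho]; have fy : 0 < f y by case: Oy.
have [m m0 mE] := tangent_margin Oy rho0.
have K0 : 0 < 1 + h (G y) by rewrite ltr_pwDl.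
exists (m / (1 + h (G y))) => [|t /andP[t0 tm]]; first by rewrite divr_gt0.
have thm : t * h (G y) <= m.
  move: tm; rewrite ler_pdivlMr// mulrDr mulr1; lra.
apply/(exp_conjugate_geP _ (proper_perturbation h t)).
  by rewrite mulr_gt0// expR_gt0.
move=> x; rewrite lnM ?posrE ?expR_gt0// expRK addrA /perturbation.
have [xG|xG] := ltP `|x - G y| rho.
  rewrite EFinD leeD//; last by rewrite lee_fin ler_wpM2l// hrho.
  exact: (exp_conjugate_geP y ppsi fy).1 (lexx _) x.
apply: le_trans (_ : (dot x y + ln (f y) + m)%:E <= _)%E.
  by rewrite lee_fin lerD2l.
by apply: le_trans (mE x xG) _; rewrite leeDl// lee_fin mulr_ge0.
Qed.

Hypotheses (n_gt0 : (0 < n)%N) (alpha_gt0 : 0 < alpha).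
Local Notation w y := (riesz_potential alpha f y * (f y)%:E)%E.
Local Notation E g := (riesz_energy alpha g).

Let f0 y : 0 <= f y. Proof. exact: exp_conjugate_ge0. Qed.
Let mf : measurable_fun setT f. Proof. exact: measurable_exp_conjugate. Qed.

(** The energy of [f + (g - f)] is expanded by bilinearity and symmetry, and the nonnegative energy
    of [g - f] is dropped. *)
Lemma riesz_form_increment g M M' : measurable_fun setT g ->
  (forall y, f y <= g y) -> E f = M%:E -> (E g <= M'%:E)%E ->
  (riesz_form alpha f (fun y => g y - f y)%R <= ((M' - M) / 2)%:E)%E.
Proof.
move=> mg fg EfM EgM.
set k := fun y => _.
have mk : measurable_fun setT k by exact: measurable_funB.
have k0 y : 0 <= k y by rewrite subr_ge0.
have gE : g = fun y => f y + k y by apply/funext => y; rewrite /k addrC subrK.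
have g0 y : 0 <= f y + k y by rewrite addr_ge0.
have mfk : measurable_fun setT (fun y => f y + k y) by exact: measurable_funD.
have : E g = (M%:E + riesz_form alpha f k + (riesz_form alpha f k + riesz_form alpha k k))%E.
  rewrite gE riesz_form_diag riesz_formDr//.
  rewrite riesz_form_sym// riesz_formDr// -riesz_form_diag EfM.
  rewrite (riesz_form_sym alpha (f := fun y => f y + k y))// riesz_formDr//.
  by rewrite (riesz_form_sym alpha (f := k)).
have kk0 : (0 <= riesz_form alpha k k)%E by exact: riesz_form_ge0.
have fk0 : (0 <= riesz_form alpha f k)%E by exact: riesz_form_ge0.
move: EgM => /[swap] ->; move: fk0 kk0.
case: (riesz_form alpha f k) => [a| |]//; case: (riesz_form alpha k k) => [b| |]//=.
by rewrite !lee_fin => a0 b0 H; rewrite ler_pdivlMr//; lra.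
Qed.

(** This is [1 - x <= exp (- x)] multiplied by [exp x]. *)
Let expR_le_quad (x : R) : expR x - 1 <= x * expR x.
Proof.
have := expR_ge1Dx (- x); rewrite -(ler_pM2r (expR_gt0 x)) -expRD addNr expR0.
by lra.
Qed.

(** For [t = 1 / (j + 1)], [riesz_form_increment] bounds the integral of I(f) (f_t - f) / t by
    [M * m * expR (2 * t * m)]. By [perturbation_ge], the lower limit of these integrands dominates
    the integrand of the conclusion on the regular set, and Fatou's lemma applies. In the
    application [m] is the [mu]-average of [h]. *)
Lemma euler_lagrange_le (h : V -> R) (M m : R) : measurable_fun setT h ->
  (forall x, 0 <= h x) ->
  (forall p : V, exists2 rho : R, 0 < rho &
     forall x : V, `|x - p| < rho -> h p <= h x) ->
  E f = M%:E -> 0 <= M -> 0 <= m ->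
  (forall t, 0 < t -> (E (exp_conjugate (perturbation h t)) <=
     (M * expR (2 * t * m))%:E)%E) ->
  (\int[leb]_(y in Om) ((h (G y))%:E * w y) <= (M * m)%:E)%E.
Proof.
move=> mh h0 hlsc EfM M0 m0 Eh.
have mOm : measurable Om := measurable_regular_set ppsi.
have mw : measurable_fun setT (riesz_potential alpha f).
  exact: measurable_riesz_potential.
have I0 y : (0 <= riesz_potential alpha f y)%E by exact: riesz_potential_ge0.
pose t_ (j : nat) : R := j.+1%:R^-1.
have t0 j : 0 < t_ j by rewrite invr_gt0.
pose f_ j := exp_conjugate (perturbation h (t_ j)).
have mf_ j : measurable_fun setT (f_ j).
  exact: measurable_exp_conjugate (proper_perturbation _ _).
have ff_ j y : f y <= f_ j y.
  apply: le_exp_conjugate => //; first exact: proper_perturbation.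
  by move=> x; rewrite leeDl// lee_fin mulr_ge0// ltW.
pose u j y := (riesz_potential alpha f y * ((f_ j y - f y) * j.+1%:R)%:E)%E.
have mu_ j : measurable_fun setT (u j).
  apply: emeasurable_funM => //; apply/measurable_EFinP.
  by apply: measurable_funM => //; exact: measurable_funB.
have u0 j y : (0 <= u j y)%E.
  by rewrite mule_ge0// lee_fin mulr_ge0// subr_ge0.
have uint j : (\int[leb]_(y in Om) u j y <= (M * m * expR (2 * t_ j * m))%:E)%E.
  apply: (@le_trans _ _ (\int[leb]_y u j y)%E).
    by apply: ge0_subset_integral => //; exact: mu_.
  have -> : (\int[leb]_y u j y = riesz_form alpha f (fun y => f_ j y - f y)%R * j.+1%:R%:E)%E.
    have mfg : measurable_fun setT (fun y => riesz_potential alpha f y * (f_ j y - f y)%R%:E)%E.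
      apply: emeasurable_funM => //; apply/measurable_EFinP.
      exact: measurable_funB.
    have fg0 y : setT y -> (0 <= riesz_potential alpha f y * (f_ j y - f y)%R%:E)%E.
      by move=> _; rewrite mule_ge0// lee_fin subr_ge0.
    have j0 : (0 <= j.+1%:R%:E :> \bar R)%E by rewrite lee_fin.
    rewrite -(ge0_integralZr leb measurableT mfg fg0 j0).
    by apply: eq_integral => y _; rewrite /u EFinM muleA.
  have := riesz_form_increment (mf_ j) (ff_ j) EfM (Eh _ (t0 j)).
  have j0 : (0 <= j.+1%:R%:E :> \bar R)%E by rewrite lee_fin.
  move=> /(lee_wpmul2r j0)/le_trans; apply.
  rewrite -EFinM lee_fin.
  have := expR_le_quad (2 * t_ j * m); move: (expR _) => e he.
  have -> : M * m * e = M * (2 * t_ j * m * e) / 2 * j.+1%:R.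
    rewrite /t_; have : j.+1%:R != 0 :> R by rewrite pnatr_eq0.
    by move: j.+1%:R => J J0; field.
  rewrite ler_wpM2r// ler_wpM2r// -{2}(mulr1 M) -mulrBr.
  by rewrite ler_wpM2l.
have limu y : Om y -> ((h (G y))%:E * w y <= limn_einf (u^~ y))%E.
  move=> Oy; have fy : 0 < f y by case: Oy.
  have [s s0 sE] := perturbation_ge h0 Oy (hlsc _).
  apply: (@limn_einf_ge _ _ _ (Num.truncn s^-1)) => j sj.
  rewrite /u muleCA lee_wpmul2l// -EFinM lee_fin.
  have ts : 0 <= t_ j <= s.
    rewrite (ltW (t0 j))/= -[leRHS]invrK lef_pV2 ?posrE ?invr_gt0//.
    by apply: ltW; apply: lt_le_trans (truncnS_gt _) _; rewrite ler_nat.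
  have := sE _ ts; rewrite -/(f_ j) => /(le_trans _) H.
  rewrite mulrC -ler_pdivrMr// -/(t_ j) lerBrDr; apply: H.
  rewrite -[X in _ + X]mulr1 -mulrA -mulrDr ler_pM2l//.
  by rewrite addrC mulrC; exact: expR_ge1Dx.
have X_le : (\int[leb]_(y in Om) ((h (G y))%:E * w y) <=
    limn_einf (fun j => \int[leb]_(y in Om) u j y))%E.
  apply: (@le_trans _ _ (\int[leb]_(y in Om) limn_einf (u^~ y))%E).
    apply: ge0_le_integral => //.
    - by move=> y _; rewrite mule_ge0 ?lee_fin ?mule_ge0 ?lee_fin.
    - apply: measurable_funTS; apply: emeasurable_funM.
        apply/measurable_EFinP; apply: measurableT_comp => //.
        exact: measurable_regular_gradient.
      by apply: emeasurable_funM => //; exact/measurable_EFinP.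
    - rewrite (_ : (fun _ => _) =
        (fun y => - limn_esup (-%E \o (u^~ y)))%E); last first.
        by apply/funext => y; rewrite limn_esupN oppeK.
      apply: measurable_funTS; apply: measurableT_comp.
        exact: oppe_measurable.
      by apply: measurable_fun_limn_esup => j; exact: measurableT_comp.
  by apply: fatou => // j; [exact: measurable_funTS].
(* It remains to let [t] tend to [0] in [M * m * expR (2 * t * m)]: for [t <= 1] its excess over
   [M * m] is at most [C * t], hence at most [e] at the index chosen below. *)
apply/lee_addgt0Pr => e e0; rewrite leNgt; apply/negP.
move=> /lt_le_trans/(_ X_le); rewrite -EFinD => /limn_einf_gt[N HN].
pose C := M * m * (2 * m * expR (2 * m)).
have C0 : 0 <= C by rewrite !mulr_ge0// expR_ge0.
pose j := maxn N (Num.truncn (C / e)).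
have := lt_le_trans (HN j (leq_maxl _ _)) (uint j); rewrite lte_fin ltNge.
move=> /negP; apply.
have tj1 : t_ j <= 1 by rewrite invf_le1// ler1n.
have Cj : C * t_ j <= e.
  rewrite ler_pdivrMr// mulrC -ler_pdivrMr//.
  by apply/ltW/(lt_le_trans (truncnS_gt _)); rewrite ler_nat ltnS leq_maxr.
have := expR_le_quad (2 * t_ j * m).
have : expR (2 * t_ j * m) <= expR (2 * m).
  by rewrite ler_expR mulrAC ler_piMr// mulr_ge0.
move: (expR (2 * t_ j * m)) => a a1 a2.
apply: (@le_trans _ _ (M * m * (1 + 2 * t_ j * m * expR (2 * m)))).
  rewrite ler_wpM2l// ?mulr_ge0// -lerBlDl (le_trans a2)// ler_wpM2l//.
  by rewrite !mulr_ge0// ltW.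
by rewrite mulrDr mulr1 lerD2l; apply: le_trans Cj; rewrite /C; lra.
Qed.

End euler_lagrange.

(** * Comparison of finite Borel measures on open sets *)

Section measures_on_rV.
Context {R : realType} {n : nat}.
Local Notation V := 'rV[R]_n.
Local Open Scope ereal_scope.

Lemma open_closed_exhaustion (U : set V) : open U -> exists C : (set V)^nat,
  [/\ forall k, closed (C k), nondecreasing_seq C & \bigcup_k C k = U].
Proof.
move=> oU; pose C k := ~` \bigcup_(x in ~` U) ball (x : V) (k.+1%:R^-1 : R).
exists C; split => [k|k l kl|].
- apply: open_closedC; apply: bigcup_open => x _; exact: ball_open.
- apply/subsetPset => y Cy [x nUx xy]; apply: Cy; exists x => //.
  by apply: le_ball xy; rewrite lef_pV2 ?posrE// ler_nat.
apply/seteqP; split => [y [k _ Cy]|y Uy].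
  by apply: contrapT => nUy; apply: Cy; exists y => //; exact: ballxx.
have : nbhs y U by exact: open_nbhs_nbhs.
move=> /nbhs_ballP[e /= e0 yU]; exists (Num.truncn e^-1) => // -[x nUx xy].
apply: nUx; apply: yU; apply: ball_sym; apply: le_ball xy.
by rewrite -[leRHS]invrK lef_pV2 ?posrE ?invr_gt0// ltW// truncnS_gt.
Qed.

(** Complements reverse the inequality on closed sets. An open set is an increasing union of closed
    sets, so equality holds on open sets, which generate and are stable under intersection. *)
Lemma le_open_measure_eq (m1 m2 : {measure set V -> \bar R}) :
  m1 setT < +oo -> m1 setT = m2 setT -> (forall U, open U -> m1 U <= m2 U) ->
  forall A, measurable A -> m1 A = m2 A.
Proof.
move=> m1oo m12T m12 A mA.
have fin1 B : measurable B -> m1 B \is a fin_num.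
  move=> mB; rewrite ge0_fin_numE//; apply: le_lt_trans m1oo.
  by apply: le_measure; rewrite ?inE.
have fin2 B : measurable B -> m2 B \is a fin_num.
  move=> mB; rewrite ge0_fin_numE//; move: m1oo; rewrite m12T.
  by apply: le_lt_trans; apply: le_measure; rewrite ?inE.
have closed21 C : closed C -> m2 C <= m1 C.
  move=> cC; have mCC : measurable (~` C) by apply: open_measurable_rV; exact: closed_openC.
  have mC : measurable C by rewrite -(setCK C); exact: measurableC.
  have split_ (m : {measure set V -> \bar R}) : m setT = m C + m (~` C).
    by rewrite -measureU ?setICr// setUv.
  have := m12 _ (closed_openC cC); have := m12T; rewrite !split_.
  have := fin1 _ mC; have := fin1 _ mCC; have := fin2 _ mC; have := fin2 _ mCC.
  case: (m1 C) (m1 (~` C)) (m2 C) (m2 (~` C)) => [a| |] [b| |] [c| |] [d| |]//.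
  by move=> _ _ _ _ [H]; rewrite !lee_fin; lra.
apply: (@measure_unique _ _ _ (@open V) (fun=> setT)) => //.
- by move=> U U'; exact: openI.
- by move=> _; exact: openT.
- by apply/seteqP; split => // x _; exists 0%N.
move=> U oU; apply/eqP; rewrite eq_le m12//=.
have [C [cC ndC CU]] := open_closed_exhaustion oU.
have mC k : measurable (C k).
  by rewrite -(setCK (C k)); apply: measurableC; apply: open_measurable_rV; exact: closed_openC.
have mU : measurable U by exact: open_measurable_rV.
have : m2 \o C @ \oo --> m2 U.
  by rewrite -CU; apply: nondecreasing_cvg_mu => //; rewrite CU.
move=> /cvg_lim <- //; apply: lime_le.
  by apply/cvg_ex; exists (m2 U); rewrite -CU; apply: nondecreasing_cvg_mu => //; rewrite CU.
apply: nearW => k; apply: (le_trans (closed21 _ (cC k))).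
apply: le_measure; rewrite ?inE// -CU; exact: bigcup_sup.
Qed.

End measures_on_rV.

(** * The energy measure *)

Section gradient_measure.
Context {R : realType} {n : nat}.
Local Notation V := 'rV[R]_n.
Local Notation leb := (@lebesgue_measure_rV R n).
Variables (alpha : R) (psi : V -> \bar R).
Local Notation f := (exp_conjugate psi).
Local Notation Om := (regular_set psi).
Local Notation G := (regular_gradient psi).
Local Notation w y := (riesz_potential alpha f y * (f y)%:E)%E.

(* The proof argument only serves the inference of the measure structure. *)
Definition gradient_measure (_ : proper psi) (A : set V) : \bar R :=
  (\int[leb]_(y in Om `&` G @^-1` A) w y)%E.

Variable ppsi : proper psi.
Local Notation m := (gradient_measure ppsi).

Let f0 y : 0 <= f y. Proof. exact: exp_conjugate_ge0. Qed.
Let mf : measurable_fun setT f. Proof. exact: measurable_exp_conjugate. Qed.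

Let measurable_w : measurable_fun setT (fun y => w y).
Proof.
apply: emeasurable_funM; last exact/measurable_EFinP.
exact: measurable_riesz_potential.
Qed.

Let w_ge0 y : (0 <= w y)%E.
Proof. by rewrite mule_ge0 ?lee_fin// riesz_potential_ge0. Qed.

Let mOm : measurable Om. Proof. exact: measurable_regular_set. Qed.

Let measurable_preimage A : measurable A -> measurable (Om `&` G @^-1` A).
Proof.
by move=> mA; apply: (measurable_funTS (measurable_regular_gradient ppsi)).
Qed.

Let m0 : m set0 = 0%E.
Proof. by rewrite /m preimage_set0 setI0 integral_set0. Qed.

Let m_ge0 A : (0 <= m A)%E.
Proof. by apply: integral_ge0 => y _. Qed.

Let m_sigma_additive : semi_sigma_additive m.
Proof.
move=> A mA tA mUA; rewrite /m preimage_bigcup setI_bigcupr.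
apply: (semi_sigma_additive_nng_induced (mu := leb) measurable_w w_ge0).
- by move=> k; exact: measurable_preimage.
- apply/trivIsetP => i j _ _ ij; have /trivIsetP/(_ i j I I ij) Aij := tA.
  by rewrite setIACA setIid -preimage_setI Aij preimage_set0 setI0.
- by rewrite -setI_bigcupr -preimage_bigcup; exact: measurable_preimage.
Qed.

HB.instance Definition _ := isMeasure.Build _ _ _ m m0 m_ge0 m_sigma_additive.

Let w_neq0 y : (w y != 0)%E -> 0 < f y.
Proof. by rewrite lt0r f0 andbT; apply: contra => /eqP ->; rewrite mule0. Qed.

Let irregular_off y : ~ irregular psi y -> (w y != 0)%E -> Om y.
Proof. by move=> ny /w_neq0 fy. Qed.

Lemma gradient_measureT : m setT = riesz_energy alpha f.
Proof.
apply/esym; apply: (integral_eq_off_null (N := irregular psi)) => //.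
- exact: measurable_preimage.
- exact: measurable_irregular.
- exact: irregular_null.
by move=> y ny wy; split => // _; split => //; exact: irregular_off.
Qed.

(** The preimage of [A] under [gradient] need not be measurable, but off the null set [irregular] it
    agrees with the preimage under [regular_gradient] wherever the integrand is nonzero. *)
Lemma riesz_energy_measureE A : measurable A ->
  riesz_energy_measure alpha f A = m A.
Proof.
move=> mA; rewrite /riesz_energy_measure /pushforward.
apply: (integral_eq_off_null (N := irregular psi)) => //.
- exact: measurable_preimage.
- exact: measurable_irregular.
- exact: irregular_null.
move=> y ny wy; have Oy := irregular_off ny wy.
split => -[yA] /=; rewrite -regular_gradientE//; split => //.
by apply: subset_closure; case: Oy.
Qed.

Lemma gradient_measure_indic A : measurable A ->
  m A = (\int[leb]_(y in Om) ((\1_A (G y))%:E * w y))%E.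
Proof.
move=> mA; rewrite /m setIC integral_mkcondl; apply: eq_integral => y _.
rewrite patchE indicE; case: (boolP (y \in G @^-1` A)) => [/set_mem|/negP] Ay.
  by rewrite mem_set// mul1e.
by rewrite memNset ?mul0e// => GyA; apply: Ay; exact: mem_set.
Qed.

Hypothesis psiN : forall x, psi (- x) = psi x.

Let fN y : f (- y) = f y. Proof. exact: exp_conjugateN. Qed.

Lemma riesz_potentialN y :
  riesz_potential alpha f (- y) = riesz_potential alpha f y.
Proof.
pose H z := (f z / euclidean_norm (z - y) `^ (n%:R - alpha))%:E.
rewrite /riesz_potential -[RHS](@integral_affine _ _ (-1) 0 H).
- apply: eq_integral => x _; rewrite /H scaleN1r addr0 fN.
  by rewrite -(euclidean_normN (x - - y)) opprD opprK.
- by right.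
- have mE := measurable_riesz_kernelB alpha (f := id) (g := fun=> y) _ _.
  apply/measurable_EFinP; apply: measurable_funM => //.
  by apply: mE; [exact: measurable_id|exact: measurable_cst].
- move=> z; rewrite lee_fin divr_ge0//; exact: powR_ge0.
Qed.

(** [G] is odd, the integrand is even and Lebesgue measure is invariant under reflection. *)
Lemma gradient_measureN (A : set V) : measurable A -> m (-%R @^-1` A) = m A.
Proof.
move=> mA; rewrite /m integral_mkcond [RHS]integral_mkcond.
rewrite -[RHS](@integral_affine _ _ (-1) 0).
- apply: eq_integral => y _; rewrite !patchE scaleN1r addr0.
  rewrite riesz_potentialN fN; congr (if _ then _ else _).
  apply/idP/idP => /set_mem [Oy Ay]; apply/mem_set; split.
  + exact: regular_setN.
  + by rewrite /= regular_gradientN.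
  + by rewrite -(opprK y); exact: regular_setN.
  + by move: Ay; rewrite /= regular_gradientN.
- by right.
- apply/(measurable_restrictT _ (measurable_preimage mA)).
  exact: measurable_funTS.
- by move=> y; rewrite patchE; case: ifP.
Qed.

End gradient_measure.

(** * From the maximizer to the prescribed energy measure *)

Section solution.
Context {R : realType} {n : nat}.
Local Notation V := 'rV[R]_n.
Local Notation leb := (@lebesgue_measure_rV R n).
Variable alpha : R.
Hypotheses (n_gt0 : (0 < n)%N) (alpha_gt0 : 0 < alpha).
Variable mu : {measure set V -> \bar R}.
Hypothesis mu_finite : (mu setT < +oo)%E.
Hypothesis mu_neq0 : mu setT != 0%E.
Hypothesis mu_even : even_measure mu.
Variable c : R.
Hypothesis c_gt0 : 0 < c.
Hypothesis mu_coercive : forall t, ((c * `|t|)%:E <= abs_moment mu t)%E.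
Variable psi : V -> \bar R.
Hypothesis fpsi : feasible mu psi.
Hypothesis gain_psi_gt0 : 0 < gain alpha mu psi.
Hypothesis gain_max :
  forall psi', feasible mu psi' -> gain alpha mu psi' <= gain alpha mu psi.

Local Notation E f := (riesz_energy alpha f).
Local Notation mass := (mass mu).
Let mass_gt0 : 0 < mass. Proof. exact: mass_gt0. Qed.
Let ppsi : proper psi. Proof. exact: feasible_proper fpsi. Qed.
Let energy_feasible := riesz_energy_feasible n_gt0 alpha_gt0 mu_finite mu_neq0
  c_gt0 mu_coercive.

Let e0 := fine (E (exp_conjugate psi)).
Let e0_gt0 : 0 < e0.
Proof. by move: gain_psi_gt0; rewrite /gain pmulr_lgt0// expR_gt0. Qed.

(* Adding [kappa] to [psi] makes the energy equal to the mass of [mu]. *)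
Let kappa := ln (mass / e0) / 2.
Definition normalized : V -> \bar R := fun x => (psi x + kappa%:E)%E.
Let proper_normalized : proper normalized. Proof. exact: properD. Qed.
Local Notation f := (exp_conjugate normalized).

Let expR_kappa : expR kappa ^+ 2 = mass / e0.
Proof.
by rewrite -expRM_natl /kappa mulrC divfK// lnK// posrE divr_gt0.
Qed.

Let energy_shift (phi : V -> \bar R) : proper phi ->
  E (exp_conjugate (fun x => phi x + kappa%:E)%E) =
  ((mass / e0)%:E * E (exp_conjugate phi))%E.
Proof.
move=> pphi; rewrite -expR_kappa -riesz_energyZ ?expR_ge0//.
- by congr riesz_energy; apply/funext => y; rewrite exp_conjugateD.
- exact: measurable_exp_conjugate.
- by move=> x; exact: exp_conjugate_ge0.
Qed.

Lemma energy_normalized : E f = mass%:E.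
Proof.
rewrite energy_shift// energy_feasible// -EFinM; congr EFin.
by rewrite divfK// gt_eqF.
Qed.

Section test_set.
Variable U : set V.
Hypothesis oU : open U.

Let mU : measurable U. Proof. exact: open_measurable_rV. Qed.
Let NU := -%R @^-1` U.

Let oNU : open NU.
Proof. by apply: open_comp oU => x _; exact: oppr_continuous. Qed.

Let mNU : measurable NU. Proof. exact: open_measurable_rV. Qed.

Let mu_NU : mu NU = mu U.
Proof.
rewrite -(mu_even mU); congr (mu _); apply/seteqP; split => x /=.
  by move=> Ux; exists (- x) => //; rewrite opprK.
by move=> [z Uz <-]; rewrite /NU/= opprK.
Qed.

(** Symmetrizing the indicator of [U] keeps the perturbed function even; it doubles both sides of
    the final inequality. *)
Let h x : R := \1_U x + \1_NU x.

Let h_ge0 x : 0 <= h x. Proof. by rewrite addr_ge0. Qed.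

Let measurable_h : measurable_fun setT h.
Proof. by apply: measurable_funD; exact: measurable_indic. Qed.

Let h_lsc (p : V) : exists2 rho : R, 0 < rho &
  forall x : V, `|x - p| < rho -> h p <= h x.
Proof.
have lsc (W : set V) : open W -> exists2 rho : R, 0 < rho &
    forall x : V, `|x - p| < rho -> \1_W p <= (\1_W x : R).
  move=> oW; have [Wp|nWp] := pselect (W p); last first.
    by exists 1 => // x _; rewrite !indicE (memNset nWp).
  have : nbhs p W by exact: open_nbhs_nbhs.
  move=> /nbhs_ballP[e /= e_gt0 pW]; exists e => // x xp.
  rewrite !indicE (mem_set Wp) mem_set//; apply: pW.
  by rewrite -ball_normE/= distrC.
have [r1 r10 H1] := lsc U oU; have [r2 r20 H2] := lsc NU oNU.
exists (Num.min r1 r2) => [|x]; first by rewrite lt_min r10.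
by rewrite lt_min => /andP[x1 x2]; rewrite lerD// ?H1 ?H2.
Qed.

Let mass_U := fine (mu U).
Let muUE : mu U = mass_U%:E.
Proof.
rewrite fineK// ge0_fin_numE//; apply: le_lt_trans mu_finite.
by apply: le_measure; rewrite ?inE.
Qed.

Let moment_h : (\int[mu]_x (h x)%:E = (2 * mass_U)%:E)%E.
Proof.
rewrite /h; under eq_integral do rewrite EFinD.
rewrite ge0_integralD//; last 2 first.
- by apply/measurable_EFinP; exact: measurable_indic.
- by apply/measurable_EFinP; exact: measurable_indic.
by rewrite !integral_indic// !setIT mu_NU muUE -EFinD mulr_natl mulr2n.
Qed.

Let perturbed_feasible t : 0 < t -> feasible mu (perturbation psi h t) /\
  average mu (perturbation psi h t) = average mu psi + t * (2 * mass_U / mass).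
Proof.
move=> t0; have [[mpsi psi0 psiN] momfin] := fpsi.
have mh : measurable_fun setT (fun x => (t * h x)%:E).
  by apply/measurable_EFinP; exact: measurable_funM.
have th0 x : (0 <= (t * h x)%:E)%E by rewrite lee_fin mulr_ge0// ltW.
have momE : moment mu (perturbation psi h t) =
    (average mu psi * mass + t * (2 * mass_U))%:E.
  rewrite /moment /perturbation ge0_integralD//.
  rewrite -/(moment mu psi) (averageE mu_finite mu_neq0 fpsi) EFinD; congr (_ + _)%E.
  under eq_integral do rewrite EFinM.
  rewrite ge0_integralZl//; last 3 first.
  - exact/measurable_EFinP.
  - by move=> x _; rewrite lee_fin.
  - by rewrite lee_fin ltW.
  by rewrite moment_h EFinM.
split.
  split; last by rewrite momE ltry.
  split.
  - exact: emeasurable_funD.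
  - by move=> x; rewrite adde_ge0.
  - move=> x; rewrite /perturbation psiN /h !indicE; congr (_ + (_ * _)%:E)%E.
    have -> : (- x \in U) = (x \in NU) by apply/idP/idP => /set_mem ?; exact/mem_set.
    have -> : (- x \in NU) = (x \in U).
      by apply/idP/idP => /set_mem; rewrite /NU/= ?opprK => ?; apply/mem_set; rewrite //= opprK.
    by rewrite addrC.
by rewrite {1}/average momE/= mulrDl mulfK ?gt_eqF// -(mulrA t).
Qed.

(** The gain does not increase and the average grows by [t * (2 * mass_U / mass)], which bounds the
    growth of the energy; adding [kappa] multiplies both energies by [mass / e0]. *)
Let energy_perturbed t : 0 < t ->
  (E (exp_conjugate (perturbation normalized h t)) <=
   (mass * expR (2 * t * (2 * mass_U / mass)))%:E)%E.
Proof.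
move=> t0; have [fp avg] := perturbed_feasible t0.
have -> : perturbation normalized h t =
    (fun x => perturbation psi h t x + kappa%:E)%E.
  by apply/funext => x; rewrite /perturbation /normalized addeAC.
rewrite energy_shift; last exact: proper_perturbation.
have := gain_max fp; rewrite /gain avg -/e0 energy_feasible//=.
move: (fine _) => e.
set q := 2 * mass_U / mass.
rewrite mulrDr opprD expRD [expR (- _) * _]mulrC mulrA ler_pM2r ?expR_gt0//.
rewrite expRN ler_pdivrMr ?expR_gt0// => ee.
rewrite -EFinM lee_fin mulrAC -mulrA ler_pM2l// ler_pdivrMr//.
by rewrite [leRHS]mulrC -(mulrA 2).
Qed.

Lemma gradient_measure_open_le :
  (gradient_measure alpha proper_normalized U <= mu U)%E.
Proof.
have nN x : normalized (- x) = normalized x.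
  by have [[_ _ psiN] _] := fpsi; rewrite /normalized psiN.
have mU0 : 0 <= mass_U by exact: fine_ge0.
have q0 : 0 <= 2 * mass_U / mass by rewrite divr_ge0 ?mulr_ge0 ?(ltW mass_gt0).
have := euler_lagrange_le proper_normalized measurable_h h_ge0 h_lsc
  energy_normalized (ltW mass_gt0) q0 energy_perturbed.
(* The right side becomes [2 * mass_U]; by evenness the left side will be twice the measure of
   [U]. *)
rewrite mulrC divfK ?gt_eqF//.
pose w y := (riesz_potential alpha f y * (f y)%:E)%E.
have f0 y : 0 <= f y by exact: exp_conjugate_ge0.
have mf : measurable_fun setT f by exact: measurable_exp_conjugate.
have w0 y : (0 <= w y)%E by rewrite mule_ge0 ?lee_fin// riesz_potential_ge0.
have measurable_ind W : measurable W -> measurable_fun setT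
    (fun y => (\1_W (regular_gradient normalized y))%:E * w y)%E.
  move=> mW; apply: emeasurable_funM.
    apply/measurable_EFinP; apply: measurableT_comp.
      exact: measurable_indic.
    exact: measurable_regular_gradient.
  apply: emeasurable_funM; last exact/measurable_EFinP.
  exact: measurable_riesz_potential.
have -> : (\int[leb]_(y in regular_set normalized)
    ((h (regular_gradient normalized y))%:E * w y) =
    gradient_measure alpha proper_normalized U +
    gradient_measure alpha proper_normalized NU)%E.
  rewrite !(gradient_measure_indic alpha proper_normalized)// -ge0_integralD//.
  - apply: eq_integral => y _; rewrite /h EFinD ge0_muleDl// ?lee_fin//.
  - exact: measurable_regular_set.
  - by move=> y _; apply: mule_ge0 (w0 y); rewrite lee_fin.
  - apply: measurable_funTS; exact: measurable_ind.
  - by move=> y _; apply: mule_ge0 (w0 y); rewrite lee_fin.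
  - apply: measurable_funTS; exact: measurable_ind.
rewrite gradient_measureN// muUE.
have := measure_ge0 (gradient_measure alpha proper_normalized) U.
case: (gradient_measure _ _ _) => [r _|//|_ _]; last by rewrite leNye.
by rewrite -EFinD !lee_fin; lra.
Qed.

End test_set.

Lemma gradient_measure_eq A : measurable A ->
  gradient_measure alpha proper_normalized A = mu A.
Proof.
have mT : gradient_measure alpha proper_normalized setT = mass%:E.
  by rewrite (gradient_measureT alpha proper_normalized) energy_normalized.
apply: (le_open_measure_eq (m1 := gradient_measure alpha proper_normalized)).
- by rewrite [X in (X < _)%E]mT ltry.
- by rewrite [LHS]mT massE.
- exact: gradient_measure_open_le.
Qed.

Lemma LC_normalized : LC f.
Proof.
split.
- exact: exp_conjugate_log_concave.
- exact: exp_conjugate_usc.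
have mf : measurable_fun setT f by exact: measurable_exp_conjugate.
have f0 y : 0 <= f y by exact: exp_conjugate_ge0.
(* The integral is positive because the energy is, and finite by exponential decay. *)
apply/andP; split.
  rewrite lt0e integral_ge0// ?andbT; last by move=> x _; rewrite lee_fin.
  apply/eqP => /(riesz_energy_eq0 alpha n_gt0 mf f0).
  by rewrite energy_normalized => -[]; apply/eqP; rewrite gt_eqF.
pose k := c / mass; have k0 : 0 < k by rewrite divr_gt0.
pose C := expR kappa * expR (average mu psi).
have mE : measurable_fun setT (fun y : V => expR (- (k * `|y|))).
  apply: measurableT_comp => //; apply: measurable_funN.
  by apply: measurable_funM => //; exact: measurable_norm_rV.
apply: (@le_lt_trans _ _ (\int[leb]_y (C * expR (- (k * `|y|)))%:E)%E).
  apply: ge0_le_integral => //.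
  - by move=> x _; rewrite lee_fin.
  - exact/measurable_EFinP.
  - by apply/measurable_EFinP; exact: measurable_funM.
  move=> y _; rewrite lee_fin exp_conjugateD// /C -mulrA ler_pM2l ?expR_gt0//.
  exact: (exp_conjugate_decay mu_finite mu_neq0 c_gt0 mu_coercive).
under eq_integral do rewrite EFinM.
rewrite (ge0_integralZl leb)//; last 2 first.
- exact/measurable_EFinP.
- by rewrite lee_fin mulr_ge0// expR_ge0.
by rewrite lte_mul_pinfty ?lee_fin ?mulr_ge0 ?expR_ge0// exp_norm_lty.
Qed.

End solution.

Theorem theorem1p7 (R : realType) (n : nat) (hn : (1 <= n)%N)
    (alpha : R) (halpha : 0 < alpha)
    (mu : {measure set 'rV[R]_n -> \bar R})
    (mu_finite : (mu setT < +oo)%E)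
    (mu_neq0 : mu setT != 0%E)
    (mu_even : even_measure mu)
    (mu_subspace : forall W : {vspace 'rV[R]_n}, W != fullv ->
       ~ concentrated_in mu [set x | x \in W])
    (mu_moment : (\int[mu]_x (euclidean_norm x)%:E < +oo)%E) :
  exists f : 'rV[R]_n -> R,
    [/\ LC f,
        riesz_energy alpha f = (\int[mu]_x 1)%E &
        forall A : set 'rV[R]_n, measurable A ->
          mu A = riesz_energy_measure alpha f A].
Proof.
have [c c0 mu_coercive] := abs_moment_coercive mu_subspace mu_moment.
have [psi [fpsi gpsi maxpsi]] :=
  gain_maximizer hn halpha mu_finite mu_neq0 mu_moment c0 mu_coercive.
have ppsi := feasible_proper mu_neq0 fpsi.
exists (exp_conjugate (normalized alpha mu psi)); split.
- exact: (LC_normalized hn halpha mu_finite mu_neq0 c0 mu_coercive fpsi gpsi).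
- rewrite (energy_normalized hn halpha mu_finite mu_neq0 c0 mu_coercive fpsi gpsi).
  by rewrite (integral_cst_mass mu_finite ler01) mul1r.
move=> A mA; have pn : proper (normalized alpha mu psi) by exact: properD.
rewrite (riesz_energy_measureE alpha pn mA); apply/esym.
exact: (gradient_measure_eq hn halpha mu_finite mu_neq0 mu_even c0
  mu_coercive fpsi gpsi maxpsi).
Qed.
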